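(* Assume the network assumption, the stochastic gradient assumption and the smoothness assumption (with constant $L$) stated in the context, and that there is no compression, i.e. $C=0$ (the compressor is the identity). Assume further that for some $q>0$, $$\|\mathbf{x}_{-1}\|^2=\|H_0\|^2=\mathcal{O}(n^2),\qquad\|\nabla F(\mathbf{x}_{-1})\|^2=\mathcal{O}(n^2),\qquad\frac{1}{1-\lambda_2}=\mathcal{O}(n^q).$$ Choose $\alpha=1/4$, $\gamma=1/8$, let $\Delta_0=f(\bar x_{-1})-f^{\inf}$, and run CEDAS with the constant stepsize $$\eta_k=\eta=\frac{1}{\sqrt{\frac{L\sigma^2K}{n\Delta_0}}+\frac{32L}{\gamma(1-\lambda_2)}}.$$ Then the transient time of CEDAS (defined in the context) becomes $$K_T^{(ncvx)}=\mathcal{O}\left(\frac{n^3}{(1-\lambda_2)^2}\right).$$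
   Context: Notation. There are $n\ge2$ agents; $f_i:\mathbb{R}^p\to\mathbb{R}$ is differentiable, $f=\frac1n\sum_{i=1}^nf_i$, and $f^{\inf}=\inf_{x\in\mathbb{R}^p}f(x)$ (finite). For $\mathbf{x}\in\mathbb{R}^{n\times p}$ with $i$-th row $x_i^\top$, $\bar x=\frac1n\sum_ix_i$, and $\nabla F(\mathbf{x})\in\mathbb{R}^{n\times p}$ has $i$-th row $\nabla f_i(x_i)^\top$. $\mathbf{1}\in\mathbb{R}^n$ is the all-ones vector. $\|\cdot\|$ is the Euclidean norm of vectors and the Frobenius norm of matrices. Transient time. $K_T^{(ncvx)}=\inf\{K:\ \frac1k\sum_{t=0}^{k-1}\mathbb{E}[\|\nabla f(\bar x_t)\|^2]\le\mathcal{O}(1/\sqrt{nk})\ \text{for all }k\ge K\}$, where for each $k$ the iterates are those produced with the stepsize $\eta$ computed with horizon $K=k$. $\mathcal{O}(\cdot)$ hides factors independent of $n$, $1-\lambda_2$, the iteration count and all other displayed quantities (they may depend on e.g. $L,\sigma,\Delta_0$); an equality $K_T=\mathcal{O}(\cdot)$ is an upper bound in this sense. Network assumption. The communication graph on the agents is undirected and connected; $W=(w_{ij})\in\mathbb{R}^{n\times n}$ is symmetric, entrywise nonnegative, positive semidefinite, $W\mathbf{1}=\mathbf{1}$, and for $i\ne j$ one has $w_{ij}=w_{ji}>0$ if $i,j$ are linked and $w_{ij}=w_{ji}=0$ otherwise. Its eigenvalues are $1=\lambda_1>\lambda_2\ge\cdots\ge\lambda_n\ge0$. CEDAS. Given stepsizes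 $\eta_k>0$ ($k\ge-1$), parameters $\alpha,\gamma>0$, a compression operator $\mathcal{C}:\mathbb{R}^p\to\mathbb{R}^p$ applied row by row (here the identity), and deterministic $\mathbf{x}_{-1},H_0\in\mathbb{R}^{n\times p}$, set $D_0=0$, $\mathbf{x}_0=\mathbf{x}_{-1}-\eta_{-1}G_{-1}$, and for $k\ge0$: $\mathbf{y}_k=\mathbf{x}_k-\eta_kG_k-D_k$; $Q_k=\mathcal{C}(\mathbf{y}_k-H_k)$; $D_{k+1}=D_k+\frac\gamma2(I-W)(H_k+Q_k)$; $H_{k+1}=H_k+\alpha Q_k$; $\mathbf{x}_{k+1}=\mathbf{x}_k-\eta_kG_k-D_{k+1}$. Here $G_k$ has rows $g_{i,k}^\top$ with $g_{i,k}=\nabla f_i(x_{i,k};\xi_{i,k})$ the stochastic gradient, and $x_{i,k}^\top$ is the $i$-th row of $\mathbf{x}_k$. Stochastic gradient assumption. For all $k\ge-1$, conditionally on all randomness generated before the samples $\xi_{1,k},\dots,\xi_{n,k}$ are drawn, these samples are independent across $i$, $g_{i,k}$ has mean $\nabla f_i(x_{i,k})$, and $\|g_{i,k}-\nabla f_i(x_{i,k})\|^2$ has expectation at most $\sigma^2$ ($\sigma>0$). Smoothness assumption. Each $\nabla f_i$ is $L$-Lipschitz. *)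

(* Defs.v *)
From HB Require Import structures.
From mathcomp Require Export all_boot all_order all_algebra.
From mathcomp Require Export all_classical all_reals all_analysis.

Set Implicit Arguments.
Unset Strict Implicit.
Unset Printing Implicit Defensive.

Import Order.TTheory GRing.Theory Num.Theory.
Import numFieldNormedType.Exports.

Local Open Scope classical_set_scope.
Local Open Scope ring_scope.

(* The library norm [`|_|] on matrices is the sup norm, so the
   Euclidean/Frobenius norm is defined here.  Points of R^p are row vectors, and
   row [i] of an n x p matrix belongs to agent [i]. *)

Section Euclidean.
Context {R : realType}.

Definition sqnorm m p (A : 'M[R]_(m, p)) : R := \sum_i \sum_j A i j ^+ 2.

Definition enorm m p (A : 'M[R]_(m, p)) : R := Num.sqrt (sqnorm A).

Definition grad p (f : 'rV[R]_p -> R) (x : 'rV[R]_p) : 'rV[R]_p :=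
  \row_j 'D_(delta_mx 0 j) f x.

End Euclidean.

Section Objective.
Context {R : realType} (n p : nat).
Variable f : 'I_n -> 'rV[R]_p -> R.

Definition favg (x : 'rV[R]_p) : R := n%:R^-1 * \sum_i f i x.

Definition finf : R := inf (range favg).

Definition rowmean (x : 'M[R]_(n, p)) : 'rV[R]_p :=
  n%:R^-1 *: \sum_i row i x.

Definition gradF (x : 'M[R]_(n, p)) : 'M[R]_(n, p) :=
  \matrix_i grad (f i) (row i x).

Definition smooth (L : R) : Prop := forall i (x y : 'rV[R]_p),
  enorm (grad (f i) x - grad (f i) y) <= L * enorm (x - y).

End Objective.

Section Network.
Context {R : realType} (n : nat).

(* [lam] lists the eigenvalues with multiplicity, in nonincreasing order;
   thus lambda_1, lambda_2 are [lam`_0], [lam`_1]. *)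
Definition spectrum (W : 'M[R]_n) (lam : n.-tuple R) : Prop :=
  sorted >=%R lam /\ char_poly W = \prod_(l <- lam) ('X - l%:P).

Record network (e : rel 'I_n) (W : 'M[R]_n) (lam : n.-tuple R) : Prop := {
  network_undirected : symmetric e ;
  network_connected : forall i j, connect e i j ;
  network_sym : W^T = W ;
  network_ge0 : forall i j, 0 <= W i j ;
  network_psd : forall v : 'cV[R]_n, 0 <= (v^T *m W *m v) 0 0 ;
  network_stochastic : W *m const_mx 1 = const_mx 1 :> 'cV[R]_n ;
  network_edge : forall i j, i != j -> e i j -> 0 < W i j ;
  network_nonedge : forall i j, i != j -> ~~ e i j -> W i j = 0 ;
  network_spectrum : spectrum W lam ;
  network_lam1 : lam`_0 = 1 ;
  network_lam2 : lam`_1 < 1 ;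
  network_lam_ge0 : forall l, l \in lam -> 0 <= l }.

End Network.

(* Time is shifted by one for everything that starts at k = -1: index [s : nat]
   of a stepsize, a sample or a query point stands for k = s - 1. *)
Section Cedas.
Context {R : realType} (n p : nat) (Xi : 'I_n -> Type).
Variables (C : 'rV[R]_p -> 'rV[R]_p) (W : 'M[R]_n) (alpha gamma : R).
Variable eta : nat -> R.
(* [oracle i x s] is the stochastic gradient of f_i at x for the sample s *)
Variable oracle : forall i, 'rV[R]_p -> Xi i -> 'rV[R]_p.
Variables xm1 H0 : 'M[R]_(n, p).
Variable z : nat -> forall i, Xi i.

Record cedas_state := CedasState {
  cedas_x : 'M[R]_(n, p) ; cedas_D : 'M[R]_(n, p) ; cedas_H : 'M[R]_(n, p) }.

Definition stochgrad (x : 'M[R]_(n, p)) (s : nat) : 'M[R]_(n, p) :=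
  \matrix_i oracle (row i x) (z s i).

Definition compress (Y : 'M[R]_(n, p)) : 'M[R]_(n, p) :=
  \matrix_i C (row i Y).

Definition cedas_step (k : nat) (st : cedas_state) : cedas_state :=
  let: CedasState x D H := st in
  let G := stochgrad x k.+1 in
  let y := x - eta k.+1 *: G - D in
  let Q := compress (y - H) in
  let D' := D + (gamma / 2) *: ((1%:M - W) *m (H + Q)) in
  CedasState (x - eta k.+1 *: G - D') D' (H + alpha *: Q).

(* (x_k, D_k, H_k) for k >= 0 *)
Fixpoint cedas (k : nat) : cedas_state :=
  match k with
  | 0 => CedasState (xm1 - eta 0 *: stochgrad xm1 0) 0 H0
  | k'.+1 => cedas_step k' (cedas k')
  end.

(* x_{s-1} *)
Definition cedas_query (s : nat) : 'M[R]_(n, p) :=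
  match s with 0 => xm1 | k.+1 => cedas_x (cedas k) end.

End Cedas.

Section Conditional.
Context {R : realType} (d : measure_display) (T : measurableType d).
Variables (P : probability T R) (F : set (set T)).

(* Y is a version of E[X | F], for F a sub-sigma-algebra *)
Record cond_expectation (X Y : T -> R) : Prop := {
  cond_expectation_integrable : P.-integrable setT (EFin \o X) ;
  cond_expectation_integrable_version : P.-integrable setT (EFin \o Y) ;
  cond_expectation_measurable :
    forall B : set R, measurable B -> F (Y @^-1` B) ;
  cond_expectation_int : forall A, F A ->
    (\int[P]_(w in A) (Y w)%:E = \int[P]_(w in A) (X w)%:E)%E }.

(* Conditional expectations are unique up to null sets, so the choice of the
   versions [Y i] is immaterial; subfamilies are covered by [B i = setT]. *)
Definition cond_independent (n : nat) (d' : measure_display)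
    (Xi : 'I_n -> measurableType d') (X : forall i, T -> Xi i) : Prop :=
  forall B : forall i, set (Xi i), (forall i, measurable (B i)) ->
  exists Y : 'I_n -> T -> R,
    (forall i, cond_expectation (\1_(X i @^-1` B i)) (Y i)) /\
    cond_expectation (fun w => \prod_i \1_(X i @^-1` B i) w)
                     (fun w => \prod_i Y i w).

End Conditional.

Section StochasticGradient.
Context {R : realType} (n p : nat).
Context (d dX : measure_display) (T : measurableType d).
Variable P : probability T R.
Variable Xi : 'I_n -> measurableType dX.

(* The initialization is deterministic and the compressor is the identity, so
   the randomness generated before the samples of index [s] is exactly that of
   the samples of smaller index. *)
Definition past (xi : forall i, nat -> T -> Xi i) (s : nat) : set (set T) :=
  <<s [set A | exists i t (B : set (Xi i)),
         [/\ (t < s)%N, measurable B & A = xi i t @^-1` B] ] >>.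

(* Joint measurability in (x, sample), with R^p carrying the Borel
   sigma-algebra of the library type [p.-tuple R]. *)
Definition measurable_oracle (oracle : forall i, 'rV[R]_p -> Xi i -> 'rV[R]_p) :
    Prop :=
  forall i j, measurable_fun [set: p.-tuple R * Xi i]
    (fun u => oracle i (\row_l tnth u.1 l) u.2 0 j).

Definition stochastic_gradient (f : 'I_n -> 'rV[R]_p -> R)
    (oracle : forall i, 'rV[R]_p -> Xi i -> 'rV[R]_p) (sigma : R)
    (x : nat -> T -> 'M[R]_(n, p)) (xi : forall i, nat -> T -> Xi i) : Prop :=
  let g i s w := oracle i (row i (x s w)) (xi i s w) in
  let m i s w := grad (f i) (row i (x s w)) in
  forall s, let F := past xi s in
  [/\ cond_independent P F (fun i => xi i s),
      forall i j,
        cond_expectation P F (fun w => g i s w 0 j) (fun w => m i s w 0 j)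
    & forall i, exists V : T -> R,
        cond_expectation P F (fun w => sqnorm (g i s w - m i s w)) V /\
        {ae P, forall w, V w <= sigma ^+ 2} ].

End StochasticGradient.

Section TransientTime.
Context {R : realType}.

Definition avg_stationarity n p (d : measure_display) (T : measurableType d)
    (P : probability T R) (f : 'I_n -> 'rV[R]_p -> R)
    (x : nat -> T -> 'M[R]_(n, p)) (k : nat) : \bar R :=
  ((k%:R^-1)%:E *
   \sum_(t < k) 'E_P[fun w => sqnorm (grad (favg f) (rowmean (x t w)))])%E.

(* [A] is the constant hidden in the O(1 / sqrt (n k)) of the definition, and
   [avg k] the average over the first k iterates of the run of horizon k; the
   value is +oo when no such K exists. *)
Definition transient_time (A : R) (n : nat) (avg : nat -> \bar R) : \bar R :=
  ereal_inf [set K%:R%:E | K in [set K : nat | (0 < K)%N /\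
    forall k, (K <= k)%N -> (avg k <= (A / Num.sqrt (n * k)%:R)%:E)%E]].

Definition cedas_stepsize (n : nat) (L sigma Delta0 gamma lam2 : R) (K : nat) :
    R :=
  (Num.sqrt (L * sigma ^+ 2 * K%:R / (n%:R * Delta0))
   + 32 * L / (gamma * (1 - lam2)))^-1.

End TransientTime.

(* Main.v *)
Require Import Defs.
From mathcomp Require Import ring lra measurable_realfun.

(** Write J for the averaging matrix, M = (gamma / 2)(1 - W), h for the stepsize
and y_k = x_k - h G_k - D_k.  Since the compressor is the identity,
H_k + Q_k = y_k, so H_k drops out and a step of the algorithm is
x_(k+1) = (1 - M) y_k, D_(k+1) = D_k + M y_k.

The mean.  M kills constants and D_k has mean zero, so the mean of the rows of
x_k performs a stochastic gradient step on the average objective f.  The descent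
lemma for f bounds h / 2 times the sum of the squared gradients at the mean by
the optimality gap, plus h L^2 / (2 n) times the consensus errors
|x_k - J x_k|^2, plus L h^2 / 2 times the variances of the averaged noises.
These variances are at most sigma^2 / n because the noises of distinct agents
are uncorrelated, which is where conditional independence enters
(cond_indep_uncorrelated).

The deviation from the mean.  The dual variable D_k tracks -h g, where g is the
centred gradient of F at the mean.  Let X be the centred x_k, E = D_k + h g, and
B the pseudo-inverse of M.  On the eigenvector of M for the eigenvalue m, a step
without noise and without motion of the mean maps (X, E) to
((1 - m)(X - E), (1 - m) E + m X), up to a perturbation by the variation of the
gradients.  This map has determinant 1 - m, and it multiplies the quadratic form
X^2 + (1/m - 1) E^2 by exactly 1 - m (lyap_unforced).  Hence V = |X|^2 + <E, B E> - |E|^2 contracts by 1 - rho / 4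
(lyap_step), where rho = (1 - lambda_2) / 16 bounds M from below on centred
vectors.  As V dominates |X|^2 with constant 1, the noise, which adds h^2 n
sigma^2 to V at each step, costs a single factor 1 / (1 - lambda_2).  The motion
of the mean adds a term of order h^4 L^2 n |mean gradient|^2 / rho^2, which the
negative term of the descent inequality absorbs since h L <= rho / 16.  The
initial value of V is O(n^2).

The spectral bound is the variational characterization of the second eigenvalue
(rayleigh): a maximizer of the quadratic form of W on the unit sphere of the
centred vectors is an eigenvector, and connectedness of the graph forbids its
eigenvalue to be 1.

The rate.  Summing both inequalities over a run of horizon K and inserting the
stepsize (stationarity_bound, stepsize_bound), the average squared gradient is
at most 4 sigma sqrt (L Delta0) / sqrt (n K) + C n / (rho K), where C depends
only on L, Delta0 and the constants of the initial conditions.  The second term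
is below 1 / sqrt (n K) as soon as K >= C^2 n^3 / rho^2 =
256 C^2 n^3 / (1 - lambda_2)^2 (transient_bound). *)

Import Order.TTheory GRing.Theory Num.Theory.
Import numFieldNormedType.Exports.
Local Open Scope classical_set_scope.
Local Open Scope ring_scope.

Set Implicit Arguments.
Unset Strict Implicit.
Unset Printing Implicit Defensive.

(** * Expectations, and orthogonality to a sub-sigma-algebra *)

Section Expectation.
Context {R : realType} {d : measure_display} {T : measurableType d}.
Variable P : probability T R.
Implicit Types (X Y : T -> R) (A : set T) (a : R).

Definition intble (X : T -> R) := P.-integrable setT (EFin \o X).

Definition Ex (X : T -> R) : R := \int[P]_w X w.

Lemma intble_meas X : intble X -> measurable_fun setT X.
Proof. by move=> /measurable_int /measurable_EFinP. Qed.

Lemma intbleD X Y : intble X -> intble Y -> intble (fun w => X w + Y w).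
Proof.
move=> iX iY; have := integrableD measurableT iX iY.
by apply: eq_integrable => // w _; rewrite /= EFinD.
Qed.

Lemma intbleN X : intble X -> intble (fun w => - X w).
Proof.
move=> iX; have := integrableN iX.
by apply: eq_integrable => // w _; rewrite /= EFinN.
Qed.

Lemma intbleB X Y : intble X -> intble Y -> intble (fun w => X w - Y w).
Proof. by move=> iX iY; apply: intbleD => //; apply: intbleN. Qed.

Lemma intbleZ a X : intble X -> intble (fun w => a * X w).
Proof.
move=> iX; have := integrableZl measurableT a iX.
by apply: eq_integrable => // w _; rewrite /= EFinM.
Qed.

Lemma intble_cst a : intble (fun=> a).
Proof. exact: finite_measure_integrable_cst. Qed.

Lemma intble_sum (I : Type) (r : seq I) (Q : pred I) (X : I -> T -> R) :
  (forall i, Q i -> intble (X i)) ->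
  intble (fun w => \sum_(i <- r | Q i) X i w).
Proof.
move=> iX; elim: r => [|i r IH].
  by under [X in intble X]eq_fun do rewrite big_nil; exact: intble_cst.
case Qi : (Q i); last by under [X in intble X]eq_fun do rewrite big_cons Qi.
under [X in intble X]eq_fun do rewrite big_cons Qi.
by apply: intbleD => //; apply: iX.
Qed.

Lemma intble_le X Y : measurable_fun setT X -> intble Y ->
  (forall w, `|X w| <= Y w) -> intble X.
Proof.
move=> mX iY XY; apply: (le_integrable measurableT _ _ iY).
  exact/measurable_EFinP.
move=> w _ /=; rewrite lee_fin (le_trans (XY w))// ler_norm //.
Qed.

Lemma intble_abs X : intble X -> intble (fun w => `|X w|).
Proof. by move=> iX; have := integrable_abse iX; apply: eq_integrable. Qed.

Lemma intbleM01 X Y : intble X -> measurable_fun setT Y ->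
  (forall w, 0 <= Y w <= 1) -> intble (fun w => X w * Y w).
Proof.
move=> iX mY Y01; apply: (intble_le _ (intble_abs iX)).
  by apply: measurable_funM => //; exact: intble_meas.
by move=> w; rewrite normrM ler_piMr// ger0_norm; case/andP: (Y01 w).
Qed.

Lemma intble01 Y : measurable_fun setT Y -> (forall w, 0 <= Y w <= 1) ->
  intble Y.
Proof.
move=> mY Y01; have := intbleM01 (intble_cst 1) mY Y01.
by under [X in intble X]eq_fun do rewrite mul1r.
Qed.

Lemma indic01 A w : 0 <= (\1_A w : R) <= 1.
Proof. by rewrite indicE; case: (_ \in _); rewrite /= ?lexx ?ler01. Qed.

Lemma intble_indic A : measurable A -> intble (\1_A : T -> R).
Proof.
by move=> mA; apply: (intble01 (measurable_indic mA)) => w; exact: indic01.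
Qed.

Lemma intble_indicM X A : measurable A -> intble X ->
  intble (fun w => X w * \1_A w).
Proof.
move=> mA iX; apply: (intbleM01 iX (measurable_indic mA)) => w.
exact: indic01.
Qed.

Lemma ExD X Y : intble X -> intble Y -> Ex (fun w => X w + Y w) = Ex X + Ex Y.
Proof. by move=> iX iY; rewrite /Ex RintegralD. Qed.

Lemma ExB X Y : intble X -> intble Y -> Ex (fun w => X w - Y w) = Ex X - Ex Y.
Proof. by move=> iX iY; rewrite /Ex RintegralB. Qed.

Lemma ExZ a X : intble X -> Ex (fun w => a * X w) = a * Ex X.
Proof. by move=> iX; rewrite /Ex RintegralZl. Qed.

Lemma Ex_cst a : Ex (fun=> a) = a.
Proof. by rewrite /Ex Rintegral_cst//= probability_setT mulr1. Qed.

Lemma Ex_sum (I : Type) (r : seq I) (Q : pred I) (X : I -> T -> R) :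
  (forall i, Q i -> intble (X i)) ->
  Ex (fun w => \sum_(i <- r | Q i) X i w) = \sum_(i <- r | Q i) Ex (X i).
Proof.
move=> iX; elim: r => [|i r IH].
  by under [X in Ex X]eq_fun do rewrite big_nil; rewrite Ex_cst big_nil.
rewrite big_cons; case Qi : (Q i); last first.
  by under [X in Ex X]eq_fun do rewrite big_cons Qi.
under [X in Ex X]eq_fun do rewrite big_cons Qi.
by rewrite ExD ?IH//; [exact: iX|exact: intble_sum].
Qed.

Lemma le_Ex X Y : intble X -> intble Y -> (forall w, X w <= Y w) ->
  Ex X <= Ex Y.
Proof. by move=> iX iY XY; apply: le_Rintegral => // w _. Qed.

Lemma Ex_ge0 X : (forall w, 0 <= X w) -> 0 <= Ex X.
Proof. by move=> X0; apply: Rintegral_ge0. Qed.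

Lemma EFin_Ex X : intble X -> (\int[P]_w (X w)%:E = (Ex X)%:E)%E.
Proof. by move=> iX; rewrite /Ex /Rintegral fineK//; exact: integrable_fin_num. Qed.

Lemma Ex_indic X A : Ex (fun w => X w * \1_A w) = \int[P]_(w in A) X w.
Proof.
rewrite Rintegral_mkcond; congr Rintegral; apply/funext => w.
by rewrite patchE indicE; case: (_ \in _); rewrite ?mulr1 ?mulr0.
Qed.

Lemma Ex_ae X Y : measurable_fun setT X -> measurable_fun setT Y ->
  {ae P, forall w, X w = Y w} -> Ex X = Ex Y.
Proof.
move=> mX mY XY; rewrite /Ex /Rintegral; congr fine.
apply: ae_eq_integral => //; try exact/measurable_EFinP.
by apply: filterS XY => w /= -> _.
Qed.

Lemma Ex_le_ae X a : intble X -> {ae P, forall w, X w <= a} -> Ex X <= a.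
Proof.
move=> iX Xa; have mX := intble_meas iX.
(* Y equals X almost everywhere and is bounded by a everywhere *)
pose Y w := Num.min (X w) a.
have mY : measurable_fun setT Y by exact: measurable_minr.
have iY : intble Y.
  apply: (intble_le mY (intbleD (intble_abs iX) (intble_cst `|a|))) => w.
  rewrite /Y; case: (leP (X w) a) => _; first by rewrite lerDl.
  by rewrite lerDr.
rewrite (Ex_ae (Y := Y))//.
  rewrite -[leRHS]Ex_cst; apply: le_Ex => //; first exact: intble_cst.
  by move=> w; rewrite /Y ge_min lexx orbT.
by apply: filterS Xa => w h; rewrite /Y min_l.
Qed.

End Expectation.

Section SubAlgebra.
Context {R : realType} {d : measure_display} {T : measurableType d}.
Variable P : probability T R.
Implicit Types (G : set (set T)) (X Y Z : T -> R).

(** Membership of the preimages in <<s G>> is phrased as measurability on the type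
carrying the sigma-algebra <<s G>>, so that the measurability lemmas of all the
usual operations apply to functions of the past. *)
Definition gmeas G (Y : T -> R) :=
  measurable_fun [set: g_sigma_algebraType G] (Y : g_sigma_algebraType G -> R).

(** The equation E[X | <<s G>>] = 0 in integrated form.  A conditional expectation
Y of X is thus a <<s G>>-measurable Y such that X - Y is orthogonal to G; no
version has to be chosen. *)
Definition orth G X := forall A, <<s G >> A -> Ex P (fun w => X w * \1_A w) = 0.

Lemma gmeasP G Y :
  gmeas G Y <-> (forall B, measurable B -> <<s G >> (Y @^-1` B)).
Proof.
split=> [mY B mB|h _ B mB]; last by rewrite setTI; exact: h.
by have := mY measurableT B mB; rewrite setTI.
Qed.

Lemma sub_gmeas G G' Y : <<s G >> `<=` <<s G' >> -> gmeas G Y -> gmeas G' Y.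
Proof. by move=> GG' /gmeasP mY; apply/gmeasP => B mB; apply: GG'; exact: mY. Qed.

Lemma gmeas_meas G Y : <<s G >> `<=` measurable -> gmeas G Y ->
  measurable_fun setT Y.
Proof.
by move=> GT /gmeasP mY _ B mB; rewrite setTI; apply: GT; exact: mY.
Qed.

Section orthogonality.
Import HBSimple HBNNSimple.
Variable G : set (set T).
Hypothesis GT : <<s G >> `<=` measurable.

Let orth_mul_ge0 X Z : intble P X -> orth G X -> gmeas G Z ->
  (forall w, 0 <= Z w) -> intble P (fun w => X w * Z w) ->
  Ex P (fun w => X w * Z w) = 0.
Proof.
move=> iX oX mZ Z0 iXZ.
pose S : measurableType _ := g_sigma_algebraType G.
have mZ' : measurable_fun [set: S] (EFin \o (Z : S -> R)).
  exact/measurable_EFinP.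
pose g_ := nnsfun_approx (T := S) measurableT mZ'.
(* a simple function as a finite combination of indicators *)
have gE n w : g_ n w = \sum_(y <- finmap.enum_fset (fset_set (range (g_ n))))
    y * \1_(g_ n @^-1` [set y]) w.
  by rewrite (fimfunE (g_ n) w) fsbig_finite.
have mg n y : <<s G >> (g_ n @^-1` [set y]).
  exact: (measurable_sfunP (g_ n)).
have ig n y : intble P (fun w => X w * \1_(g_ n @^-1` [set y]) w).
  by apply: intble_indicM => //; apply: GT; exact: mg.
have Xg0 n : Ex P (fun w => X w * g_ n w) = 0.
  under [X in Ex P X]eq_fun => w.
    rewrite gE mulr_sumr; under eq_bigr do rewrite mulrCA.
    over.
  rewrite Ex_sum; last by move=> i _; exact: intbleZ.
  by rewrite big1 // => y _; rewrite ExZ // oX ?mulr0.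
have iXg n : intble P (fun w => X w * g_ n w).
  under [X in intble P X]eq_fun => w.
    rewrite gE mulr_sumr; under eq_bigr do rewrite mulrCA.
    over.
  by apply: intble_sum => y _; exact: intbleZ.
have cg w : EFin \o g_^~ w @ \oo --> (Z w)%:E.
  by apply: (cvg_nnsfun_approx (T := S)) => // x _; rewrite lee_fin.
have gle n w : g_ n w <= Z w.
  rewrite -lee_fin /g_ nnsfun_approxE.
  by apply: (le_approx (T := S)) => // x _; rewrite lee_fin.
have [] := @dominated_convergence _ T R P setT measurableT
  (fun n w => (X w * g_ n w)%:E) (fun w => (X w * Z w)%:E)
  (fun w => (`|X w * Z w|)%:E).
- by move=> n; apply/measurable_EFinP; exact: intble_meas (iXg n).
- by apply/measurable_EFinP; exact: intble_meas iXZ.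
- apply: aeW => w _; under eq_fun do rewrite EFinM.
  by rewrite EFinM; apply: cvgeZl => //; exact: cg.
- exact: intble_abs.
- apply: aeW => w n _ /=; rewrite lee_fin !normrM ler_wpM2l//.
  by rewrite !ger0_norm.
move=> _ _.
have -> : [sequence (\int[P]_x (X x * g_ n x)%:E)%E]_n = fun=> 0%E.
  by apply/funext => n /=; rewrite EFin_Ex// Xg0.
rewrite EFin_Ex// => /(cvg_unique (@ereal_hausdorff R)).
by move=> /(_ _ (cvg_cst _)) [].
Qed.

(** Orthogonality to indicators extends linearly to simple functions, then to
nonnegative Z by dominated convergence along the standard increasing
approximation of Z by simple functions, the integrand being dominated by |X Z|;
the positive and negative parts of Z are treated separately. *)
Lemma orth_mul X Z : intble P X -> orth G X -> gmeas G Z ->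
  intble P (fun w => X w * Z w) -> Ex P (fun w => X w * Z w) = 0.
Proof.
move=> iX oX mZ iXZ.
have mX := intble_meas iX; have mZT := gmeas_meas GT mZ.
have habs := intble_abs iXZ.
have i1 : intble P (fun w => X w * Num.max (Z w) 0).
  apply: (intble_le _ habs).
    by apply: measurable_funM => //; exact: measurable_maxr.
  move=> w; rewrite !normrM ler_wpM2l//.
  by case: (leP (Z w) 0) => // _; rewrite normr0.
have i2 : intble P (fun w => X w * Num.max (- Z w) 0).
  apply: (intble_le _ habs).
    apply: measurable_funM => //; apply: measurable_maxr => //.
    exact: measurableT_comp.
  move=> w; rewrite !normrM ler_wpM2l//.
  by case: (leP (- Z w) 0) => // _; rewrite ?normr0 ?normrN.
have -> : (fun w => X w * Z w) =
    (fun w => X w * Num.max (Z w) 0 - X w * Num.max (- Z w) 0).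
  apply/funext => w; rewrite -mulrBr; congr (_ * _).
  by case: (leP (Z w) 0) => ?; case: (leP (- Z w) 0) => ?; lra.
rewrite ExB// !orth_mul_ge0 ?subrr//.
- apply: measurable_maxr => //.
  exact: measurable_funN mZ.
- by move=> w; rewrite le_max lexx orbT.
- exact: measurable_maxr.
- by move=> w; rewrite le_max lexx orbT.
Qed.

(** The measurable sets over which X integrates to 0 form a Dynkin system:
complements use the integral of X over the whole space, countable disjoint unions
use sigma-additivity of the integral.  The pi-lambda theorem then extends the
vanishing from a pi-system to the sigma-algebra that it generates. *)
Lemma orth_pi_system X : intble P X -> setI_closed G -> G setT ->
  (forall A, G A -> Ex P (fun w => X w * \1_A w) = 0) -> orth G X.
Proof.
move=> iX GI GsetT X0.
have Ei A : measurable A ->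
    (\int[P]_(w in A) (X w)%:E = (Ex P (fun w => X w * \1_A w))%:E)%E.
  move=> mA; rewrite Ex_indic /Rintegral fineK//.
  by apply: integrable_fin_num => //; exact: integrableS iX.
suff : <<s G >> `<=`
    [set A | measurable A /\ Ex P (fun w => X w * \1_A w) = 0].
  by move=> h A /h[].
apply: lambda_system_subset => //; last first.
  by move=> A GA; split; [apply: GT; exact: sub_sigma_algebra|exact: X0].
apply/dynkin_lambda_system; split => [|A [mA A0]|F tF hF] /=.
- by split => //; exact: X0.
- split; first exact: measurableC.
  have -> : (fun w => X w * \1_(~` A) w) =
      (fun w => X w * \1_setT w - X w * \1_A w).
    apply/funext => w; rewrite -mulrBr; congr (_ * _).
    rewrite !indicE in_setT in_setC; by case: (_ \in _); rewrite /= ?subrr ?subr0.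
  rewrite ExB; [|exact: intble_indicM|exact: intble_indicM].
  by rewrite A0 X0// subr0.
- have mF : measurable (\bigcup_k F k).
    by apply: bigcupT_measurable => k; case: (hF k).
  split => //; apply/eqP; rewrite -eqe -Ei// integral_bigcup//.
  + rewrite eseries0// => k _ _; have [mk k0] := hF k.
    by rewrite Ei// k0.
  + by move=> k; case: (hF k).
  + exact: integrableS iX.
Qed.

End orthogonality.
End SubAlgebra.

(** * Versions of conditional expectations *)

Section Versions.
Context {R : realType} {d : measure_display} {T : measurableType d}.
Variables (P : probability T R) (G : set (set T)).
Hypothesis GT : <<s G >> `<=` measurable.
Implicit Types (X Y Z : T -> R).

Lemma Ex_eq0_ae X : intble P X -> (forall w, 0 <= X w) -> Ex P X = 0 ->
  {ae P, forall w, X w = 0}.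
Proof.
move=> iX X0 E0; have mX := intble_meas iX.
have : (\int[P]_w `|(X w)%:E| = 0)%E.
  rewrite -[RHS]/(0%:E) -E0 -EFin_Ex//; apply: eq_integral => w _.
  by rewrite gee0_abs ?lee_fin.
move/(ae_eq_integral_abs P measurableT).
move=> /(_ (iffRL (measurable_EFinP _ _) mX)).
by apply: filterS => w /(_ I) [].
Qed.

Lemma orthB_Ex X Y A : intble P X -> intble P Y -> orth P G (X \- Y) ->
  <<s G >> A -> Ex P (fun w => X w * \1_A w) = Ex P (fun w => Y w * \1_A w).
Proof.
move=> iX iY o sA; apply/eqP; rewrite -subr_eq0 -ExB; last 2 first.
- exact/intble_indicM/iX/GT.
- exact/intble_indicM/iY/GT.
rewrite -[X in _ == X](o _ sA); apply/eqP; congr Ex; apply/funext => w /=.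
by rewrite mulrBl.
Qed.

Lemma Ex_orthB X Y : intble P X -> intble P Y ->
  (forall A, <<s G >> A ->
     Ex P (fun w => X w * \1_A w) = Ex P (fun w => Y w * \1_A w)) ->
  orth P G (X \- Y).
Proof.
move=> iX iY o A sA.
under [Z in Ex P Z]eq_fun do rewrite mulrBl.
rewrite ExB ?o ?subrr//; [exact/intble_indicM/iX/GT|exact/intble_indicM/iY/GT].
Qed.

Lemma gmeas_le_set Y (a : R) : gmeas G Y -> <<s G >> [set w | a < Y w].
Proof.
move=> /gmeasP /(_ `]a, +oo[%classic (measurable_itv _)).
by congr (<<s G >> _); apply/seteqP; split=> w /=; rewrite in_itv/= andbT.
Qed.

(** The excess (Y - X) 1_(Y > a) is nonnegative, as X <= a, and has expectation 0,
as the event Y > a belongs to the sigma-algebra; so the event is negligible. *)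
Lemma orth_le_ae X Y (a : R) : intble P X -> intble P Y -> gmeas G Y ->
  orth P G (X \- Y) -> (forall w, X w <= a) -> {ae P, forall w, Y w <= a}.
Proof.
move=> iX iY mY o Xa; pose A := [set w | a < Y w].
have sA : <<s G >> A by exact: gmeas_le_set.
have iA : intble P (fun w => (Y w - X w) * \1_A w).
  by apply: intble_indicM; [exact: GT|exact: intbleB].
have := Ex_eq0_ae iA.
have h w : 0 <= (Y w - X w) * \1_A w.
  rewrite indicE; have [|] := boolP (w \in A); last by rewrite mulr0.
  by rewrite inE /A /= mulr1 => ?; have := Xa w; lra.
move=> /(_ h); have -> : Ex P (fun w => (Y w - X w) * \1_A w) = 0.
  under [Z in Ex P Z]eq_fun do rewrite mulrBl.
  rewrite ExB; [|exact/intble_indicM/iY/GT|exact/intble_indicM/iX/GT].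
  by rewrite (orthB_Ex iX iY o sA) subrr.
move=> /(_ erefl); apply: filterS => w.
case: (leP (Y w) a) => // aY; rewrite indicE mem_set// mulr1.
by have := Xa w; lra.
Qed.

Lemma orth_unique X Y Z : intble P X -> intble P Y -> intble P Z ->
  gmeas G Y -> gmeas G Z ->
  orth P G (X \- Y) -> orth P G (X \- Z) -> {ae P, forall w, Y w = Z w}.
Proof.
move=> iX iY iZ mY mZ oY oZ.
have iYZ : intble P (fun w => Y w - Z w) by exact: intbleB.
have iZY : intble P (fun w => Z w - Y w) by exact: intbleB.
have i0 : intble P (fun=> 0) by exact: intble_cst.
have o1 Y' Z' : intble P Y' -> intble P Z' -> orth P G (X \- Y') ->
    orth P G (X \- Z') -> orth P G (cst 0 \- (fun w => Y' w - Z' w)).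
  move=> iY' iZ' oY' oZ'; apply: Ex_orthB => //; first exact: intbleB.
  move=> A sA; under [V in _ = Ex P V]eq_fun do rewrite mulrBl.
  rewrite ExB; [|exact/intble_indicM/iY'/GT|exact/intble_indicM/iZ'/GT].
  rewrite -(orthB_Ex iX iY' oY' sA) -(orthB_Ex iX iZ' oZ' sA) subrr.
  by under [V in Ex P V]eq_fun do rewrite mul0r; rewrite Ex_cst.
have := orth_le_ae (a := 0) i0 iYZ (measurable_funB mY mZ) (o1 _ _ iY iZ oY oZ).
move=> /(_ (fun=> lexx _)).
have := orth_le_ae (a := 0) i0 iZY (measurable_funB mZ mY) (o1 _ _ iZ iY oZ oY).
move=> /(_ (fun=> lexx _)).
by apply: filterS2 => w ? ?; lra.
Qed.

Lemma cond_expectation_orth X Y : cond_expectation P <<s G >> X Y ->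
  [/\ intble P X, intble P Y, gmeas G Y & orth P G (X \- Y)].
Proof.
case=> iX iY mY eXY; split => //; first exact/gmeasP.
apply: Ex_orthB => // A sA.
by rewrite !Ex_indic /Rintegral eXY.
Qed.

(** Conditional expectations of indicators take values in [0, 1] only almost
everywhere.  Clipping gives a version bounded everywhere, by which any
integrable function can be multiplied. *)
Lemma orth_clip X Y : intble P X -> intble P Y -> gmeas G Y ->
  orth P G (X \- Y) -> (forall w, 0 <= X w <= 1) ->
  let Y' := fun w => Num.min (Num.max (Y w) 0) 1 in
  [/\ gmeas G Y', (forall w, 0 <= Y' w <= 1), intble P Y',
    {ae P, forall w, Y w = Y' w} & orth P G (X \- Y')].
Proof.
move=> iX iY mY o X01 Y'.
have Y'01 w : 0 <= Y' w <= 1.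
  by rewrite /Y' le_min ge_min le_max !lexx ler01 !orbT.
have mY' : gmeas G Y'.
  by apply: measurable_minr => //; apply: measurable_maxr.
have iY' : intble P Y' by apply: intble01 => //; exact: gmeas_meas mY'.
have aeY : {ae P, forall w, Y w = Y' w}.
  have h1 : {ae P, forall w, Y w <= 1}.
    by apply: orth_le_ae o _ => // w; case/andP: (X01 w).
  have h2 : {ae P, forall w, - Y w <= 0}.
    apply: (@orth_le_ae (fun w => - X w)) => //.
    - exact: intbleN.
    - exact: intbleN.
    - exact: measurable_funN.
    - move=> A sA; rewrite /= -[RHS]oppr0 -(o _ sA) -mulN1r -ExZ; last first.
        by apply: intble_indicM; [exact: GT|exact: intbleB].
      by congr Ex; apply/funext => w /=; ring.
    - by move=> w; case/andP: (X01 w) => ? ?; lra.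
  by apply: filterS2 h1 h2 => w ? ?; rewrite /Y' max_l ?min_l//; lra.
split => //; apply: Ex_orthB => // A sA; rewrite (orthB_Ex iX iY o sA).
apply: Ex_ae.
- exact/intble_meas/intble_indicM/iY/GT.
- exact/intble_meas/intble_indicM/iY'/GT.
by apply: filterS aeY => w ->.
Qed.

End Versions.

(** * Conditional independence makes the noises of distinct agents uncorrelated *)

Section Uncorrelated.
Context {R : realType} {d dX : measure_display} {T : measurableType d}.
Variables (P : probability T R) (G : set (set T)).
Hypothesis GT : <<s G >> `<=` measurable.
Variables (n : nat) (Xi : 'I_n -> measurableType dX) (xi : forall i, T -> Xi i).
Hypothesis mxi : forall i, measurable_fun setT (xi i).
Hypothesis indep : cond_independent P <<s G >> xi.

Let mI (i : 'I_n) (C : set (Xi i)) : measurable C -> measurable (xi i @^-1` C).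
Proof. by move=> mC; have := mxi measurableT mC; rewrite setTI. Qed.

Let ind01 (A : set T) w : 0 <= (\1_A w : R) <= 1. Proof. exact: indic01. Qed.

Let gmeas_indic (H : set (set T)) A : <<s H >> A -> gmeas H (\1_A : T -> R).
Proof. by move=> sA; apply: (@measurable_indic _ (g_sigma_algebraType H)). Qed.

(** The hypothesis is about the whole family; choosing the full space as event of
every other sample leaves a statement about two samples, because the conditional
probability of the full space is almost surely 1. *)
Lemma cond_indep_pair (i j : 'I_n) (C : set (Xi i)) (D : set (Xi j)) :
  i != j -> measurable C -> measurable D ->
  exists Y Z : T -> R,
    [/\ gmeas G Y, (forall w, 0 <= Y w <= 1) &
        orth P G (\1_(xi i @^-1` C) \- Y)] /\
    [/\ gmeas G Z, (forall w, 0 <= Z w <= 1),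
        orth P G (\1_(xi j @^-1` D) \- Z) &
        orth P G ((\1_(xi i @^-1` C) \* \1_(xi j @^-1` D)) \- (Y \* Z))].
Proof.
move=> ij mC mD.
(* the family of events: C for i, D for j, everything for the others *)
pose B0 : forall l, set (Xi l) := fun l => setT.
pose B1 := @eqtype.dfwith _ _ B0 i C.
pose B := @eqtype.dfwith _ _ B1 j D.
have Bj : B j = D by rewrite /B eqtype.dfwith_in.
have Bi : B i = C by rewrite /B eqtype.dfwith_out 1?eq_sym// /B1 eqtype.dfwith_in.
have Bl l : l != i -> l != j -> B l = setT.
  by move=> li lj; rewrite /B eqtype.dfwith_out 1?eq_sym// /B1 eqtype.dfwith_out 1?eq_sym.
have mB l : measurable (B l).
  have [->|lj] := eqVneq l j; first by rewrite Bj.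
  have [->|li] := eqVneq l i; first by rewrite Bi.
  by rewrite Bl//; exact: measurableT.
have [Y [hY hprod]] := indep mB.
have {}hY l := cond_expectation_orth GT (hY l).
have [ip iYp mYp oYp] := cond_expectation_orth GT hprod.
pose Y' l := fun w => Num.min (Num.max (Y l w) 0) 1.
have hY' l : [/\ gmeas G (Y' l), (forall w, 0 <= Y' l w <= 1), intble P (Y' l),
    {ae P, forall w, Y l w = Y' l w} & orth P G (\1_(xi l @^-1` B l) \- Y' l)].
  by have [a b c e] := hY l; apply: orth_clip.
have Y1 l : l != i -> l != j -> {ae P, forall w, Y l w = 1}.
  move=> li lj; have [a b c e] := hY l.
  apply: (orth_unique GT a b (intble_cst P 1) c) => //.
    exact: measurable_cst.
  move=> A sA; rewrite -[RHS](Ex_cst P 0); congr Ex; apply/funext => w /=.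
  by rewrite Bl// preimage_setT indicT subrr mul0r.
exists (Y' i), (Y' j).
have [mi bi iYi aei oi] := hY' i; have [mj bj iYj aej oj] := hY' j.
rewrite Bi in oi; rewrite Bj in oj.
split; split => //.
apply: Ex_orthB => //.
- by apply: intbleM01; [exact/intble_indic/mI|exact/measurable_indic/mI|].
- by apply: intbleM01 => //; exact: gmeas_meas mj.
move=> A sA.
have -> : (fun w => (\1_(xi i @^-1` C) \* \1_(xi j @^-1` D)) w * \1_A w) =
    (fun w => (\prod_l \1_(xi l @^-1` B l) w) * \1_A w :> R).
  apply/funext => w; rewrite (bigD1 i)//= (bigD1 j) 1?eq_sym//=.
  rewrite big1 ?mulr1 ?Bi ?Bj// => l /andP[li lj].
  by rewrite Bl// preimage_setT indicT.
rewrite (orthB_Ex GT ip iYp oYp sA).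
apply: Ex_ae.
- exact/intble_meas/intble_indicM/iYp/GT.
- apply: measurable_funM; last exact/measurable_indic/GT.
  exact: measurable_funM (gmeas_meas GT mi) (gmeas_meas GT mj).
have : {ae P, forall w, forall l, (l != i -> l != j -> Y l w = 1) /\
    Y l w = Y' l w}.
  apply: filter_forall => l; have [_ _ _ ael _] := hY' l.
  have [->|li] := eqVneq l i; first by apply: filterS aei => w.
  have [->|lj] := eqVneq l j; first by apply: filterS aej => w.
  by apply: filterS2 (Y1 l li lj) ael.
apply: filterS => w h; congr (_ * _).
rewrite (bigD1 i)//= (bigD1 j) 1?eq_sym//= big1 ?mulr1.
  by rewrite (h i).2 (h j).2.
by move=> l /andP[li lj]; rewrite (h l).1.
Qed.

(** A pi-system generating the sigma-algebra of the past and of the sample i. *)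
Definition past_with (i : 'I_n) : set (set T) :=
  [set S | exists A (C : set (Xi i)),
     [/\ <<s G >> A, measurable C & S = A `&` xi i @^-1` C] ].

Lemma past_with_sub i : <<s past_with i >> `<=` measurable.
Proof.
apply: smallest_sub; first exact: sigma_algebra_measurable.
move=> _ [A [C [sA mC ->]]]; apply: measurableI; [exact: GT|exact: mI].
Qed.

Lemma past_withT i : past_with i setT.
Proof.
exists setT, setT; split => //; last by rewrite setTI preimage_setT.
exact: (@measurableT _ (g_sigma_algebraType G)).
Qed.

Lemma past_withI i : setI_closed (past_with i).
Proof.
move=> _ _ [A [C [sA mC ->]]] [B [D [sB mD ->]]].
exists (A `&` B), (C `&` D); split.
- exact: (@measurableI _ (g_sigma_algebraType G)).
- exact: measurableI.
- by rewrite preimage_setI setIACA.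
Qed.

Lemma past_with_past i : <<s G >> `<=` <<s past_with i >>.
Proof.
move=> A sA; apply: sub_sigma_algebra; exists A, setT; split => //.
by rewrite preimage_setT setIT.
Qed.

Lemma past_with_sample i (C : set (Xi i)) : measurable C ->
  <<s past_with i >> (xi i @^-1` C).
Proof.
move=> mC; apply: sub_sigma_algebra; exists setT, C; split => //.
  exact: (@measurableT _ (g_sigma_algebraType G)).
by rewrite setTI.
Qed.

(** Given the past, the sample i carries no information on the sample j: centring
1_(xi_j in D) by its conditional probability Z given the past makes it
orthogonal to the larger sigma-algebra also containing the sample i.  On the
pi-system of the sets A and (xi_i in C) this is the product formula of
cond_indep_pair, in which Z multiplies 1_C - Y, itself orthogonal to the past. *)
Lemma cond_indep_orth (i j : 'I_n) (D : set (Xi j)) (Z : T -> R) :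
  i != j -> measurable D ->
  gmeas G Z -> (forall w, 0 <= Z w <= 1) -> orth P G (\1_(xi j @^-1` D) \- Z) ->
  orth P (past_with i) (\1_(xi j @^-1` D) \- Z).
Proof.
move=> ij mD mZ Z01 oZ.
have iD : intble P (\1_(xi j @^-1` D) : T -> R) by exact/intble_indic/mI.
have iZ : intble P Z by apply: intble01 => //; exact: gmeas_meas mZ.
apply: orth_pi_system.
- exact: past_with_sub.
- exact: intbleB.
- exact: past_withI.
- exact: past_withT.
move=> _ [A [C [sA mC ->]]].
have [Y [Z' [[mY Y01 oY] [mZ' Z'01 oZ' oYZ']]]] := cond_indep_pair ij mC mD.
have mA : measurable A by exact: GT.
have iC : intble P (\1_(xi i @^-1` C) : T -> R) by exact/intble_indic/mI.
have iZ' : intble P Z' by apply: intble01 => //; exact: gmeas_meas mZ'.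
have iY : intble P Y by apply: intble01 => //; exact: gmeas_meas mY.
have aeZ : {ae P, forall w, Z w = Z' w} by exact: (orth_unique GT iD).
have mi1 (S : set T) : measurable S -> measurable_fun setT (\1_S : T -> R).
  exact: measurable_indic.
have mZT : measurable_fun setT Z by exact: gmeas_meas mZ.
have mZ'T : measurable_fun setT Z' by exact: gmeas_meas mZ'.
have mYT : measurable_fun setT Y by exact: gmeas_meas mY.
have mCT := mi1 _ (mI mC); have mDT := mi1 _ (mI mD); have mAT := mi1 _ mA.
have -> : (fun w => (\1_(xi j @^-1` D) \- Z) w * \1_(A `&` xi i @^-1` C) w) =
    (fun w => (\1_(xi i @^-1` C) \* \1_(xi j @^-1` D)) w * \1_A w -
              (\1_(xi i @^-1` C) w * Z w) * \1_A w).
  by apply/funext => w; rewrite indicI /=; ring.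
rewrite ExB; last 2 first.
- by apply: intbleM01 => //=; apply: intbleM01.
- by apply: intbleM01 => //; apply: intbleM01.
rewrite (orthB_Ex GT _ _ oYZ' sA); last 2 first.
- by apply: intbleM01.
- by apply: intbleM01.
have -> : Ex P (fun w => \1_(xi i @^-1` C) w * Z w * \1_A w) =
    Ex P (fun w => \1_(xi i @^-1` C) w * (Z' w * \1_A w)).
  apply: Ex_ae.
  - by do 2?apply: measurable_funM.
  - by do 2?apply: measurable_funM.
  by apply: filterS aeZ => w ->; rewrite mulrA.
have iZA : intble P (fun w => Z' w * \1_A w) by apply: intbleM01.
have iYZA : intble P (fun w => (\1_(xi i @^-1` C) \- Y) w * (Z' w * \1_A w)).
  rewrite (_ : (fun w => _) = fun w => (Z' w * \1_A w) * \1_(xi i @^-1` C) w -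
    (Z' w * \1_A w) * Y w); last by apply/funext => w /=; ring.
  by apply: intbleB; apply: intbleM01.
have h : Ex P (fun w => (\1_(xi i @^-1` C) \- Y) w * (Z' w * \1_A w)) = 0.
  apply: (orth_mul GT _ oY) => //; first exact: intbleB.
  exact: measurable_funM mZ' (gmeas_indic sA).
apply/eqP; rewrite subr_eq0 eq_sym -subr_eq0 -ExB; last 2 first.
- by under [V in intble P V]eq_fun do rewrite mulrC; apply: intbleM01.
- by do 2?apply: intbleM01.
by rewrite -[X in _ == X]h; apply/eqP; congr Ex; apply/funext => w /=; ring.
Qed.

(** It suffices that U is orthogonal to the past together with the sample j, V
being measurable with respect to it.  On a set A and (xi_j in D) of the
generating pi-system, split 1_D as (1_D - Z) + Z with Z its conditional
probability given the past: the first part is orthogonal to U 1_A, which depends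
on the past and on the sample i only, and U is orthogonal to Z 1_A, which
depends on the past only. *)
Lemma cond_indep_uncorrelated (i j : 'I_n) (U V : T -> R) : i != j ->
  gmeas (past_with i) U -> gmeas (past_with j) V ->
  intble P U -> orth P G U -> intble P (fun w => U w * V w) ->
  Ex P (fun w => U w * V w) = 0.
Proof.
move=> ij mU mV iU oU iUV.
apply: (orth_mul (@past_with_sub j)) => //.
apply: (orth_pi_system (@past_with_sub j)) => //.
  exact: past_withI.
  exact: past_withT.
move=> _ [A [D [sA mD ->]]].
have mA : measurable A by exact: GT.
have mAT : measurable_fun setT (\1_A : T -> R) by exact: measurable_indic.
have mDT : measurable_fun setT (\1_(xi j @^-1` D) : T -> R).
  exact/measurable_indic/mI.
have [_ [Z [_ [mZ Z01 oZ _]]]] := cond_indep_pair ij measurableT mD.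
have mZT : measurable_fun setT Z by exact: gmeas_meas mZ.
have oDZ := cond_indep_orth ij mD mZ Z01 oZ.
have iUA : intble P (fun w => U w * \1_A w) by apply: intbleM01.
have iDZ : intble P (fun w => (\1_(xi j @^-1` D) \- Z) w * (U w * \1_A w)).
  rewrite (_ : (fun w => _) = fun w => (U w * \1_A w) * \1_(xi j @^-1` D) w -
    (U w * \1_A w) * Z w); last by apply/funext => w /=; ring.
  by apply: intbleB; apply: intbleM01.
have e1 : Ex P (fun w => (\1_(xi j @^-1` D) \- Z) w * (U w * \1_A w)) = 0.
  apply: (orth_mul (@past_with_sub i) _ oDZ).
  - apply: intbleB; first exact/intble_indic/mI.
    exact: intble01.
  - exact: measurable_funM mU (gmeas_indic (@past_with_past i _ sA)).
  - exact: iDZ.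
have e2 : Ex P (fun w => U w * (Z w * \1_A w)) = 0.
  apply: (orth_mul GT) => //.
  - exact: measurable_funM mZ (gmeas_indic sA).
  - by under [X in intble P X]eq_fun do rewrite mulrA; do 2?apply: intbleM01.
rewrite -[RHS]addr0 -[X in _ = X + _]e1 -[X in _ = _ + X]e2 -ExD.
- by congr Ex; apply/funext => w; rewrite indicI /=; ring.
- exact: iDZ.
- by under [X in intble P X]eq_fun do rewrite mulrA; do 2?apply: intbleM01.
Qed.

End Uncorrelated.

(** * The Frobenius inner product *)

Section Frobenius.
Context {R : realType}.

Definition dotm m p (A B : 'M[R]_(m, p)) : R := \tr (A *m B^T).

Lemma dotm_mull m k p (S : 'M[R]_(m, k)) (A : 'M[R]_(k, p)) (B : 'M[R]_(m, p)) :
  dotm (S *m A) B = dotm A (S^T *m B).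
Proof. by rewrite /dotm trmx_mul trmxK -mulmxA mxtrace_mulC -mulmxA. Qed.

Section FixedSize.
Variables m p : nat.
Implicit Types (A B C : 'M[R]_(m, p)) (S : 'M[R]_m) (a : R).

Lemma dotmE A B : dotm A B = \sum_i \sum_j A i j * B i j.
Proof.
by apply: eq_bigr => i _; rewrite mxE; apply: eq_bigr => j _; rewrite mxE.
Qed.

Lemma sqnormE A : sqnorm A = dotm A A.
Proof.
by rewrite dotmE; do 2!apply: eq_bigr => ? _; rewrite expr2.
Qed.

Lemma dotmC A B : dotm A B = dotm B A.
Proof. by rewrite /dotm -mxtrace_tr trmx_mul trmxK. Qed.

Lemma dotmDl A B C : dotm (A + B) C = dotm A C + dotm B C.
Proof. by rewrite /dotm mulmxDl raddfD. Qed.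
Lemma dotmDr A B C : dotm A (B + C) = dotm A B + dotm A C.
Proof. by rewrite ![dotm A _]dotmC dotmDl. Qed.
Lemma dotmNl A B : dotm (- A) B = - dotm A B.
Proof. by rewrite /dotm mulNmx raddfN. Qed.
Lemma dotmNr A B : dotm A (- B) = - dotm A B.
Proof. by rewrite ![dotm A _]dotmC dotmNl. Qed.
Lemma dotmZl a A B : dotm (a *: A) B = a * dotm A B.
Proof. by rewrite /dotm -scalemxAl linearZ. Qed.
Lemma dotmZr a A B : dotm A (a *: B) = a * dotm A B.
Proof. by rewrite ![dotm A _]dotmC dotmZl. Qed.
Lemma dotm0l A : dotm 0 A = 0.
Proof. by rewrite /dotm mul0mx raddf0. Qed.
Lemma dotm0r A : dotm A 0 = 0.
Proof. by rewrite dotmC dotm0l. Qed.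

Definition dotm_lin := (dotmDl, dotmDr, dotmNl, dotmNr, dotmZl, dotmZr).

Lemma sqnorm_ge0 A : 0 <= sqnorm A.
Proof. by apply: sumr_ge0 => i _; apply: sumr_ge0 => j _; exact: sqr_ge0. Qed.

Lemma sqnorm_eq0 A : sqnorm A = 0 -> A = 0.
Proof.
move=> A0; apply/matrixP => i j; rewrite mxE; apply/eqP.
have := A0; rewrite /sqnorm => /eqP; rewrite psumr_eq0; last first.
  by move=> k _; apply: sumr_ge0 => ? _; exact: sqr_ge0.
move=> /allP /(_ i (mem_index_enum i)) /=; rewrite psumr_eq0; last first.
  by move=> k _; exact: sqr_ge0.
by move=> /allP /(_ j (mem_index_enum j)) /=; rewrite sqrf_eq0.
Qed.

Lemma sqnormD A B : sqnorm (A + B) = sqnorm A + 2 * dotm A B + sqnorm B.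
Proof. by rewrite !sqnormE !dotm_lin (dotmC B A); ring. Qed.

Lemma sqnormB A B : sqnorm (A - B) = sqnorm A - 2 * dotm A B + sqnorm B.
Proof. by rewrite !sqnormE !dotm_lin (dotmC B A); ring. Qed.

Lemma sqnormN A : sqnorm (- A) = sqnorm A.
Proof. by rewrite !sqnormE !dotm_lin opprK. Qed.

Lemma sqnormZ a A : sqnorm (a *: A) = a ^+ 2 * sqnorm A.
Proof. by rewrite !sqnormE !dotm_lin; ring. Qed.

(** Expand the form at a A - B.  Nonnegativity is assumed at this one matrix because
the forms of interest are nonnegative on centred matrices only. *)
Lemma form_young S a A B : S^T = S -> 0 < a ->
  0 <= dotm (a *: A - B) (S *m (a *: A - B)) ->
  dotm (A + B) (S *m (A + B)) <=
  (1 + a) * dotm A (S *m A) + (1 + a^-1) * dotm B (S *m B).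
Proof.
move=> symS a0; rewrite !(mulmxDr, mulmxN, =^~scalemxAr, dotm_lin).
have -> : dotm B (S *m A) = dotm A (S *m B) by rewrite dotmC dotm_mull symS.
move=> h; rewrite -subr_ge0 -(pmulr_rge0 _ a0).
apply: (le_trans h); rewrite le_eqVlt; apply/orP; left; apply/eqP; field.
by rewrite gt_eqF.
Qed.

Lemma sqnorm_young a A B : 0 < a ->
  sqnorm (A + B) <= (1 + a) * sqnorm A + (1 + a^-1) * sqnorm B.
Proof.
move=> a0; have := @form_young 1%:M a A B (trmx1 _ _) a0.
by rewrite !mul1mx -!sqnormE; apply; exact: sqnorm_ge0.
Qed.

Lemma sqnormD_le2 A B : sqnorm (A + B) <= 2 * (sqnorm A + sqnorm B).
Proof.
by have := @sqnorm_young 1 A B ltr01; rewrite invr1; lra.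
Qed.

Lemma sqnormD_le3 A B C :
  sqnorm (A + B + C) <= 3 * (sqnorm A + sqnorm B + sqnorm C).
Proof.
have := sqnorm_ge0 (A - B); have := sqnorm_ge0 (A - C).
have := sqnorm_ge0 (B - C); rewrite !sqnormB !sqnormD !dotm_lin; lra.
Qed.

Lemma dotm_le_half A B : 2 * dotm A B <= sqnorm A + sqnorm B.
Proof. by have := sqnorm_ge0 (A - B); rewrite sqnormB; lra. Qed.

End FixedSize.

Lemma le_sqnorm_entry m p (A : 'M[R]_(m, p)) i j : A i j ^+ 2 <= sqnorm A.
Proof.
rewrite /sqnorm (bigD1 i)//= (bigD1 j)//= -addrA lerDl addr_ge0//.
  by apply: sumr_ge0 => k _; exact: sqr_ge0.
by apply: sumr_ge0 => k _; apply: sumr_ge0 => l _; exact: sqr_ge0.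
Qed.

Lemma dotm_col m p (A B : 'M[R]_(m, p)) :
  dotm A B = \sum_j dotm (col j A)^T (col j B)^T.
Proof.
rewrite dotmE exchange_big /=; apply: eq_bigr => j _.
by rewrite dotmE big_ord1; apply: eq_bigr => i _; rewrite !mxE.
Qed.

Lemma dotm_row m p (A B : 'M[R]_(m, p)) :
  dotm A B = \sum_i dotm (row i A) (row i B).
Proof.
rewrite dotmE; apply: eq_bigr => i _.
by rewrite dotmE big_ord1; apply: eq_bigr => j _; rewrite !mxE.
Qed.

Lemma sqnorm_row m p (A : 'M[R]_(m, p)) : sqnorm A = \sum_i sqnorm (row i A).
Proof. by rewrite sqnormE dotm_row; apply: eq_bigr => i _; rewrite sqnormE. Qed.

End Frobenius.

Section Rayleigh.
Context {R : realType} {n : nat}.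
Variables (e : rel 'I_n) (W : 'M[R]_n) (lam : n.-tuple R).
Hypotheses (n2 : (2 <= n)%N) (net : network e W lam).

Let one : 'cV[R]_n := const_mx 1.
Let W1 : W *m one = one. Proof. by case: net. Qed.
Let Wsym : W^T = W. Proof. by case: net. Qed.

Let rowsum i : \sum_j W i j = 1.
Proof.
have /matrixP /(_ i 0) := W1; rewrite !mxE => <-.
by apply: eq_bigr => j _; rewrite mxE mulr1.
Qed.

Let Wij i j : W i j = W j i.
Proof. by rewrite -{1}Wsym mxE. Qed.

(** The rows of W sum to 1, so the squares on the right-hand side collect into twice
the squared norm.  This is what links the eigenvalue 1 to the edges of the
graph. *)
Lemma dirichlet_form (v : 'rV[R]_n) :
  2 * (sqnorm v - dotm v (v *m W)) =
  \sum_i \sum_j W i j * (v 0 i - v 0 j) ^+ 2.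
Proof.
have S1 : \sum_i \sum_j W i j * v 0 i ^+ 2 = sqnorm v.
  rewrite /sqnorm big_ord1; apply: eq_bigr => i _.
  by rewrite -mulr_suml rowsum mul1r.
have S2 : \sum_i \sum_j W i j * v 0 j ^+ 2 = sqnorm v.
  rewrite exchange_big /= -[RHS]S1; do 2!apply: eq_bigr => ? _.
  by rewrite Wij.
have S3 : \sum_i \sum_j W i j * (v 0 i * v 0 j) = dotm v (v *m W).
  rewrite dotmE big_ord1 exchange_big /=; apply: eq_bigr => i _.
  by rewrite mxE mulr_sumr; apply: eq_bigr => j _; ring.
rewrite mulrBr mulr2n mulrDl !mul1r -{1}S1 -{1}S2 -S3 mulr_sumr -big_split /=.
rewrite -sumrB; apply: eq_bigr => i _.
rewrite mulr_sumr -big_split /= -sumrB; apply: eq_bigr => j _; ring.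
Qed.

Let continuous_sum (I : Type) (r : seq I) (F : I -> 'rV[R]_n -> R) :
  (forall i, continuous (F i)) -> continuous (fun v => \sum_(i <- r) F i v).
Proof.
move=> cF; elim: r => [|i r IH].
  have -> : (fun v => \sum_(j <- [::]) F j v) = fun=> 0.
    by apply/funext => v; rewrite big_nil.
  by move=> v; exact: cst_continuous.
have -> : (fun v => \sum_(j <- i :: r) F j v) =
    fun v => F i v + \sum_(j <- r) F j v.
  by apply/funext => v; rewrite big_cons.
by move=> v; apply: continuousD; [exact: cF|exact: IH].
Qed.

Let continuous_form : continuous (fun v : 'rV[R]_n => dotm v (v *m W)).
Proof.
have -> : (fun v : 'rV[R]_n => dotm v (v *m W)) =
    fun v => \sum_j v 0 j * \sum_k v 0 k * W k j.
  by apply/funext => v; rewrite dotmE big_ord1; apply: eq_bigr => j _; rewrite mxE.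
apply: continuous_sum => j v; apply: continuousM; first exact: coord_continuous.
move: v; apply: continuous_sum => k v.
by apply: continuousM; [exact: coord_continuous|exact: cst_continuous].
Qed.

Let continuous_sqnorm : continuous (fun v : 'rV[R]_n => sqnorm v).
Proof.
have -> : (fun v : 'rV[R]_n => sqnorm v) = fun v => \sum_j v 0 j * v 0 j.
  apply/funext => v; rewrite /sqnorm big_ord1.
  by apply: eq_bigr => j _; rewrite expr2.
by apply: continuous_sum => j v; apply: continuousM; exact: coord_continuous.
Qed.

Let sphere := [set v : 'rV[R]_n | sqnorm v = 1 /\ \sum_j v 0 j = 0].

Let compact_sphere : compact sphere.
Proof.
apply: bounded_closed_compact.
  exists 1; split => // M M1 v [v1 _].
  apply: le_trans (ltW M1); rewrite [X in X <= _]mx_normrE.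
  apply/bigmax_leP; split => // -[i j] _ /=.
  rewrite -(@ler_pXn2r _ 2)// ?nnegrE// expr1n -normrX ger0_norm ?sqr_ge0//.
  rewrite -v1 /sqnorm [i]ord1 big_ord1 (bigD1 j)//= lerDl.
  by apply: sumr_ge0 => k _; exact: sqr_ge0.
have -> : sphere = (fun v : 'rV[R]_n => sqnorm v) @^-1` [set 1] `&`
    (fun v : 'rV[R]_n => \sum_j v 0 j) @^-1` [set 0] by [].
apply: closedI; apply: closed_comp => //; try exact: closed_eq.
by move=> v _; apply: continuous_sum => j; exact: coord_continuous.
Qed.

(** Let c maximize the quadratic form of W on the unit sphere of the centred
vectors, with maximum mu.  The residual r = mu c - c W is centred, and moving c
along -r would raise the quotient at first order unless r = 0; so mu is an
eigenvalue.  If mu were 1, the Dirichlet form would vanish at c, so c would be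
constant along the edges, hence constant by connectedness and zero by centring.
Therefore mu occurs in the sorted list of eigenvalues after the first entry. *)
Lemma rayleigh (u : 'rV[R]_n) : \sum_j u 0 j = 0 ->
  dotm u (u *m W) <= lam`_1 * sqnorm u.
Proof.
move=> u0; have [->|un0] := eqVneq u 0.
  by rewrite mul0mx dotm0r sqnormE dotm0r mulr0.
have normalize (v : 'rV[R]_n) : v != 0 -> \sum_j v 0 j = 0 ->
    sphere ((Num.sqrt (sqnorm v))^-1 *: v).
  move=> vn0 v0; have vp : 0 < sqnorm v.
    rewrite lt_neqAle sqnorm_ge0 andbT eq_sym.
    by apply: contra_neq vn0; exact: sqnorm_eq0.
  split; last first.
    by under eq_bigr do rewrite mxE; rewrite -mulr_sumr v0 mulr0.
  by rewrite sqnormZ exprVn sqr_sqrtr ?sqnorm_ge0// mulVf// gt_eqF.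
have [c cS cmax] : exists2 c, c \in sphere & forall t, t \in sphere ->
    dotm t (t *m W) <= dotm c (c *m W).
  apply: EVT_max_rV; [by eexists; exact: normalize un0 u0|
    exact: compact_sphere|exact: continuous_subspaceT continuous_form].
move: cS; rewrite inE => -[c1 c0].
set mu := dotm c (c *m W) in cmax.
have Q (v : 'rV[R]_n) : \sum_j v 0 j = 0 -> dotm v (v *m W) <= mu * sqnorm v.
  move=> v0; have [->|vn0] := eqVneq v 0.
    by rewrite mul0mx dotm0r sqnormE dotm0r mulr0.
  have vp : 0 < sqnorm v.
    rewrite lt_neqAle sqnorm_ge0 andbT eq_sym.
    by apply: contra_neq vn0; exact: sqnorm_eq0.
  have := cmax _ (mem_set (normalize _ vn0 v0)).
  rewrite -scalemxAl dotmZl dotmZr mulrA -expr2 exprVn sqr_sqrtr ?sqnorm_ge0//.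
  by rewrite ler_pdivrMl// mulrC.
pose r := mu *: c - c *m W.
have r0 : \sum_j r 0 j = 0.
  have -> : \sum_j r 0 j = (r *m one) 0 0.
    by rewrite [RHS]mxE; apply: eq_bigr => j _; rewrite [one _ _]mxE mulr1.
  have c1' : c *m one = 0.
    apply/matrixP => i j; rewrite mxE [RHS]mxE -[RHS]c0; apply: eq_bigr => k _.
    by rewrite [one _ _]mxE ord1 mulr1.
  by rewrite /r mulmxBl -scalemxAl -mulmxA W1 c1' scaler0 subr0 mxE.
have rE : c *m W = mu *: c - r by rewrite /r subKr.
clearbody r.
have bl (v w : 'rV[R]_n) : dotm v (w *m W) = dotm (v *m W) w.
  by rewrite /dotm trmx_mul Wsym mulmxA.
have rr : sqnorm r = 0.
  set q := mu * sqnorm r - dotm r (r *m W).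
  have q0 : 0 <= q by rewrite subr_ge0 Q.
  (* the maximality of c, tested at c - t r *)
  have ineq t : 0 <= t ^+ 2 * q - 2 * t * sqnorm r.
    have z : \sum_j (c - t *: r) 0 j = 0.
      under eq_bigr do rewrite !mxE.
      by rewrite sumrB -mulr_sumr r0 c0 mulr0 subrr.
    have := Q _ z; rewrite -subr_ge0 => /le_trans; apply.
    rewrite sqnormB sqnormZ c1 mulmxBl -scalemxAl !dotm_lin -/mu.
    have -> : dotm c (r *m W) = mu * dotm c r - sqnorm r.
      by rewrite bl rE !dotm_lin -sqnormE.
    have -> : dotm r (c *m W) = mu * dotm c r - sqnorm r.
      by rewrite rE !dotm_lin -sqnormE (dotmC r c).
    by rewrite /q le_eqVlt; apply/orP; left; apply/eqP; ring.
  apply/eqP; rewrite eq_le sqnorm_ge0 andbT leNgt; apply/negP => rp.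
  (* a step small enough for the first-order term to win, and defined even
     when q = 0 *)
  have := ineq (sqnorm r / (q + sqnorm r)); apply/negP; rewrite -ltNge.
  have qp : 0 < q + sqnorm r by lra.
  rewrite (_ : _ - _ = - ((sqnorm r / (q + sqnorm r)) ^+ 2 * (q + 2 * sqnorm r))).
    by rewrite oppr_lt0 mulr_gt0//; [rewrite exprn_gt0// divr_gt0|lra].
  by field; lra.
have cn0 : c != 0.
  apply/eqP => c00; move: c1; rewrite c00 sqnormE dotm0l => /eqP.
  by rewrite eq_sym oner_eq0.
have eig : c *m W = mu *: c.
  by rewrite rE (sqnorm_eq0 rr) subr0.
have mulam : mu \in (lam : seq R).
  have [_ cp] := network_spectrum net.
  rewrite -root_prod_XsubC -cp -eigenvalue_root_char; apply/eigenvalueP.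
  by exists c.
have mu1 : mu != 1.
  apply/eqP => mu1; have := dirichlet_form c.
  rewrite c1 -/mu mu1 subrr mulr0 => /esym /eqP.
  have W0 i j : 0 <= W i j * (c 0 i - c 0 j) ^+ 2.
    by rewrite mulr_ge0 ?sqr_ge0//; case: net.
  rewrite psumr_eq0; last by move=> i _; exact: sumr_ge0.
  move=> /allP h.
  have edge i j : e i j -> c 0 i = c 0 j.
    move=> eij; have [->//|ij] := eqVneq i j.
    have := h i (mem_index_enum i); rewrite /= psumr_eq0//.
    move=> /allP /(_ j (mem_index_enum j)) /=.
    have Wp : 0 < W i j by case: net => ? ? ? ? ? ? + ? ? ? ? ?; exact.
    by rewrite mulf_eq0 gt_eqF//= sqrf_eq0 subr_eq0 => /eqP.
  have const i j : c 0 i = c 0 j.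
    have /connectP [s] := network_connected net i j.
    elim: s i => [|k s IH] i /=; first by move=> _ ->.
    by move=> /andP[eik] /IH h' /h' <-; exact: edge.
  move: cn0 => /negP; apply; apply/eqP/matrixP => i j; rewrite [i]ord1 mxE.
  have := c0; rewrite (eq_bigr (fun=> c 0 j)); last by move=> k _; exact: const.
  rewrite sumr_const card_ord => /eqP; rewrite mulrn_eq0.
  by case/orP => /eqP // n0; have := n2; rewrite [X in (_ < X)%N]n0.
have mule : mu <= lam`_1.
  have [srt _] := network_spectrum net.
  have k_lt : (index mu lam < n)%N by rewrite -[X in (_ < X)%N](size_tuple lam) index_mem.
  have muE : lam`_(index mu lam) = mu by rewrite nth_index.
  (* the first entry of the list is 1 *)
  have k0 : (0 < index mu lam)%N.
    rewrite lt0n; apply: contra_neq mu1 => k0.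
    by rewrite -muE k0 (network_lam1 net).
  have tr : transitive (>=%R : rel R) by move=> x y z /= yx xz; exact: le_trans xz yx.
  have := @sorted_leq_nth _ (>=%R) tr (fun x => lexx x) 0 lam srt 1 (index mu lam).
  by rewrite !inE size_tuple muE; apply.
by rewrite (le_trans (Q u u0))// ler_wpM2r// sqnorm_ge0.
Qed.

End Rayleigh.

(** * Measurable and square-integrable random matrices *)

Section MeasurableMatrix.
Context {R : realType} {d : measure_display} {T : measurableType d}.

Definition measurable_mx m p (A : T -> 'M[R]_(m, p)) :=
  forall i j, measurable_fun setT (fun w => A w i j).

Lemma measurable_mx_cst m p (A : 'M[R]_(m, p)) : measurable_mx (fun=> A).
Proof. by move=> i j; exact: measurable_cst. Qed.

Lemma measurable_mxD m p (A B : T -> 'M[R]_(m, p)) :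
  measurable_mx A -> measurable_mx B -> measurable_mx (fun w => A w + B w).
Proof.
move=> mA mB i j; rewrite (_ : (fun w => _) = fun w => A w i j + B w i j).
  exact: measurable_funD.
by apply/funext => w; rewrite mxE.
Qed.

Lemma measurable_mxZ m p a (A : T -> 'M[R]_(m, p)) :
  measurable_mx A -> measurable_mx (fun w => a *: A w).
Proof.
move=> mA i j; rewrite (_ : (fun w => _) = fun w => a * A w i j).
  exact: measurable_funM (measurable_cst _) (mA i j).
by apply/funext => w; rewrite mxE.
Qed.

Lemma measurable_mxN m p (A : T -> 'M[R]_(m, p)) :
  measurable_mx A -> measurable_mx (fun w => - A w).
Proof. by move=> /(measurable_mxZ (-1)); under eq_fun do rewrite scaleN1r. Qed.

Lemma measurable_mxB m p (A B : T -> 'M[R]_(m, p)) :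
  measurable_mx A -> measurable_mx B -> measurable_mx (fun w => A w - B w).
Proof. by move=> mA mB; exact: measurable_mxD mA (measurable_mxN mB). Qed.

Lemma measurable_mx_mull m n p (S : 'M[R]_(m, n)) (A : T -> 'M[R]_(n, p)) :
  measurable_mx A -> measurable_mx (fun w => S *m A w).
Proof.
move=> mA i j; rewrite (_ : (fun w => _) = fun w => \sum_k S i k * A w k j).
  apply: measurable_sum => k.
  exact: measurable_funM (measurable_cst _) (mA k j).
by apply/funext => w; rewrite mxE.
Qed.

Lemma measurable_mx_row m p i (A : T -> 'M[R]_(m, p)) :
  measurable_mx A -> measurable_mx (fun w => row i (A w)).
Proof. by move=> mA k j; under eq_fun do rewrite mxE; exact: mA. Qed.

Lemma measurable_dotm m p (A B : T -> 'M[R]_(m, p)) :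
  measurable_mx A -> measurable_mx B -> measurable_fun setT (fun w => dotm (A w) (B w)).
Proof.
move=> mA mB; under eq_fun do rewrite dotmE.
apply: measurable_sum => i; apply: measurable_sum => j.
exact: measurable_funM (mA i j) (mB i j).
Qed.

Lemma measurable_sqnorm m p (A : T -> 'M[R]_(m, p)) :
  measurable_mx A -> measurable_fun setT (fun w => sqnorm (A w)).
Proof. by move=> mA; under eq_fun do rewrite sqnormE; exact: measurable_dotm. Qed.

(** An open set of row vectors is a countable union of boxes with rational centres
and radii 1 / (k + 1), and the preimage of a box is a finite intersection of
events on the coordinates. *)
Lemma measurable_continuous_rV p (phi : 'rV[R]_p -> R) (x : T -> 'rV[R]_p) :
  continuous phi -> measurable_mx x -> measurable_fun setT (fun w => phi (x w)).
Proof.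
move=> cphi mx mT.
apply: (measurability _ (RGenOInfty.measurableE R)) => //.
move=> _ [_ [a ->] <-]; rewrite setTI.
pose O := phi @^-1` `]a, +oo[%classic.
have oO : open O.
  apply: open_comp; last exact: interval_open.
  by move=> y _; exact: cphi.
(* boxes are indexed by a countable type *)
pose box (c : 'rV[rat]_p * nat) := [set y : 'rV[R]_p |
  forall j, `|y 0 j - ratr (c.1 0 j)| < c.2.+1%:R^-1].
have -> : (fun w => phi (x w)) @^-1` `]a, +oo[%classic =
    \bigcup_c [set w | box c `<=` O /\ box c (x w)].
  apply/seteqP; split=> w /=; last by move=> [c _ [cO]] /cO.
  move=> Ow; have /nbhs_ballP [e /= e0 eO] : nbhs (x w) O.
    exact: open_nbhs_nbhs.
  have [k ke] : exists k : nat, k.+1%:R^-1 < e / 2.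
    exists (Num.truncn (2 / e)).
    by rewrite -(invf_div 2) ltf_pV2 ?posrE ?divr_gt0// truncnS_gt.
  have rat_ex (y : R) : exists q : rat, `|y - ratr q| < k.+1%:R^-1.
    have k0 : 0 < k.+1%:R^-1 :> R by [].
    have /rat_in_itvoo [q] : y - k.+1%:R^-1 < y + k.+1%:R^-1 by rewrite ltrD2l gtrN.
    rewrite in_itv /= => qy; by exists q; rewrite distrC ltr_distl.
  pose q j := projT1 (cid (rat_ex (x w 0 j))).
  exists (\row_j q j, k) => //; split.
  - move=> y hy; apply: eO; split => // i j; rewrite [i]ord1.
    rewrite /ball /= /ball_ /=.
    have := hy j; rewrite mxE => h1.
    have h2 : `|x w 0 j - ratr (q j)| < k.+1%:R^-1 by exact: (projT2 (cid (rat_ex (x w 0 j)))).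
    have := ler_normD (x w 0 j - ratr (q j)) (ratr (q j) - y 0 j).
    rewrite addrA subrK => h3.
    apply: (le_lt_trans h3); rewrite (splitr e); apply: ltrD.
      exact: (lt_trans h2).
    by rewrite distrC; exact: (lt_trans h1).
  - by move=> j; rewrite mxE; exact: (projT2 (cid (rat_ex (x w 0 j)))).
apply: countable_bigcupT_measurable; first exact: countableP.
move=> c; have [cO|ncO] := pselect (box c `<=` O); last first.
  rewrite (_ : [set w | _] = set0) //.
  by apply/seteqP; split => // w [].
rewrite (_ : [set w | _] = \bigcap_(j in [set: 'I_p])
  (fun w => x w 0 j) @^-1` `]ratr (c.1 0 j) - c.2.+1%:R^-1,
                             ratr (c.1 0 j) + c.2.+1%:R^-1[%classic).
  apply: fin_bigcap_measurable => // j _; rewrite -[X in measurable X]setTI.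
  by apply: mx => //; exact: measurable_itv.
apply/seteqP; split => w /=.
  by move=> [_ h] j _ /=; have := h j; rewrite in_itv/= ltr_distl.
move=> h; split => // j; have := h j I; rewrite /= in_itv/=.
by rewrite ltr_distl.
Qed.

End MeasurableMatrix.

Section SquareIntegrable.
Context {R : realType} {d : measure_display} {T : measurableType d}.
Variable P : probability T R.

Definition L2 m p (A : T -> 'M[R]_(m, p)) :=
  measurable_mx A /\ intble P (fun w => sqnorm (A w)).

Section FixedSize.
Variables m p : nat.
Implicit Types (A B : T -> 'M[R]_(m, p)).

Lemma L2_dotm A B : L2 A -> L2 B -> intble P (fun w => dotm (A w) (B w)).
Proof.
move=> [mA iA] [mB iB]; apply: intble_le (intbleD iA iB) _.
  exact: measurable_dotm.
move=> w; have := dotm_le_half (A w) (B w).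
have := dotm_le_half (A w) (- B w); rewrite sqnormN dotmNr.
have := sqnorm_ge0 (A w); have := sqnorm_ge0 (B w).
move=> ? ? ? ?; rewrite ler_norml; apply/andP; split; lra.
Qed.

Lemma L2_dom A (Y : T -> R) : measurable_mx A -> intble P Y ->
  (forall w, sqnorm (A w) <= Y w) -> L2 A.
Proof.
move=> mA iY AY; split => //; apply: intble_le iY _.
  exact: measurable_sqnorm.
by move=> w; rewrite ger0_norm ?sqnorm_ge0.
Qed.

Lemma L2_cst (A : 'M[R]_(m, p)) : L2 (fun=> A).
Proof. by split; [exact: measurable_mx_cst|exact: intble_cst]. Qed.

Lemma L2D A B : L2 A -> L2 B -> L2 (fun w => A w + B w).
Proof.
move=> [mA iA] [mB iB]; apply: L2_dom (intbleZ 2 (intbleD iA iB)) _.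
  exact: measurable_mxD.
by move=> w; exact: sqnormD_le2.
Qed.

Lemma L2Z a A : L2 A -> L2 (fun w => a *: A w).
Proof.
move=> [mA iA]; apply: L2_dom (intbleZ (a ^+ 2) iA) _; first exact: measurable_mxZ.
by move=> w; rewrite sqnormZ.
Qed.

Lemma L2N A : L2 A -> L2 (fun w => - A w).
Proof. by move=> /(L2Z (-1)); under eq_fun do rewrite scaleN1r. Qed.

Lemma L2B A B : L2 A -> L2 B -> L2 (fun w => A w - B w).
Proof. by move=> hA hB; exact: L2D hA (L2N hB). Qed.

End FixedSize.

Lemma L2_entryM m p m' p' (A : T -> 'M[R]_(m, p)) (B : T -> 'M[R]_(m', p'))
  i j k l : L2 A -> L2 B -> intble P (fun w => A w i j * B w k l).
Proof.
move=> [mA iA] [mB iB]; apply: intble_le (intbleD iA iB) _.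
  exact: measurable_funM (mA i j) (mB k l).
move=> w; apply: le_trans (lerD (le_sqnorm_entry (A w) i j)
  (le_sqnorm_entry (B w) k l)).
have := sqr_ge0 (A w i j - B w k l); have := sqr_ge0 (A w i j + B w k l).
have := sqr_ge0 (A w i j); have := sqr_ge0 (B w k l).
rewrite !expr2 => ? ? ? ?; rewrite ler_norml; apply/andP; split; lra.
Qed.

Lemma L2_entry m p (A : T -> 'M[R]_(m, p)) i j : L2 A ->
  intble P (fun w => A w i j).
Proof.
move=> hA; have := L2_entryM i j 0 0 hA (L2_cst (const_mx 1 : 'M[R]_1)).
by under [X in intble P X]eq_fun do rewrite mxE mulr1.
Qed.

(** The squared norm of S A is a quadratic polynomial in the entries of A, whose
pairwise products are integrable. *)
Lemma L2_mull m n p (S : 'M[R]_(m, n)) (A : T -> 'M[R]_(n, p)) :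
  L2 A -> L2 (fun w => S *m A w).
Proof.
move=> hA; split; first by apply: measurable_mx_mull; case: hA.
under [X in intble P X]eq_fun do rewrite sqnormE dotm_mull.
have cle (C : 'M[R]_n) : intble P (fun w => dotm (A w) (C *m A w)).
  under [X in intble P X]eq_fun do rewrite dotmE.
  apply: intble_sum => i _; apply: intble_sum => j _.
  rewrite (_ : (fun w => _) = fun w => \sum_k C i k * (A w i j * A w k j)).
    apply: intble_sum => k _; apply: intbleZ.
    exact: L2_entryM.
  apply/funext => w; rewrite mxE mulr_sumr; apply: eq_bigr => k _; ring.
by under [X in intble P X]eq_fun do rewrite mulmxA; exact: cle.
Qed.

Lemma Ex_dotm_orth (G : set (set T)) m p (Z N : T -> 'M[R]_(m, p)) :
  <<s G >> `<=` measurable ->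
  L2 Z -> L2 N -> (forall i j, gmeas G (fun w => Z w i j)) ->
  (forall i j, orth P G (fun w => N w i j)) ->
  Ex P (fun w => dotm (Z w) (N w)) = 0.
Proof.
move=> GT hZ hN gZ oN.
under [X in Ex P X]eq_fun do rewrite dotmE.
have iZN i j : intble P (fun w => N w i j * Z w i j) by exact: L2_entryM.
have iZN' i j : intble P (fun w => Z w i j * N w i j) by exact: L2_entryM.
rewrite Ex_sum; last by move=> i _; exact: intble_sum.
rewrite big1// => i _; rewrite Ex_sum; last by move=> j _; exact: iZN'.
rewrite big1// => j _.
under [X in Ex P X]eq_fun do rewrite mulrC.
by apply: (orth_mul GT) => //; exact: L2_entry.
Qed.

End SquareIntegrable.

(** * A Lyapunov function for the consensus and dual errors *)

Section Lyapunov.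
Context {R : realType} {n : nat}.
Variables (M J : 'M[R]_n) (rho : R).
Hypotheses (Msym : M^T = M) (Jsym : J^T = J) (JJ : J *m J = J) (MJ : M *m J = 0).
Hypotheses (rho_gt0 : 0 < rho) (rho_le : rho <= 1 / 16).
Hypothesis M_ge : forall p (A : 'M[R]_(n, p)), J *m A = 0 ->
  rho * sqnorm A <= dotm A (M *m A).
Hypothesis M_le : forall p (A : 'M[R]_(n, p)),
  dotm A (M *m A) <= 1 / 16 * sqnorm A.

Let JM : J *m M = 0.
Proof. by rewrite -[LHS]trmxK trmx_mul Msym Jsym MJ trmx0. Qed.

(** The kernel of M + J is trivial: J (M + J) = J shows that J kills it, and M is
definite on what J kills.  Then B = (M + J)^(-1) - J. *)
Lemma ex_pseudo_inverse : exists B : 'M[R]_n,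
  [/\ B^T = B, M *m B = 1%:M - J & J *m B = 0].
Proof.
have MJu : M + J \in unitmx.
  rewrite -row_free_unit -kermx_eq0; set K := kermx _.
  have K0 : (M + J) *m K^T = 0.
    by apply: trmx_inj; rewrite trmx_mul trmxK linearD /= Msym Jsym mulmx_ker trmx0.
  have JK0 : J *m K^T = 0.
    have /(congr1 (mulmx J)) := K0; rewrite mulmxA mulmxDr JM JJ add0r.
    by rewrite mulmx0.
  have MK0 : M *m K^T = 0 by move: K0; rewrite mulmxDl JK0 addr0.
  have := M_ge JK0; rewrite MK0 dotm0r => h.
  have : sqnorm K^T = 0.
    apply/eqP; rewrite eq_le sqnorm_ge0 andbT -(ler_pM2l rho_gt0).
    by rewrite mulr0.
  by move=> /sqnorm_eq0 h0; rewrite -(trmxK K) h0 trmx0.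
set C := invmx (M + J).
have CT : C^T = C by rewrite /C trmx_inv linearD /= Msym Jsym.
have JC : J *m C = J.
  have : J *m (M + J) = J by rewrite mulmxDr JM JJ add0r.
  by move=> h; rewrite -{1}h -mulmxA mulmxV// mulmx1.
exists (C - J); split.
- by rewrite linearB /= CT Jsym.
- rewrite mulmxBr MJ subr0.
  have -> : M *m C = (M + J) *m C - J *m C by rewrite mulmxDl addrK.
  by rewrite mulmxV// JC.
- by rewrite mulmxBr JC JJ subrr.
Qed.

Variable B : 'M[R]_n.
Hypotheses (Bsym : B^T = B) (MB : M *m B = 1%:M - J) (JB : J *m B = 0).
Variable p : nat.
Implicit Types (A X E S U N Y : 'M[R]_(n, p)).

Let BM : B *m M = 1%:M - J.
Proof. by apply: trmx_inj; rewrite trmx_mul Msym Bsym MB linearB /= trmx1 Jsym. Qed.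

(** On the eigenspace of M for m this is X^2 + (1/m - 1) E^2, the quadratic form that
the linear recursion of the errors multiplies by its determinant 1 - m. *)
Definition lyap X E := sqnorm X + dotm E (B *m E) - sqnorm E.

Section Centred.
Variable E : 'M[R]_(n, p).
Hypothesis JE : J *m E = 0.

Let MBE : M *m (B *m E) = E.
Proof. by rewrite mulmxA MB mulmxBl mul1mx JE subr0. Qed.

Let BME : B *m (M *m E) = E.
Proof. by rewrite mulmxA BM mulmxBl mul1mx JE subr0. Qed.

Let JBE : J *m (B *m E) = 0.
Proof. by rewrite mulmxA JB mul0mx. Qed.

(** Since M <= 1/16 on centred matrices, B >= 16 there.  Without diagonalizing:
expand the nonnegative form of M at B E - 16 E. *)
Lemma pinv_form_ge : 16 * sqnorm E <= dotm E (B *m E).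
Proof.
pose u := B *m E; pose Z := u - 16 *: E.
have JZ : J *m Z = 0 by rewrite mulmxBr -scalemxAr JE JBE scaler0 subrr.
have := M_ge JZ; have := M_le E.
have h0 : 0 <= rho * sqnorm Z by rewrite mulr_ge0 ?sqnorm_ge0// ltW.
have -> : dotm Z (M *m Z) = dotm E u - 32 * sqnorm E + 256 * dotm E (M *m E).
  rewrite /Z /u !(mulmxDr, mulmxN, =^~scalemxAr, dotm_lin) MBE.
  have -> : dotm (B *m E) (M *m E) = sqnorm E.
    by rewrite dotm_mull Bsym BME sqnormE.
  by rewrite (dotmC (B *m E)) sqnormE; ring.
rewrite -/u; lra.
Qed.

(** With u = B E, the lower bound on M reads rho |u|^2 <= <E, u>; combine it with
the expansion of |E - rho u|^2 >= 0. *)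
Lemma pinv_form_le : rho * dotm E (B *m E) <= sqnorm E.
Proof.
pose u := B *m E.
have hu : rho * sqnorm u <= dotm E u.
  by rewrite (le_trans (M_ge JBE))// MBE dotmC.
have := sqnorm_ge0 (E - rho *: u); rewrite sqnormB sqnormZ dotmZr.
have : rho * (rho * sqnorm u) <= rho * dotm E u by rewrite ler_pM2l.
rewrite -/u expr2; lra.
Qed.

End Centred.

(** In an eigenspace of M for m the right-hand side is
(1 - m) (X^2 + (1/m - 1) E^2): the form is multiplied by exactly 1 - m. *)
Lemma lyap_unforced X E : J *m X = 0 -> J *m E = 0 ->
  let Y := X - E in
  lyap (Y - M *m Y) (E + M *m Y) =
  sqnorm X - dotm X (M *m X) + dotm E (B *m E) - 2 * sqnorm E + dotm E (M *m E).
Proof.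
move=> JX JE Y; have JY : J *m Y = 0 by rewrite mulmxBr JX JE subrr.
have XE : X = Y + E by rewrite /Y subrK.
clearbody Y.
have BMY : B *m (M *m Y) = Y by rewrite mulmxA BM mulmxBl mul1mx JY subr0.
have MS A C : dotm A (M *m C) = dotm C (M *m A).
  by rewrite dotmC dotm_mull Msym.
have BMYE : dotm (M *m Y) (B *m E) = dotm Y E.
  by rewrite dotmC dotm_mull Bsym BMY dotmC.
rewrite /lyap XE !sqnormE.
rewrite !(mulmxDr, mulmxN, dotm_lin) BMY BMYE.
rewrite (dotmC (M *m Y) Y) (dotmC (M *m Y) E) (dotmC E Y) (MS E Y); ring.
Qed.

Let q' E := dotm E ((B - 1%:M) *m E).

Let q'E E : q' E = dotm E (B *m E) - sqnorm E.
Proof. by rewrite /q' mulmxBl mul1mx !dotm_lin sqnormE. Qed.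

Let q'_ge0 E : J *m E = 0 -> 0 <= q' E.
Proof.
move=> JE; rewrite q'E; have := pinv_form_ge JE; have := sqnorm_ge0 E; lra.
Qed.

Lemma lyap_ge X E : J *m E = 0 -> sqnorm X <= lyap X E.
Proof. by move=> /q'_ge0; rewrite q'E /lyap; lra. Qed.

Lemma lyap_le X E : J *m E = 0 -> lyap X E <= sqnorm X + rho^-1 * sqnorm E.
Proof.
move=> JE; have := pinv_form_le JE; have := sqnorm_ge0 E.
rewrite /lyap mulrC -ler_pdivlMr// mulrC; lra.
Qed.

(** X and E are the consensus and dual errors, S the deviation of the gradients
from those at the mean, N the noise, U the variation of the gradients at the
mean.  The unforced recursion contracts by 1 - rho.  Two applications of Young's
inequality with parameter rho / 4, one to absorb S, which is small relative to X,
and one to split off U, leave a contraction by 1 - rho / 4.  The noise enters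
only through its square and an inner product with Z, which is known before the
noise is drawn. *)
Lemma lyap_step (eta L : R) X E S N U Z Y :
  J *m X = 0 -> J *m E = 0 -> J *m S = 0 -> J *m N = 0 -> J *m U = 0 ->
  0 <= eta -> 0 <= L -> eta * L <= rho / 16 ->
  sqnorm S <= L ^+ 2 * sqnorm X ->
  Z = X - eta *: S -> Y = Z - eta *: N - E ->
  lyap (Y - M *m Y) (E + M *m Y + eta *: U) <=
    (1 - rho / 4) * lyap X E
    - 2 * eta * ((1 + rho / 4) * (1 - rho)) * dotm Z N
    + eta ^+ 2 * sqnorm N + 5 * eta ^+ 2 / rho ^+ 2 * sqnorm U.
Proof.
move=> JX JE JS JN JU eta0 L0 etaL SX ZE YE.
have rgt0 := rho_gt0; have rle := rho_le.
have rho1 : rho <= 1 by lra.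
have JZ : J *m Z = 0 by rewrite ZE mulmxBr -scalemxAr JX JS scaler0 subrr.
pose X' := Z - eta *: N.
have JX' : J *m X' = 0 by rewrite mulmxBr -scalemxAr JZ JN scaler0 subrr.
have JY : J *m Y = 0 by rewrite YE mulmxBr JX' JE subrr.
pose E' := E + M *m Y.
have JE' : J *m E' = 0 by rewrite mulmxDr JE mulmxA JM mul0mx addr0.
(* the contraction without motion of the mean; B >= 16 and the bound on M
   turn the loss in E into a fraction of rho times the form of B - 1 *)
have h1 : sqnorm (Y - M *m Y) + q' E' <=
    (1 - rho) * sqnorm X' + (1 - 15 / 16 * rho) * q' E.
  rewrite !q'E addrA -[X in X <= _]/(lyap (Y - M *m Y) E') /E' YE (lyap_unforced JX' JE).
  have := M_ge JX'; have := M_le E; have := pinv_form_le JE.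
  have := pinv_form_ge JE; have := sqnorm_ge0 E => e0 e1 e2 e3 e4.
  have : 0 <= rho * sqnorm E by rewrite mulr_ge0// ltW.
  lra.
have h2 : q' (E' + eta *: U) <=
    (1 + rho / 4) * q' E' + 5 * eta ^+ 2 / rho ^+ 2 * sqnorm U.
  have BS : (B - 1%:M)^T = B - 1%:M by rewrite linearB /= Bsym trmx1.
  have r4 : 0 < rho / 4 by lra.
  have J0 : J *m (rho / 4 *: E' - eta *: U) = 0.
    by rewrite mulmxBr -!scalemxAr JE' JU !scaler0 subrr.
  apply: (le_trans (form_young BS r4 (q'_ge0 J0))); rewrite lerD2l.
  rewrite -scalemxAr !dotm_lin -/(q' U).
  have qU : rho * q' U <= sqnorm U.
    have := pinv_form_le JU; rewrite q'E; have : 0 <= rho * sqnorm U.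
      by rewrite mulr_ge0 ?sqnorm_ge0// ltW.
    lra.
  have c1 : 1 + (rho / 4)^-1 <= 5 / rho.
    rewrite -subr_ge0 (_ : _ - _ = (1 - rho) / rho).
      by rewrite divr_ge0 ?subr_ge0// ltW.
    by field; rewrite gt_eqF.
  have q0 := q'_ge0 JU.
  apply: (@le_trans _ _ (5 / rho * (eta * (eta * q' U)))).
    by rewrite ler_wpM2r// !mulr_ge0.
  rewrite (_ : 5 / rho * _ = 5 * eta ^+ 2 / rho ^+ 2 * (rho * q' U)); last first.
    by field; rewrite gt_eqF.
  by apply: ler_wpM2l => //; apply: divr_ge0; rewrite ?sqr_ge0// mulr_ge0 ?sqr_ge0.
have h3 : sqnorm X' = sqnorm Z - 2 * eta * dotm Z N + eta ^+ 2 * sqnorm N.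
  by rewrite /X' sqnormB sqnormZ dotmZr; ring.
have h4 : sqnorm Z <= (1 + rho / 4 + 5 * rho / 256) * sqnorm X.
  have r4 : 0 < rho / 4 by lra.
  have := sqnorm_young X (- (eta *: S)) r4; rewrite -ZE sqnormN sqnormZ.
  move=> /le_trans; apply; rewrite [leRHS]mulrDl lerD2l.
  have c1 : 1 + (rho / 4)^-1 <= 5 / rho.
    rewrite -subr_ge0 (_ : _ - _ = (1 - rho) / rho).
      by rewrite divr_ge0 ?subr_ge0// ltW.
    by field; rewrite gt_eqF.
  have eL2 : eta ^+ 2 * L ^+ 2 <= rho ^+ 2 / 256.
    rewrite -exprMn (_ : rho ^+ 2 / 256 = (rho / 16) ^+ 2); last by field.
    by rewrite ler_pXn2r ?nnegrE ?mulr_ge0//; lra.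
  apply: (@le_trans _ _ (5 / rho * (eta ^+ 2 * (L ^+ 2 * sqnorm X)))).
    rewrite ler_pM//; first by rewrite addr_ge0// invr_ge0 ltW.
    - by rewrite mulr_ge0 ?sqr_ge0 ?sqnorm_ge0.
    - by rewrite ler_wpM2l// sqr_ge0.
  rewrite (_ : 5 * rho / 256 = 5 / rho * (rho ^+ 2 / 256)); last first.
    by field; rewrite gt_eqF.
  apply: (@le_trans _ _ (5 / rho * (rho ^+ 2 / 256 * sqnorm X))).
    by rewrite ler_pM2l ?divr_gt0// mulrA ler_wpM2r ?sqnorm_ge0.
  by rewrite mulrA.
have -> : lyap (Y - M *m Y) (E + M *m Y + eta *: U) =
    sqnorm (Y - M *m Y) + q' (E' + eta *: U) by rewrite q'E addrA.
have -> : lyap X E = sqnorm X + q' E by rewrite q'E addrA.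
have q0 := q'_ge0 JE; have s0 := sqnorm_ge0 X; have n0 := sqnorm_ge0 N.
have y0 : 0 <= sqnorm (Y - M *m Y) by exact: sqnorm_ge0.
set u1 := 5 * eta ^+ 2 / rho ^+ 2 * sqnorm U in h2 *.
set y := sqnorm (Y - M *m Y) in h1 y0 *.
set dn := eta * dotm Z N.
set en := eta ^+ 2 * sqnorm N.
have en0 : 0 <= en by rewrite mulr_ge0 ?sqr_ge0.
have c0 : 0 <= (1 + rho / 4) * (1 - rho) by rewrite mulr_ge0//; lra.
apply: (@le_trans _ _ ((1 + rho / 4) * (y + q' E') + u1)).
  have : 0 <= rho / 4 * y by rewrite mulr_ge0//; lra.
  lra.
rewrite [in leRHS]addrC [leLHS]addrC lerD2l.
apply: (@le_trans _ _ ((1 + rho / 4) *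
    ((1 - rho) * (sqnorm Z - 2 * dn + en) + (1 - 15 / 16 * rho) * q' E))).
  rewrite ler_wpM2l//; first lra.
  apply: (le_trans h1); rewrite lerD2r h3.
  by rewrite le_eqVlt; apply/orP; left; apply/eqP; rewrite /dn /en; ring.
have r2 : 0 <= rho ^+ 2 by exact: sqr_ge0.
have r3 : 0 <= rho * rho ^+ 2 by rewrite mulr_ge0// ltW.
(* the contraction factors of X and of E after both applications of Young's
   inequality *)
have k1 : (1 + rho / 4) * (1 - rho) * (1 + rho / 4 + 5 * rho / 256) <= 1 - rho / 4.
  rewrite (_ : _ * _ * _ = 1 - 123 / 256 * rho - (1 / 4 + 3 / 4 * (69 / 256)) *
    rho ^+ 2 - 69 / 1024 * (rho * rho ^+ 2)); last by field.
  lra.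
have k2 : (1 + rho / 4) * (1 - 15 / 16 * rho) <= 1 - rho / 4.
  rewrite (_ : _ * _ = 1 - 11 / 16 * rho - 15 / 64 * rho ^+ 2); last by field.
  lra.
have k3 : (1 + rho / 4) * (1 - rho) <= 1.
  rewrite (_ : _ * _ = 1 - 3 / 4 * rho - 1 / 4 * rho ^+ 2); last by field.
  lra.
have m1 : (1 + rho / 4) * (1 - rho) * sqnorm Z <= (1 - rho / 4) * sqnorm X.
  apply: (le_trans (ler_wpM2l c0 h4)); rewrite mulrA.
  by rewrite ler_wpM2r.
have m2 : (1 + rho / 4) * (1 - 15 / 16 * rho) * q' E <= (1 - rho / 4) * q' E.
  by rewrite ler_wpM2r.
have m3 : (1 + rho / 4) * (1 - rho) * en <= en by rewrite ler_piMl.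
rewrite -[in leRHS]/en.
set c := (1 + rho / 4) * (1 - rho) in m1 m3 *.
set c' := (1 + rho / 4) * (1 - 15 / 16 * rho) in m2 *.
rewrite (_ : _ * (_ + _) = c * sqnorm Z - 2 * c * dn + c * en + c' * q' E); last first.
  by rewrite /c /c'; ring.
rewrite (_ : 2 * eta * c * dotm Z N = 2 * c * dn); last by rewrite /dn; ring.
lra.
Qed.

End Lyapunov.

(** * Gradients of smooth functions *)

Section Gradient.
Context {R : realType} {p : nat}.
Implicit Types (f : 'rV[R]_p -> R) (x y v : 'rV[R]_p) (L : R).

Lemma derive_grad f x v : differentiable f x -> 'D_v f x = dotm (grad f x) v.
Proof.
move=> df; rewrite deriveE// {1}(row_sum_delta v) linear_sum.
rewrite dotmE big_ord1; apply: eq_bigr => j _.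
by rewrite linearZ /= mxE deriveE// mulrC.
Qed.

(** Squared, to avoid the square roots of the Euclidean norm. *)
Definition lipschitz_grad L f := forall x y,
  sqnorm (grad f x - grad f y) <= L ^+ 2 * sqnorm (x - y).

(** Along the segment from x to y, f minus its quadratic upper model is
nonincreasing, because its derivative is <= 0 by the Lipschitz bound. *)
Lemma descent_lemma f L x y : 0 < L -> (forall z, differentiable f z) ->
  lipschitz_grad L f ->
  f y <= f x + dotm (grad f x) (y - x) + L / 2 * sqnorm (y - x).
Proof.
move=> L0 df lip; rewrite -{1}(subrK x y); move: (y - x) => v.
pose g (t : R) : 'rV[R]_p := t *: v + x.
pose psi (t : R) := f (g t) - (dotm (grad f x) v * t + L / 2 * sqnorm v * t ^+ 2).
have dg t : differentiable g t.
  by apply: differentiableD => //; exact: differentiableZl.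
have dfg t : derivable (f \o g) t 1.
  by apply: diff_derivable; apply: differentiable_comp.
have Dfg t : 'D_1 (f \o g) t = dotm (grad f (g t)) v.
  rewrite deriveE; last exact: differentiable_comp.
  rewrite diff_comp//= -derive_grad// deriveE//; congr ('d f _ _).
  have gE : g = ( *:%R^~ v) + cst x :> (R -> 'rV[R]_p) by [].
  have idg : is_diff t (( *:%R^~ v : R -> 'rV[R]_p) + cst x) (( *:%R^~ v) + 0).
    exact: is_diffD.
  have e1 : 'd g t = ( *:%R^~ v) + 0 :> (R -> 'rV[R]_p).
    by rewrite gE; exact: (@diff_val _ _ _ _ _ _ _ idg).
  by rewrite e1 -[RHS]addr0 -[in RHS](scale1r v).
have ipsi (t : R) : is_derive t 1 psi
    (dotm (grad f (g t)) v - (dotm (grad f x) v + L * t * sqnorm v)).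
  have h1 : is_derive t 1 (f \o g) (dotm (grad f (g t)) v).
    by rewrite -Dfg; exact: derivableP.
  have h2 : is_derive t (1 : R) (fun t : R => dotm (grad f x) v * t +
    L / 2 * sqnorm v * t ^+ 2) (dotm (grad f x) v + L * t * sqnorm v).
    have -> : (fun t : R => dotm (grad f x) v * t + L / 2 * sqnorm v * t ^+ 2) =
      (dotm (grad f x) v) \*: (id : R -> R) + (L / 2 * sqnorm v) \*: (id ^+ 2 : R -> R).
      by apply/funext => s.
    apply: is_derive_eq.
    by rewrite /GRing.scale /= expr1 -mulr_natl; field.
  have -> : psi = (f \o g) - (fun t : R => dotm (grad f x) v * t +
    L / 2 * sqnorm v * t ^+ 2) by [].
  exact: is_deriveB.
have : psi 1 <= psi 0.
  apply: (@ler0_derive1_le_cc _ psi 0 1) => //; rewrite ?in_itv/= ?lexx ?ler01//.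
  - move=> t; rewrite in_itv/= => /andP[t0 t1]; rewrite derive1E derive_val.
    have Lt : 0 < L * t by rewrite mulr_gt0.
    have h := lip (g t) x; rewrite addrK sqnormZ mulrA -exprMn in h.
    have := dotm_le_half (grad f (g t) - grad f x) ((L * t) *: v).
    rewrite dotmZr sqnormZ dotmDl dotmNl.
    set a := dotm _ v; set b := dotm _ v; set S := sqnorm v in h *.
    move=> h2; rewrite -(pmulr_rle0 _ Lt); move: (L * t) h h2 => k.
    rewrite !expr2; lra.
  - apply: continuous_subspaceT => t.
    apply: differentiable_continuous; apply/derivable1_diffP.
    exact: ex_derive.
rewrite /psi /g !scale1r !scale0r add0r.
rewrite !mulr1 mulr0 expr0n/= mulr0 addr0 subr0 expr1n mulr1; lra.
Qed.

(** The ambient topology is that of the sup norm, whence the comparison of the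
Euclidean norm with p times the sup norm. *)
Lemma lipschitz_grad_continuous f L j : 0 < L -> lipschitz_grad L f ->
  continuous (fun x => grad f x 0 j).
Proof.
move=> L0 lip x; apply/(@cvgrPdist_lt _ R^o _ (nbhs x) (nbhs_filter x)) => e e0.
pose K := L * (p%:R + 1).
have K0 : 0 < K by rewrite mulr_gt0// ltr_wpDl.
near=> y; have xy : `|x - y| < e / K.
  have : ball x (e / K) y by near: y; apply: nbhsx_ballx; exact: divr_gt0.
  by rewrite -ball_normE.
rewrite -(ltr_pXn2r (ltn0Sn 1)) ?nnegrE// ?ltW// -normrX ger0_norm ?sqr_ge0//.
apply: (@le_lt_trans _ _ (sqnorm (grad f x - grad f y))).
  have := le_sqnorm_entry (grad f x - grad f y) 0 j.
  by rewrite [X in X ^+ 2 <= _ -> _]mxE [X in (_ + X) ^+ 2 <= _ -> _]mxE.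
apply: (le_lt_trans (lip x y)).
have : sqnorm (x - y) <= p%:R * `|x - y| ^+ 2.
  rewrite /sqnorm big_ord1 -[X in X%:R * _]card_ord -sum1_card natr_sum mulr_suml.
  apply: ler_sum => k _; rewrite mul1r -(real_normK (num_real (_ _ k))).
  rewrite ler_pXn2r ?nnegrE// [leRHS]mx_normrE.
  by rewrite (le_bigmax _ (fun ij => `|(x - y) ij.1 ij.2|) (0, k)).
have d0 : 0 <= `|x - y| by [].
have pp : 0 <= p%:R :> R by [].
have : K * `|x - y| < e by rewrite mulrC -ltr_pdivlMr.
rewrite -(ltr_pXn2r (ltn0Sn 1)) ?nnegrE; last 2 first.
- exact: mulr_ge0 (ltW K0) d0.
- exact: ltW.
move=> h1 h2; apply: le_lt_trans h1; rewrite /K exprMn exprMn -mulrA.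
rewrite ler_wpM2l ?sqr_ge0//; apply: (le_trans h2); rewrite ler_wpM2r ?sqr_ge0//.
by rewrite sqrrD1 -mulr_natl; have := sqr_ge0 (p%:R : R); lra.
Unshelve. all: by end_near. Qed.

End Gradient.

Section Average.
Context {R : realType} {n p : nat}.
Variables (f : 'I_n -> 'rV[R]_p -> R) (L : R).
Hypotheses (n0 : (0 < n)%N) (L0 : 0 < L).
Hypothesis df : forall i x, differentiable (f i) x.
Hypothesis sm : smooth f L.

Lemma smooth_lipschitz i : lipschitz_grad L (f i).
Proof.
move=> x y; have := sm i x y; rewrite /enorm => h.
rewrite -[leLHS]sqr_sqrtr ?sqnorm_ge0// -[in leRHS](sqr_sqrtr (sqnorm_ge0 _)).
by rewrite -exprMn ler_pXn2r ?nnegrE ?mulr_ge0 ?sqrtr_ge0// ltW.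
Qed.

Let favgE : favg f = n%:R^-1 \*: \sum_i f i.
Proof. by apply/funext => x; rewrite /favg /= fct_sumE. Qed.

Lemma differentiable_favg x : differentiable (favg f) x.
Proof. by rewrite favgE; apply: differentiableZ; exact: differentiable_sum. Qed.

Lemma grad_favg x : grad (favg f) x = n%:R^-1 *: \sum_i grad (f i) x.
Proof.
apply/rowP => j; rewrite !mxE summxE favgE deriveZ.
  rewrite derive_sum; last by move=> i; exact: diff_derivable.
  by congr (_ * _); apply: eq_bigr => i _; rewrite mxE.
by apply: derivable_sum => i; exact: diff_derivable.
Qed.

Lemma sqnorm_mean_le (v : 'I_n -> 'rV[R]_p) :
  sqnorm (n%:R^-1 *: \sum_i v i) <= n%:R^-1 * \sum_i sqnorm (v i).
Proof.
set m := n%:R^-1 *: _; have np : 0 < n%:R :> R by rewrite ltr0n.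
have : 0 <= \sum_i sqnorm (v i - m) by apply: sumr_ge0 => i _; exact: sqnorm_ge0.
under eq_bigr do rewrite sqnormB.
rewrite big_split sumrB /= sumr_const card_ord -mulr_sumr.
have -> : \sum_i dotm (v i) m = n%:R * sqnorm m.
  have -> : \sum_i dotm (v i) m = dotm (\sum_i v i) m.
    by elim/big_rec2: _ => [|i a b _ ->]; rewrite ?dotm0l ?dotmDl.
  have -> : \sum_i v i = n%:R *: m by rewrite /m scalerA mulfV ?scale1r// gt_eqF.
  by rewrite dotmZl sqnormE.
rewrite -[_ *+ n]mulr_natl => h; rewrite ler_pdivlMl//; lra.
Qed.

Lemma lipschitz_grad_favg : lipschitz_grad L (favg f).
Proof.
move=> x y; rewrite !grad_favg -scalerBr -sumrB.
apply: (le_trans (sqnorm_mean_le _)).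
have np : 0 < n%:R :> R by rewrite ltr0n.
rewrite ler_pdivrMl// mulr_natl -[n in leRHS](card_ord n) -sumr_const.
by apply: ler_sum => i _; exact: smooth_lipschitz.
Qed.

End Average.

(** * Averaging and gossip matrices *)

Section Averaging.
Context {R : realType} {n p : nat}.
Hypothesis n0 : (0 < n)%N.
Implicit Types (X Y : 'M[R]_(n, p)) (v : 'rV[R]_p).

Definition spread v : 'M[R]_(n, p) := \matrix_i v.

Definition avg_mx : 'M[R]_n := const_mx n%:R^-1.

Lemma row_spread v i : row i (spread v) = v.
Proof. exact: rowK. Qed.

Lemma rowmeanE X j : rowmean X 0 j = n%:R^-1 * \sum_i X i j.
Proof.
rewrite /rowmean mxE summxE; congr (_ * _).
by apply: eq_bigr => i _; rewrite mxE.
Qed.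

Lemma avg_mx_mul X : avg_mx *m X = spread (rowmean X).
Proof.
apply/matrixP => i j; rewrite [RHS]mxE rowmeanE mxE mulr_sumr.
by apply: eq_bigr => k _; rewrite mxE.
Qed.

Lemma rowmeanD X Y : rowmean (X + Y) = rowmean X + rowmean Y.
Proof.
apply/rowP => j; rewrite [RHS]mxE !rowmeanE -mulrDr -big_split /=.
by congr (_ * _); apply: eq_bigr => i _; rewrite mxE.
Qed.

Lemma rowmeanZ a X : rowmean (a *: X) = a *: rowmean X.
Proof.
apply/rowP => j; rewrite [RHS]mxE !rowmeanE [RHS]mulrCA; congr (_ * _).
by rewrite mulr_sumr; apply: eq_bigr => i _; rewrite mxE.
Qed.

Lemma rowmeanN X : rowmean (- X) = - rowmean X.
Proof. by rewrite -scaleN1r rowmeanZ scaleN1r. Qed.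

Lemma rowmeanB X Y : rowmean (X - Y) = rowmean X - rowmean Y.
Proof. by rewrite rowmeanD rowmeanN. Qed.

Let nR0 : 0 < n%:R :> R. Proof. by rewrite ltr0n. Qed.

Lemma rowmean_spread v : rowmean (spread v) = v.
Proof.
apply/rowP => j; rewrite rowmeanE (eq_bigr (fun=> v 0 j)).
  by rewrite sumr_const card_ord -[X in _ * X]mulr_natl mulKf// gt_eqF.
by move=> i _; rewrite mxE.
Qed.

Lemma sqnorm_spread v : sqnorm (spread v) = n%:R * sqnorm v.
Proof.
rewrite sqnorm_row (eq_bigr (fun=> sqnorm v)).
  by rewrite sumr_const card_ord mulr_natl.
by move=> i _; rewrite row_spread.
Qed.

Lemma dotm_spread v X : dotm (spread v) X = n%:R * dotm v (rowmean X).
Proof.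
have -> : dotm (spread v) X = dotm v (\sum_i row i X).
  rewrite dotm_row dotmC; under eq_bigr do rewrite row_spread dotmC.
  by elim/big_rec2: _ => [|i a b _ ->]; rewrite ?dotm0l ?dotmDl.
by rewrite /rowmean dotmZr mulrA mulfV ?mul1r// gt_eqF.
Qed.

Lemma spreadB v v' : spread (v - v') = spread v - spread v'.
Proof. by apply/matrixP => i j; rewrite !mxE. Qed.

Definition cen X := X - avg_mx *m X.

Lemma avg_mx_tr : avg_mx^T = avg_mx.
Proof. by apply/matrixP => i j; rewrite !mxE. Qed.

Lemma avg_mx_idem : avg_mx *m avg_mx = avg_mx.
Proof.
apply/matrixP => i j; rewrite !mxE (eq_bigr (fun=> n%:R^-1 * n%:R^-1)).
  by rewrite sumr_const card_ord -[LHS]mulr_natl mulrA mulfV ?mul1r// gt_eqF.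
by move=> k _; rewrite !mxE.
Qed.

Lemma avg_cen X : avg_mx *m cen X = 0.
Proof. by rewrite /cen mulmxBr mulmxA avg_mx_idem subrr. Qed.

Lemma cen_id X : avg_mx *m X = 0 -> cen X = X.
Proof. by rewrite /cen => ->; rewrite subr0. Qed.

Lemma cenE X : cen X = (1%:M - avg_mx) *m X.
Proof. by rewrite mulmxBl mul1mx. Qed.

Lemma cenD X Y : cen (X + Y) = cen X + cen Y.
Proof. by rewrite !cenE mulmxDr. Qed.
Lemma cenN X : cen (- X) = - cen X.
Proof. by rewrite !cenE mulmxN. Qed.
Lemma cenB X Y : cen (X - Y) = cen X - cen Y.
Proof. by rewrite cenD cenN. Qed.
Lemma cenZ a X : cen (a *: X) = a *: cen X.
Proof. by rewrite !cenE scalemxAr. Qed.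

Lemma dotm_cen X Y : avg_mx *m X = 0 -> dotm X (cen Y) = dotm X Y.
Proof.
move=> X0; rewrite /cen dotmDr dotmNr (dotmC X (avg_mx *m Y)) dotm_mull.
by rewrite avg_mx_tr X0 dotm0r subr0.
Qed.

Lemma sqnorm_cen_le X : sqnorm (cen X) <= sqnorm X.
Proof.
have {2}-> : X = cen X + avg_mx *m X by rewrite subrK.
rewrite sqnormD (dotmC (cen X)) dotm_mull avg_mx_tr avg_cen dotm0r mulr0 addr0.
by rewrite lerDl sqnorm_ge0.
Qed.

Lemma sqnorm_rowmean_le X : n%:R * sqnorm (rowmean X) <= sqnorm X.
Proof.
rewrite -sqnorm_spread -avg_mx_mul.
have {2}-> : X = cen X + avg_mx *m X by rewrite subrK.
rewrite sqnormD (dotmC (cen X)) dotm_mull avg_mx_tr avg_cen dotm0r mulr0 addr0.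
by rewrite lerDr sqnorm_ge0.
Qed.

Lemma cen_spread X : cen X = X - spread (rowmean X).
Proof. by rewrite /cen avg_mx_mul. Qed.

End Averaging.

Section GossipMatrix.
Context {R : realType} {n : nat}.
Variables (e : rel 'I_n) (W : 'M[R]_n) (lam : n.-tuple R).
Hypotheses (n2 : (2 <= n)%N) (net : network e W lam).

(** The factor is gamma / 2 for gamma = 1/8. *)
Definition gossip : 'M[R]_n := (1 / 8 / 2) *: (1%:M - W).

(** Lower bound of the gossip matrix on centred vectors: gamma / 2 = 1/16 times the
spectral gap of W. *)
Definition gap : R := (1 - lam`_1) / 16.

Let Wsym : W^T = W. Proof. by case: net. Qed.

Lemma gossip_sym : gossip^T = gossip.
Proof. by rewrite /gossip linearZ /= linearB /= trmx1 Wsym. Qed.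

Lemma gossip_avg : gossip *m avg_mx = 0.
Proof.
have -> : avg_mx = n%:R^-1 *: ((const_mx 1 : 'cV[R]_n) *m (const_mx 1 : 'rV[R]_n)).
  by apply/matrixP => i j; rewrite !mxE big_ord1 !mxE !mulr1.
rewrite /gossip -scalemxAl -scalemxAr mulmxA mulmxBl mul1mx.
by rewrite (network_stochastic net) subrr mul0mx !scaler0.
Qed.

Lemma dotm_gossip p (A : 'M[R]_(n, p)) :
  dotm A (gossip *m A) = 1 / 16 * (sqnorm A - dotm A (W *m A)).
Proof.
rewrite /gossip -scalemxAl mulmxBl mul1mx !dotm_lin -sqnormE.
by congr (_ * _); field.
Qed.

(** Apply the bound on the Rayleigh quotient of W to each column. *)
Lemma gossip_ge p (A : 'M[R]_(n, p)) : avg_mx *m A = 0 ->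
  gap * sqnorm A <= dotm A (gossip *m A).
Proof.
move=> A0; rewrite dotm_gossip /gap.
suff : dotm A (W *m A) <= lam`_1 * sqnorm A by lra.
rewrite dotm_col sqnormE dotm_col mulr_sumr; apply: ler_sum => j _.
rewrite -sqnormE; have -> : (col j (W *m A))^T = (col j A)^T *m W.
  rewrite -{2}Wsym -trmx_mul; congr trmx.
  by apply/colP => k; rewrite !mxE; apply: eq_bigr => l _; rewrite mxE.
apply: (rayleigh n2 net).
have i0 : 'I_n by exact: Ordinal (ltnW n2).
have nn : n%:R != 0 :> R by rewrite pnatr_eq0 -lt0n ltnW.
have /matrixP /(_ i0 j) := A0; rewrite !mxE.
under eq_bigr do rewrite mxE; rewrite -mulr_sumr => /eqP.
rewrite mulf_eq0 invr_eq0 (negbTE nn) /= => /eqP h.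
by rewrite -[RHS]h; apply: eq_bigr => k _; rewrite !mxE.
Qed.

Lemma gossip_le p (A : 'M[R]_(n, p)) :
  dotm A (gossip *m A) <= 1 / 16 * sqnorm A.
Proof.
rewrite dotm_gossip; suff : 0 <= dotm A (W *m A) by lra.
rewrite dotm_col; apply: sumr_ge0 => j _.
have := network_psd net (col j A); rewrite /dotm trmxK /mxtrace big_ord1.
congr (0 <= _); rewrite -mulmxA; congr ((_ *m _) _ _).
by apply/colP => k; rewrite !mxE; apply: eq_bigr => l _; rewrite mxE.
Qed.

Lemma lam2_ge0 : 0 <= lam`_1.
Proof. by apply: (network_lam_ge0 net); rewrite mem_nth// size_tuple. Qed.

Lemma gap_gt0 : 0 < gap.
Proof. by rewrite /gap; have := network_lam2 net; lra. Qed.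

Lemma gap_le : gap <= 1 / 16.
Proof. by rewrite /gap; have := lam2_ge0; lra. Qed.

End GossipMatrix.

Section GradientMatrix.
Context {R : realType} {n p : nat}.
Variables (f : 'I_n -> 'rV[R]_p -> R) (L : R).
Hypotheses (n0 : (0 < n)%N) (L0 : 0 < L) (sm : smooth f L).
Hypothesis df : forall i x, differentiable (f i) x.
Implicit Types (X Y : 'M[R]_(n, p)).

Lemma row_gradF X i : row i (gradF f X) = grad (f i) (row i X).
Proof. exact: rowK. Qed.

Lemma gradF_lipschitz X Y :
  sqnorm (gradF f X - gradF f Y) <= L ^+ 2 * sqnorm (X - Y).
Proof.
rewrite !sqnorm_row mulr_sumr; apply: ler_sum => i _.
by rewrite !linearB /= !row_gradF; exact: smooth_lipschitz.
Qed.

Lemma gradF_growth X :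
  sqnorm (gradF f X) <= 2 * sqnorm (gradF f 0) + 2 * L ^+ 2 * sqnorm X.
Proof.
have := sqnormD_le2 (gradF f X - gradF f 0) (gradF f 0); rewrite subrK.
by have := gradF_lipschitz X 0; rewrite subr0; lra.
Qed.

Lemma rowmean_gradF_spread x : rowmean (gradF f (spread x)) = grad (favg f) x.
Proof.
rewrite (grad_favg df) /rowmean; congr (_ *: _).
by apply: eq_bigr => i _; rewrite row_gradF row_spread.
Qed.

End GradientMatrix.

(** * Inequalities along one sample path *)

Section Path.
Context {R : realType} {n p : nat} {Xi : 'I_n -> Type}.
Variables (f : 'I_n -> 'rV[R]_p -> R) (L : R).
Variables (e : rel 'I_n) (W : 'M[R]_n) (lam : n.-tuple R).
Hypotheses (n2 : (2 <= n)%N) (L0 : 0 < L) (sm : smooth f L).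
Hypothesis df : forall i x, differentiable (f i) x.
Hypothesis net : network e W lam.
Variables (oracle : forall i, 'rV[R]_p -> Xi i -> 'rV[R]_p) (alpha h : R).
Variables (xm1 H0 : 'M[R]_(n, p)) (z : nat -> forall i, Xi i).

Notation M := (gossip W).
Notation rho := (gap lam).

Let st := cedas idfun W alpha (1 / 8) (fun=> h) oracle xm1 H0 z.
Let xq := cedas_query idfun W alpha (1 / 8) (fun=> h) oracle xm1 H0 z.
Let D k := cedas_D (st k).

Definition sgrad s := stochgrad oracle z (xq s) s.
Definition noise s := sgrad s - gradF f (xq s).
(** The vector y_k. *)
Definition half_step k := xq k.+1 - h *: sgrad k.+1 - D k.

(** With the identity as compressor H + Q = H + (y - H) = y, so the variable H has
no influence. *)
Lemma cedas_rec k :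
  xq k.+2 = half_step k - M *m half_step k /\ D k.+1 = D k + M *m half_step k.
Proof.
rewrite /half_step /sgrad /D /xq /= -/(st k); case: (st k) => x Dk H /=.
have -> Y : compress idfun Y = Y :> 'M[R]_(n, p).
  by apply/row_matrixP => i; rewrite rowK.
rewrite [H + _]addrC subrK -scalemxAl; split => //.
by rewrite opprD addrA.
Qed.

Let n0 : (0 < n)%N. Proof. exact: ltnW. Qed.

Let J : 'M[R]_n := avg_mx.
Let MJ : M *m J = 0. Proof. exact: gossip_avg net. Qed.
Let JM : J *m M = 0.
Proof.
by apply: trmx_inj; rewrite trmx_mul (gossip_sym net) avg_mx_tr MJ trmx0.
Qed.

Lemma avg_dual k : J *m D k = 0.
Proof.
elim: k => [|k IH]; first by rewrite /D /= mulmx0.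
by rewrite (cedas_rec k).2 mulmxDr IH mulmxA JM mul0mx addr0.
Qed.

Notation xbar s := (rowmean (xq s)).

Lemma mean_rec s : xbar s.+1 = xbar s - h *: rowmean (sgrad s).
Proof.
case: s => [|k].
  by rewrite /= rowmeanB rowmeanZ.
rewrite (cedas_rec k).1 rowmeanB.
have avg0 (X : 'M[R]_(n, p)) : J *m X = 0 -> rowmean X = 0.
  by move=> X0; rewrite -(rowmean_spread n0 (rowmean X)) -avg_mx_mul X0
     -(scale0r (0 : 'M[R]_(n, p))) rowmeanZ scale0r.
rewrite (avg0 (M *m _)) ?mulmxA ?JM ?mul0mx// subr0.
by rewrite /half_step rowmeanB (avg0 (D k)) ?avg_dual// subr0 rowmeanB rowmeanZ.
Qed.

(** The local gradients at the common point given by the mean; -h times their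
centred part is the equilibrium of the dual variable. *)
Definition mean_grad s := gradF f (spread (xbar s)).

Lemma grad_deviation s :
  sqnorm (gradF f (xq s) - mean_grad s) <= L ^+ 2 * sqnorm (cen (xq s)).
Proof. by rewrite cen_spread; exact: gradF_lipschitz. Qed.

Lemma sqnorm_sgrad_mean s : sqnorm (rowmean (sgrad s)) =
  sqnorm (rowmean (gradF f (xq s))) +
  2 * dotm (rowmean (gradF f (xq s))) (rowmean (noise s)) +
  sqnorm (rowmean (noise s)).
Proof. by rewrite -sqnormD -rowmeanD /noise addrC subrK. Qed.

(** The mean moves by -h (g + nu), where g and nu are the mean gradient and the mean
noise.  Writing G for the gradient of the average objective at the mean,
-<G, g> = (|G - g|^2 - |G|^2 - |g|^2) / 2, and |G - g|^2 is at most L^2 / n times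
the consensus error.  The term in |g|^2 is kept, to absorb the motion of the
mean in the consensus recursion. *)
Lemma descent_path s : 0 <= h ->
  favg f (xbar s.+1) <= favg f (xbar s)
    - h / 2 * sqnorm (grad (favg f) (xbar s))
    - h / 2 * (1 - L * h) * sqnorm (rowmean (gradF f (xq s)))
    + h * L ^+ 2 / (2 * n%:R) * sqnorm (cen (xq s))
    + L * h ^+ 2 * dotm (rowmean (gradF f (xq s))) (rowmean (noise s))
    + L * h ^+ 2 / 2 * sqnorm (rowmean (noise s))
    - h * dotm (grad (favg f) (xbar s)) (rowmean (noise s)).
Proof.
move=> h0.
have := descent_lemma (xbar s) (xbar s.+1) L0 (differentiable_favg df)
  (lipschitz_grad_favg n0 L0 df sm).
have -> : xbar s.+1 - xbar s = - (h *: rowmean (sgrad s)).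
  by rewrite mean_rec addrC addKr.
rewrite sqnormN sqnormZ sqnorm_sgrad_mean dotmNr dotmZr.
have -> : rowmean (sgrad s) = rowmean (gradF f (xq s)) + rowmean (noise s).
  by rewrite -rowmeanD /noise addrC subrK.
set g := rowmean (gradF f (xq s)); set nu := rowmean (noise s).
set G := grad _ _; rewrite dotmDr.
(* averaging n gradients divides the squared deviation by n *)
have dev : sqnorm (G - g) <= L ^+ 2 / n%:R * sqnorm (cen (xq s)).
  have -> : G - g = - rowmean (gradF f (xq s) - mean_grad s).
    by rewrite rowmeanB opprB /mean_grad rowmean_gradF_spread.
  have nR : 0 < n%:R :> R by rewrite ltr0n.
  rewrite sqnormN -(ler_pM2l nR); apply: (le_trans (sqnorm_rowmean_le n0 _)).
  have -> : n%:R * (L ^+ 2 / n%:R * sqnorm (cen (xq s))) =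
    L ^+ 2 * sqnorm (cen (xq s)) by field; rewrite gt_eqF.
  exact: grad_deviation.
rewrite sqnormB in dev.
have := ler_wpM2l (divr_ge0 h0 (ler0n R 2)) dev.
have -> : h * L ^+ 2 / (2 * n%:R) * sqnorm (cen (xq s)) =
    h / 2 * (L ^+ 2 / n%:R * sqnorm (cen (xq s))).
  by field; rewrite pnatr_eq0 -lt0n.
set c := L ^+ 2 / n%:R * _ => h1 h2.
apply: (le_trans h2); rewrite -!addrA; rewrite lerD2l.
move: h1; set a := sqnorm g; set b := sqnorm G; set dd := dotm G g.
move: (dotm G nu) (dotm g nu) (sqnorm nu) => u v q; rewrite !expr2; lra.
Qed.

Variable B : 'M[R]_n.
Hypotheses (Bsym : B^T = B) (MB : M *m B = 1%:M - J) (JB : J *m B = 0).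

(** The dual error: at equilibrium the dual variable cancels the centred gradients. *)
Definition tracking k := D k + h *: cen (mean_grad k.+1).

Definition lyap_path k := lyap B (cen (xq k.+1)) (tracking k).

(** The part of the centred half-step that is determined before the noise is drawn. *)
Definition drift k :=
  cen (xq k.+1) - h *: cen (gradF f (xq k.+1) - mean_grad k.+1).

Lemma avg_tracking k : J *m tracking k = 0.
Proof. by rewrite mulmxDr avg_dual -scalemxAr avg_cen// scaler0 addr0. Qed.

Lemma avg_drift k : J *m drift k = 0.
Proof. by rewrite mulmxBr -scalemxAr !avg_cen// scaler0 subrr. Qed.

Let half_step_split (x g m s d : 'M[R]_(n, p)) :
  x - h *: (g - m) - h *: (s - g) - (d + h *: m) = x - h *: s - d.
Proof. by apply/matrixP => i j; rewrite !mxE; ring. Qed.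

Let tracking_split (d y m m' : 'M[R]_(n, p)) :
  d + y + h *: m' = d + h *: m + y + h *: (m' - m).
Proof. by apply/matrixP => i j; rewrite !mxE; ring. Qed.

(** An instance of lyap_step in which U is the change of the gradients as the mean
moves: its norm is at most sqrt n L h times that of the mean stochastic gradient,
which splits into the mean gradient and the mean noise. *)
Lemma lyap_path_step k : 0 <= h -> h * L <= rho / 16 ->
  lyap_path k.+1 <= (1 - rho / 4) * lyap_path k
    - 2 * h * ((1 + rho / 4) * (1 - rho)) * dotm (drift k) (noise k.+1)
    + h ^+ 2 * sqnorm (noise k.+1)
    + 5 * h ^+ 4 * L ^+ 2 / rho ^+ 2 * n%:R *
      (sqnorm (rowmean (gradF f (xq k.+1))) +
       2 * dotm (rowmean (gradF f (xq k.+1))) (rowmean (noise k.+1)) +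
       sqnorm (rowmean (noise k.+1))).
Proof.
move=> h0 hL.
pose S := cen (gradF f (xq k.+1) - mean_grad k.+1).
pose N := cen (noise k.+1).
pose U := cen (mean_grad k.+2 - mean_grad k.+1).
(* the centred half-step, in terms of the errors *)
pose Y := drift k - h *: N - tracking k.
have YE : Y = cen (half_step k).
  rewrite /Y /drift /tracking /N /noise /half_step !cenB !cenZ.
  by rewrite (cen_id (avg_dual k)) half_step_split.
have MY : M *m Y = M *m half_step k.
  by rewrite YE /cen mulmxBr mulmxA MJ mul0mx subr0.
have JS : J *m S = 0 by exact: avg_cen.
have JN : J *m N = 0 by exact: avg_cen.
have JU : J *m U = 0 by exact: avg_cen.
have JX : J *m cen (xq k.+1) = 0 by exact: avg_cen.
have SX : sqnorm S <= L ^+ 2 * sqnorm (cen (xq k.+1)).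
  by rewrite (le_trans (sqnorm_cen_le n0 _))// grad_deviation.
have -> : lyap_path k.+1 =
    lyap B (Y - M *m Y) (tracking k + M *m Y + h *: U).
  rewrite /lyap_path MY; congr lyap.
    rewrite (cedas_rec k).1 cenB -YE cen_id//.
    by rewrite mulmxA JM mul0mx.
  by rewrite /tracking (cedas_rec k).2 /U cenB (tracking_split _ _ (cen (mean_grad k.+1))).
have := lyap_step (gossip_sym net) (@avg_mx_tr _ _) MJ
  (gap_gt0 net) (gap_le n2 net) (gossip_ge n2 net) (gossip_le net)
  Bsym MB JB JX (avg_tracking k) JS JN JU h0 (ltW L0) hL SX (erefl _)
  (erefl Y).
move=> /le_trans; apply.
have dn : dotm (drift k) N = dotm (drift k) (noise k.+1).
  by rewrite dotm_cen// avg_drift.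
rewrite -/(drift k) dn; apply: lerD.
  rewrite lerD2l ler_wpM2l ?sqr_ge0//; exact: sqnorm_cen_le.
have r0 := gap_gt0 net.
have UL : sqnorm U <= L ^+ 2 * (n%:R * (h ^+ 2 * sqnorm (rowmean (sgrad k.+1)))).
  apply: (le_trans (sqnorm_cen_le n0 _)).
  apply: (le_trans (gradF_lipschitz L0 sm _ _)).
  rewrite -spreadB sqnorm_spread mean_rec.
  have -> : xbar k.+1 - h *: rowmean (sgrad k.+1) - xbar k.+1 =
      - (h *: rowmean (sgrad k.+1)) by rewrite addrC addKr.
  by rewrite sqnormN sqnormZ.
rewrite -sqnorm_sgrad_mean.
have c0 : 0 <= 5 * h ^+ 2 / rho ^+ 2.
  by apply: divr_ge0; rewrite ?sqr_ge0// mulr_ge0 ?sqr_ge0.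
apply: (le_trans (ler_wpM2l c0 UL)).
by rewrite le_eqVlt; apply/orP; left; apply/eqP; field; rewrite gt_eqF.
Qed.

Lemma cen_le_lyap_path k : sqnorm (cen (xq k.+1)) <= lyap_path k.
Proof.
exact: (lyap_ge (gossip_sym net) (@avg_mx_tr _ _)
  (gap_gt0 net) (gossip_ge n2 net) (gossip_le net)
  Bsym MB JB _ (avg_tracking k)).
Qed.

Lemma lyap_path0_le : lyap_path 0 <=
  sqnorm (cen (xq 1)) + rho^-1 * (h ^+ 2 * sqnorm (mean_grad 1)).
Proof.
have := lyap_le (gap_gt0 net) (gossip_ge n2 net) MB JB (cen (xq 1))
  (avg_tracking 0).
move=> /le_trans; apply; rewrite lerD2l ler_wpM2l ?invr_ge0 ?(ltW (gap_gt0 net))//.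
rewrite /tracking /D /= add0r sqnormZ ler_wpM2l ?sqr_ge0//.
exact: sqnorm_cen_le.
Qed.

End Path.

(** * The gradient noise *)

Section OracleMeasurable.
Context {R : realType} {n p : nat} {dX : measure_display}.
Variables (Xi : 'I_n -> measurableType dX).
Variables (oracle : forall i, 'rV[R]_p -> Xi i -> 'rV[R]_p).
Hypothesis moracle : measurable_oracle oracle.

(** Joint measurability in the point and the sample makes the substitution of random
arguments measurable; a row vector is passed through the type of tuples, which
carries the product sigma-algebra. *)
Lemma measurable_oracle_comp d (T : measurableType d) i (x : T -> 'rV[R]_p)
  (z : T -> Xi i) : measurable_mx x -> measurable_fun setT z ->
  measurable_mx (fun w => oracle (x w) (z w)).
Proof.
move=> mx mz k j; rewrite [k]ord1.
pose tup w : p.-tuple R := [tuple x w 0 l | l < p].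
have xE w : x w = \row_l tnth (tup w) l.
  by apply/rowP => l; rewrite mxE tnth_mktuple.
rewrite (_ : (fun w => _) = (fun u : p.-tuple R * Xi i =>
    oracle (\row_l tnth u.1 l) u.2 0 j) \o (fun w => (tup w, z w))).
  apply: measurableT_comp; first exact: moracle.
  apply: measurable_fun_pair => //; apply/measurable_fun_tnthP => l.
  rewrite (_ : _ \o _ = fun w => x w 0 l); first exact: mx.
  by apply/funext => w /=; rewrite tnth_mktuple.
by apply/funext => w /=; rewrite -xE.
Qed.

End OracleMeasurable.

Section LinearMaps.
Context {R : realType} {n p : nat}.
Implicit Types (X : 'M[R]_(n, p)).

Lemma rowmean_mull X : rowmean X = (const_mx n%:R^-1 : 'rV[R]_n) *m X.
Proof.
apply/rowP => j; rewrite rowmeanE mxE mulr_sumr.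
by apply: eq_bigr => i _; rewrite mxE.
Qed.

Lemma spread_mull (v : 'rV[R]_p) : spread v = (const_mx 1 : 'cV[R]_n) *m v.
Proof. by apply/matrixP => i j; rewrite !mxE big_ord1 mxE mul1r. Qed.

End LinearMaps.

Section Noise.
Context {R : realType} {n p : nat} {d dX : measure_display}
  {T : measurableType d}.
Variables (P : probability T R) (f : 'I_n -> 'rV[R]_p -> R) (L sigma : R).
Variables (W : 'M[R]_n) (Xi : 'I_n -> measurableType dX).
Variables (oracle : forall i, 'rV[R]_p -> Xi i -> 'rV[R]_p) (alpha h : R).
Variables (xm1 H0 : 'M[R]_(n, p)) (xi : forall i, nat -> T -> Xi i).
Hypotheses (n0 : (0 < n)%N) (L0 : 0 < L) (sm : smooth f L).
Hypothesis df : forall i x, differentiable (f i) x.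
Hypothesis moracle : measurable_oracle oracle.
Hypothesis mxi : forall i s, measurable_fun setT (xi i s).

Let z w : nat -> forall i, Xi i := fun s i => xi i s w.
Let xq s w :=
  cedas_query idfun W alpha (1 / 8) (fun=> h) oracle xm1 H0 (z w) s.
Let D k w :=
  cedas_D (cedas idfun W alpha (1 / 8) (fun=> h) oracle xm1 H0 (z w) k).
Let G s w := sgrad W oracle alpha h xm1 H0 (z w) s.
Let N s w := noise f W oracle alpha h xm1 H0 (z w) s.
Let mg s w := mean_grad f W oracle alpha h xm1 H0 (z w) s.

Hypothesis sg : stochastic_gradient P f oracle sigma xq xi.

Definition past_gen s : set (set T) :=
  [set A | exists i t (B : set (Xi i)),
         [/\ (t < s)%N, measurable B & A = xi i t @^-1` B] ].

Definition gmeas_mx (F : set (set T)) m k (A : T -> 'M[R]_(m, k)) :=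
  @measurable_mx R _ (g_sigma_algebraType F) m k A.

Lemma past_gen_sub s : <<s past_gen s >> `<=` measurable.
Proof.
apply: smallest_sub; first exact: sigma_algebra_measurable.
move=> _ [i [t [B [ts mB ->]]]].
by have := @mxi i t measurableT _ mB; rewrite setTI.
Qed.

Lemma past_gen_mono s s' : (s <= s')%N -> <<s past_gen s >> `<=` <<s past_gen s' >>.
Proof.
move=> ss'; apply: smallest_sub; first exact: smallest_sigma_algebra.
move=> _ [i [t [B [ts mB ->]]]]; apply: sub_sigma_algebra.
by exists i, t, B; split => //; exact: leq_trans ts ss'.
Qed.

Lemma gmeas_mx_mono s s' m k (A : T -> 'M[R]_(m, k)) : (s <= s')%N ->
  gmeas_mx (past_gen s) A -> gmeas_mx (past_gen s') A.
Proof. by move=> ss' mA i j; apply: sub_gmeas (mA i j); exact: past_gen_mono. Qed.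

Lemma gmeas_mx_measurable s m k (A : T -> 'M[R]_(m, k)) :
  gmeas_mx (past_gen s) A -> measurable_mx A.
Proof. by move=> mA i j; apply: gmeas_meas (mA i j); exact: past_gen_sub. Qed.

Lemma sample_past s s' i : (s < s')%N ->
  @measurable_fun _ _ (g_sigma_algebraType (past_gen s')) (Xi i) setT (xi i s).
Proof.
move=> ss' _ B mB; rewrite setTI; apply: sub_sigma_algebra.
by exists i, s, B.
Qed.

Lemma sgrad_gmeas s : gmeas_mx (past_gen s) (xq s) -> gmeas_mx (past_gen s.+1) (G s).
Proof.
move=> mx i j.
rewrite (_ : (fun w => _) = fun w => oracle (row i (xq s w)) (xi i s w) 0 j).
  apply: (measurable_oracle_comp moracle (T := g_sigma_algebraType (past_gen s.+1))).
    apply: measurable_mx_row; exact: gmeas_mx_mono mx.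
  exact: sample_past.
by apply/funext => w; rewrite /G /sgrad mxE.
Qed.

(** By induction on the recursion: each step uses the current iterates, known from
the samples of smaller index, and one oracle call with the current samples. *)
Lemma query_dual_gmeas k :
  gmeas_mx (past_gen k.+1) (xq k.+1) /\ gmeas_mx (past_gen k.+1) (D k).
Proof.
have x0 : gmeas_mx (past_gen 0) (xq 0) by exact: measurable_mx_cst.
elim: k => [|k [mx mD]].
  split; last exact: measurable_mx_cst.
  apply: (@measurable_mxB _ _ (g_sigma_algebraType (past_gen 1))).
    exact: measurable_mx_cst.
  by apply: measurable_mxZ; exact: sgrad_gmeas x0.
have rec w := cedas_rec W oracle alpha h xm1 H0 (z w) k.
pose y w := half_step W oracle alpha h xm1 H0 (z w) k.
have my : gmeas_mx (past_gen k.+2) y.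
  have h1 := gmeas_mx_mono (leqnSn k.+1) mx; have h2 := gmeas_mx_mono (leqnSn k.+1) mD.
  apply: (@measurable_mxB _ _ (g_sigma_algebraType (past_gen k.+2))) => //.
  apply: (@measurable_mxB _ _ (g_sigma_algebraType (past_gen k.+2))) => //.
  by apply: measurable_mxZ; exact: sgrad_gmeas.
split.
- rewrite /gmeas_mx (_ : xq k.+2 = fun w => y w - gossip W *m y w).
    apply: (@measurable_mxB _ _ (g_sigma_algebraType (past_gen k.+2))) => //.
    exact: measurable_mx_mull.
  by apply/funext => w; exact: (rec w).1.
- rewrite /gmeas_mx (_ : D k.+1 = fun w => D k w + gossip W *m y w).
    apply: (@measurable_mxD _ _ (g_sigma_algebraType (past_gen k.+2))).
      exact: gmeas_mx_mono mD.
    exact: measurable_mx_mull.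
  by apply/funext => w; exact: (rec w).2.
Qed.

Lemma query_gmeas s : gmeas_mx (past_gen s) (xq s).
Proof. by case: s => [|k]; [exact: measurable_mx_cst|case: (query_dual_gmeas k)]. Qed.

Section AnySigmaAlgebra.
Context {d' : measure_display} {T' : measurableType d'}.
Variable A : T' -> 'M[R]_(n, p).
Hypothesis mA : measurable_mx A.

Lemma measurable_gradF : measurable_mx (fun w => gradF f (A w)).
Proof.
move=> i j; rewrite (_ : (fun w => _) = fun w => grad (f i) (row i (A w)) 0 j).
  apply: (measurable_continuous_rV (phi := fun x => grad (f i) x 0 j)).
    exact: lipschitz_grad_continuous L0 (smooth_lipschitz L0 sm i).
  exact: measurable_mx_row.
by apply/funext => w; rewrite mxE.
Qed.

Lemma measurable_rowmean : measurable_mx (fun w => rowmean (A w)).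
Proof.
under eq_fun do rewrite rowmean_mull.
exact: measurable_mx_mull.
Qed.

Lemma measurable_spread (v : T' -> 'rV[R]_p) : measurable_mx v ->
  measurable_mx (fun w => spread (v w) : 'M[R]_(n, p)).
Proof. by move=> mv; under eq_fun do rewrite spread_mull; exact: measurable_mx_mull. Qed.

Lemma measurable_cen : measurable_mx (fun w => cen (A w)).
Proof. by under eq_fun do rewrite cenE; exact: measurable_mx_mull. Qed.

End AnySigmaAlgebra.

Lemma gradF_gmeas s : gmeas_mx (past_gen s) (fun w => gradF f (xq s w)).
Proof. by apply: measurable_gradF; exact: query_gmeas. Qed.

Lemma mean_grad_gmeas s : gmeas_mx (past_gen s) (mg s).
Proof.
apply: measurable_gradF; apply: measurable_spread; apply: measurable_rowmean; exact: query_gmeas.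
Qed.

Lemma drift_gmeas k :
  gmeas_mx (past_gen k.+1) (fun w => drift f W oracle alpha h xm1 H0 (z w) k).
Proof.
apply: (@measurable_mxB _ _ (g_sigma_algebraType (past_gen k.+1))).
  by apply: measurable_cen; exact: query_gmeas.
apply: measurable_mxZ; apply: measurable_cen.
apply: (@measurable_mxB _ _ (g_sigma_algebraType (past_gen k.+1))).
  exact: gradF_gmeas.
exact: mean_grad_gmeas.
Qed.

Lemma noiseE s w i j : N s w i j =
  oracle (row i (xq s w)) (xi i s w) 0 j - grad (f i) (row i (xq s w)) 0 j.
Proof. by rewrite /N /noise !mxE. Qed.

Lemma noise_orth s i j : orth P (past_gen s) (fun w => N s w i j).
Proof.
have [_ h2 _] := sg s.
have [_ _ _] := cond_expectation_orth (@past_gen_sub s) (h2 i j).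
by under [X in _ -> orth _ _ X]eq_fun do rewrite noiseE.
Qed.

Lemma measurable_noise s : measurable_mx (N s).
Proof.
have h1 := gmeas_mx_measurable (sgrad_gmeas (@query_gmeas s)).
have h2 := gmeas_mx_measurable (@gradF_gmeas s).
exact: measurable_mxB h1 h2.
Qed.

Lemma row_noise s w i : row i (N s w) =
  oracle (row i (xq s w)) (xi i s w) - grad (f i) (row i (xq s w)).
Proof. by apply/rowP => j; rewrite mxE noiseE !mxE. Qed.

Lemma noise_row_sq s i : intble P (fun w => sqnorm (row i (N s w))) /\
  Ex P (fun w => sqnorm (row i (N s w))) <= sigma ^+ 2.
Proof.
have [_ _ h3] := sg s; have [V [hV Vs]] := h3 i.
have [iX iV mV oV] := cond_expectation_orth (@past_gen_sub s) hV.
under [X in intble P X]eq_fun do rewrite row_noise.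
under [X in Ex P X]eq_fun do rewrite row_noise.
split => //.
have := orthB_Ex (@past_gen_sub s) iX iV oV
  (@measurableT _ (g_sigma_algebraType (past_gen s))).
under [X in Ex P X = _]eq_fun do rewrite indicT mulr1.
under [X in _ = Ex P X]eq_fun do rewrite indicT mulr1.
by move=> ->; exact: Ex_le_ae.
Qed.

Lemma noise_L2 s : L2 P (N s).
Proof.
split; first exact: measurable_noise.
under [X in intble P X]eq_fun do rewrite sqnorm_row.
by apply: intble_sum => i _; case: (noise_row_sq s i).
Qed.

Lemma Ex_noise_sq s : Ex P (fun w => sqnorm (N s w)) <= n%:R * sigma ^+ 2.
Proof.
under [X in Ex P X]eq_fun do rewrite sqnorm_row.
rewrite Ex_sum; last by move=> i _; case: (noise_row_sq s i).
rewrite mulr_natl -[n in _ *+ n]card_ord -sumr_const.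
by apply: ler_sum => i _; case: (noise_row_sq s i).
Qed.

Lemma L2_rowmean (A : T -> 'M[R]_(n, p)) : L2 P A -> L2 P (fun w => rowmean (A w)).
Proof.
by move=> hA; under [X in L2 P X]eq_fun do rewrite rowmean_mull; exact: L2_mull.
Qed.

Lemma L2_spread (v : T -> 'rV[R]_p) : L2 P v ->
  L2 P (fun w => spread (v w) : 'M[R]_(n, p)).
Proof.
by move=> hA; under [X in L2 P X]eq_fun do rewrite spread_mull; exact: L2_mull.
Qed.

Lemma L2_cen (A : T -> 'M[R]_(n, p)) : L2 P A -> L2 P (fun w => cen (A w)).
Proof.
by move=> hA; under [X in L2 P X]eq_fun do rewrite cenE; exact: L2_mull.
Qed.

Lemma L2_gradF (A : T -> 'M[R]_(n, p)) : L2 P A -> L2 P (fun w => gradF f (A w)).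
Proof.
move=> [mA iA]; apply: L2_dom (intbleD (intble_cst P (2 * sqnorm (gradF f 0)))
  (intbleZ (2 * L ^+ 2) iA)) _; first exact: measurable_gradF.
by move=> w; exact: gradF_growth.
Qed.

(** Expanding the square of the sum over the agents, the cross terms vanish because
noises of distinct agents are uncorrelated; each noise depends only on the past
and on the sample of its agent.  The n diagonal terms divided by n^2 give the
factor 1 / n. *)
Lemma Ex_noise_mean_sq s :
  Ex P (fun w => sqnorm (rowmean (N s w))) <= sigma ^+ 2 / n%:R.
Proof.
have nR : 0 < n%:R :> R by rewrite ltr0n.
have [h1 _ _] := sg s.
have mx : forall i, measurable_fun setT (xi i s) by move=> i; exact: mxi.
have GT := @past_gen_sub s.
have iN i k j : intble P (fun w => N s w i j * N s w k j).
  by apply: L2_entryM; exact: noise_L2.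
have cross i k j : i != k -> Ex P (fun w => N s w i j * N s w k j) = 0.
  move=> ik.
  have mN l : gmeas (past_with (past_gen s) (fun i => xi i s) l) (fun w => N s w l j).
    under eq_fun do rewrite noiseE.
    apply: measurable_funB.
      apply: (measurable_oracle_comp moracle
        (T := g_sigma_algebraType (past_with (past_gen s) (fun i => xi i s) l))).
        apply: measurable_mx_row => a b; apply: sub_gmeas (@query_gmeas s a b).
        exact: past_with_past.
      by move=> _ B mB; rewrite setTI; exact: past_with_sample.
    have := @gradF_gmeas s l j; under [X in measurable_fun _ X -> _]eq_fun do rewrite mxE.
    by apply: sub_gmeas; exact: past_with_past.
  apply: (cond_indep_uncorrelated GT mx h1 ik (mN i) (mN k)) => //.
  - by apply: L2_entry; exact: noise_L2.
  - exact: noise_orth.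
have E w : sqnorm (rowmean (N s w)) =
    n%:R^-1 ^+ 2 * \sum_j \sum_i \sum_k N s w i j * N s w k j.
  rewrite /sqnorm big_ord1 mulr_sumr; apply: eq_bigr => j _.
  rewrite rowmeanE exprMn; congr (_ * _).
  by rewrite expr2 mulr_suml; apply: eq_bigr => i _; rewrite mulr_sumr.
under [X in Ex P X]eq_fun do rewrite E.
rewrite ExZ; last first.
  by apply: intble_sum => j _; apply: intble_sum => i _; exact: intble_sum.
rewrite Ex_sum; last by move=> j _; apply: intble_sum => i _; exact: intble_sum.
rewrite (eq_bigr (fun j => \sum_i Ex P (fun w => N s w i j * N s w i j))); last first.
  move=> j _; rewrite Ex_sum; last by move=> i _; exact: intble_sum.
  apply: eq_bigr => i _; rewrite Ex_sum// (bigD1 i)//= big1 ?addr0// => k ki.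
  by rewrite cross// eq_sym.
rewrite exchange_big /=.
have -> : \sum_i \sum_j Ex P (fun w => N s w i j * N s w i j) =
    Ex P (fun w => sqnorm (N s w)).
  under [X in _ = Ex P X]eq_fun do rewrite sqnormE dotmE.
  rewrite Ex_sum; last by move=> i _; exact: intble_sum.
  by apply: eq_bigr => i _; rewrite Ex_sum.
rewrite (_ : sigma ^+ 2 / n%:R = n%:R^-1 ^+ 2 * (n%:R * sigma ^+ 2)); last first.
  by field; rewrite gt_eqF.
by rewrite ler_wpM2l ?sqr_ge0// Ex_noise_sq.
Qed.

Lemma Ex_dotm_noise s (Z : T -> 'M[R]_(n, p)) : L2 P Z -> gmeas_mx (past_gen s) Z ->
  Ex P (fun w => dotm (Z w) (N s w)) = 0.
Proof.
move=> hZ mZ; apply: (Ex_dotm_orth (@past_gen_sub s)) => //.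
- exact: noise_L2.
- by move=> i j; exact: noise_orth.
Qed.

Lemma Ex_dotm_noise_mean s (v : T -> 'rV[R]_p) : L2 P v -> gmeas_mx (past_gen s) v ->
  Ex P (fun w => dotm (v w) (rowmean (N s w))) = 0.
Proof.
move=> hv mv; have nR : n%:R != 0 :> R by rewrite pnatr_eq0 -lt0n.
have := @Ex_dotm_noise s _ (L2_spread hv) (measurable_spread mv).
under [X in Ex P X = _ -> _]eq_fun do rewrite dotm_spread//.
rewrite ExZ; last by apply: L2_dotm => //; apply: L2_rowmean; exact: noise_L2.
by move=> /eqP; rewrite mulf_eq0 (negbTE nR) => /eqP.
Qed.

Lemma sgrad_split s w : G s w = gradF f (xq s w) + N s w.
Proof. by rewrite /N /noise addrC subrK. Qed.

Lemma sgrad_L2 s : L2 P (xq s) -> L2 P (G s).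
Proof.
move=> hx; rewrite (_ : G s = fun w => gradF f (xq s w) + N s w).
  by apply: L2D; [exact: L2_gradF|exact: noise_L2].
by apply/funext => w; exact: sgrad_split.
Qed.

(** The noise is square-integrable and the gradients grow at most linearly, so
square-integrability propagates along the recursion. *)
Lemma query_dual_L2 k : L2 P (xq k.+1) /\ L2 P (D k).
Proof.
have x0 : L2 P (xq 0) by exact: L2_cst.
elim: k => [|k [hx hD]].
  split; last exact: L2_cst.
  by apply: L2B; [exact: L2_cst|apply: L2Z; exact: (sgrad_L2 x0)].
have rec w := cedas_rec W oracle alpha h xm1 H0 (z w) k.
pose y w := half_step W oracle alpha h xm1 H0 (z w) k.
have hy : L2 P y by do 2!apply: L2B => //; apply: L2Z; exact: sgrad_L2.
split.
- rewrite (_ : xq k.+2 = fun w => y w - gossip W *m y w).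
    by apply: L2B => //; exact: L2_mull.
  by apply/funext => w; exact: (rec w).1.
- rewrite (_ : D k.+1 = fun w => D k w + gossip W *m y w).
    by apply: L2D => //; exact: L2_mull.
  by apply/funext => w; exact: (rec w).2.
Qed.

Lemma query_L2 s : L2 P (xq s).
Proof. by case: s => [|k]; [exact: L2_cst|case: (query_dual_L2 k)]. Qed.

Lemma mean_grad_L2 s : L2 P (mg s).
Proof. by apply: L2_gradF; apply: L2_spread; apply: L2_rowmean; exact: query_L2. Qed.

Lemma drift_L2 k : L2 P (fun w => drift f W oracle alpha h xm1 H0 (z w) k).
Proof.
apply: L2B; first by apply: L2_cen; exact: query_L2.
apply: L2Z; apply: L2_cen; apply: L2B; last exact: mean_grad_L2.
by apply: L2_gradF; exact: query_L2.
Qed.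

End Noise.

(** * Expected inequalities for one run *)

Section OneRun.
Context {R : realType} {n p : nat} {d dX : measure_display}
  {T : measurableType d}.
Variables (P : probability T R) (f : 'I_n -> 'rV[R]_p -> R) (L sigma : R).
Variables (e : rel 'I_n) (W : 'M[R]_n) (lam : n.-tuple R).
Variables (Xi : 'I_n -> measurableType dX).
Variables (oracle : forall i, 'rV[R]_p -> Xi i -> 'rV[R]_p) (alpha h : R).
Variables (xm1 H0 : 'M[R]_(n, p)) (xi : forall i, nat -> T -> Xi i).
Hypotheses (n2 : (2 <= n)%N) (L0 : 0 < L) (sm : smooth f L).
Hypothesis df : forall i x, differentiable (f i) x.
Hypothesis net : network e W lam.
Hypothesis moracle : measurable_oracle oracle.
Hypothesis mxi : forall i s, measurable_fun setT (xi i s).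

Notation rho := (gap lam).
Let z w : nat -> forall i, Xi i := fun s i => xi i s w.
Let xq s w :=
  cedas_query idfun W alpha (1 / 8) (fun=> h) oracle xm1 H0 (z w) s.
Let N s w := noise f W oracle alpha h xm1 H0 (z w) s.
Let mg s w := mean_grad f W oracle alpha h xm1 H0 (z w) s.
Let dr k w := drift f W oracle alpha h xm1 H0 (z w) k.

Hypothesis sg : stochastic_gradient P f oracle sigma xq xi.
Hypotheses (h0 : 0 <= h) (hL : h * L <= rho / 16).

Let n0 : (0 < n)%N. Proof. exact: ltnW. Qed.
Let nR : 0 < n%:R :> R. Proof. by rewrite ltr0n. Qed.

Notation gF s w := (gradF f (xq s w)).
Notation gm s w := (rowmean (gradF f (xq s w))).
Notation gf s w := (grad (favg f) (rowmean (xq s w))).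
Notation Nm s w := (rowmean (N s w)).

Let hN s : L2 P (N s). Proof. exact: (noise_L2 L0 sm moracle mxi sg s). Qed.
Let hx s : L2 P (xq s). Proof. exact: (query_L2 L0 sm moracle mxi sg s). Qed.
Let hgF s : L2 P (fun w => gF s w). Proof. exact: (L2_gradF L0 sm). Qed.
Let hgm s : L2 P (fun w => gm s w). Proof. by apply: L2_rowmean. Qed.
Let hNm s : L2 P (fun w => Nm s w). Proof. by apply: L2_rowmean. Qed.
Let hmg s : L2 P (mg s). Proof. exact: (mean_grad_L2 L0 sm moracle mxi sg s). Qed.
Let hcen s : L2 P (fun w => cen (xq s w)). Proof. by apply: L2_cen. Qed.
Let gfE s w : gf s w = rowmean (mg s w).
Proof. by rewrite /mg /mean_grad rowmean_gradF_spread. Qed.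
Let hgf s : L2 P (fun w => gf s w).
Proof. by under [X in L2 P X]eq_fun do rewrite gfE; exact: L2_rowmean. Qed.
Let hdr k : L2 P (dr k). Proof. exact: (drift_L2 L0 sm moracle mxi sg k). Qed.

Definition Ex_grad s := Ex P (fun w => sqnorm (gf s w)).
Definition Ex_mean_grad s := Ex P (fun w => sqnorm (gm s w)).
Definition Ex_consensus s := Ex P (fun w => sqnorm (cen (xq s w))).

Let Ex_gm_N s : Ex P (fun w => dotm (gm s w) (Nm s w)) = 0.
Proof.
apply: (Ex_dotm_noise_mean n0 L0 sm moracle mxi sg) => //.
by apply: measurable_rowmean; exact: (gradF_gmeas W alpha h xm1 H0 L0 sm moracle).
Qed.

Let Ex_gf_N s : Ex P (fun w => dotm (gf s w) (Nm s w)) = 0.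
Proof.
under [X in Ex P X]eq_fun do rewrite gfE.
apply: (Ex_dotm_noise_mean n0 L0 sm moracle mxi sg); first exact: L2_rowmean.
by apply: measurable_rowmean; exact: (mean_grad_gmeas W alpha h xm1 H0 L0 sm moracle).
Qed.

Let Ex_dr_N k : Ex P (fun w => dotm (dr k w) (N k.+1 w)) = 0.
Proof.
apply: (Ex_dotm_noise L0 sm moracle mxi sg) => //.
exact: (drift_gmeas W alpha h xm1 H0 L0 sm moracle).
Qed.

Let Ex_N s : Ex P (fun w => sqnorm (N s w)) <= n%:R * sigma ^+ 2.
Proof. exact: (Ex_noise_sq mxi sg s). Qed.

Let Ex_Nm s : Ex P (fun w => sqnorm (Nm s w)) <= sigma ^+ 2 / n%:R.
Proof. exact: (Ex_noise_mean_sq n0 L0 sm moracle mxi sg s). Qed.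

Let i_sq m k (A : T -> 'M[R]_(m, k)) : L2 P A -> intble P (fun w => sqnorm (A w)).
Proof. by case. Qed.

Lemma expectation_grad s :
  ('E_P[fun w => sqnorm (gf s w)] = (Ex_grad s)%:E)%E.
Proof. by rewrite unlock EFin_Ex//; exact: i_sq (hgf s). Qed.

(** The descent inequality is summed along each path, where the values of the
objective telescope and the last one is at least the infimum; only gradients and
noises, which are square-integrable, remain when the expectation is taken.  The
inner products with the noise have expectation 0. *)
Lemma descent_Ex K : has_lbound (range (favg f)) ->
  \sum_(s < K) (h / 2 * Ex_grad s + h / 2 * (1 - L * h) * Ex_mean_grad s) <=
  favg f (rowmean xm1) - finf f
  + h * L ^+ 2 / (2 * n%:R) * \sum_(s < K) Ex_consensus s
  + K%:R * (L * h ^+ 2 / 2 * (sigma ^+ 2 / n%:R)).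
Proof.
move=> lb.
(* the increments allowed by the descent inequality *)
pose r s w := - h / 2 * sqnorm (gf s w)
    + (- h / 2 * (1 - L * h)) * sqnorm (gm s w)
    + h * L ^+ 2 / (2 * n%:R) * sqnorm (cen (xq s w))
    + L * h ^+ 2 * dotm (gm s w) (Nm s w)
    + L * h ^+ 2 / 2 * sqnorm (Nm s w)
    + (- h) * dotm (gf s w) (Nm s w).
have tel w : finf f - favg f (rowmean xm1) <= \sum_(s < K) r s w.
  have fl : finf f <= favg f (rowmean (xq K w)).
    by apply: ge_inf => //; exists (rowmean (xq K w)).
  apply: (le_trans (lerB fl (lexx _))).
  rewrite -[X in _ - X <= _]/(favg f (rowmean (xq 0 w))).
  elim: K fl => [|K IH] _; first by rewrite subrr big_ord0.
  rewrite big_ord_recr /= -(subrK (favg f (rowmean (xq K w)))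
    (favg f (rowmean (xq K.+1 w)))) -addrA addrC lerD//.
    by apply: IH; apply: ge_inf => //; exists (rowmean (xq K w)).
  have := descent_path n2 L0 sm df net oracle alpha xm1 H0 (z w) K h0.
  rewrite -/(xq K.+1 w) -/(xq K w) -/(N K w) /r; lra.
pose i1 s := i_sq (hgf s); pose i2 s := i_sq (hgm s).
pose i3 s := i_sq (hcen s); pose i4 s := L2_dotm (hgm s) (hNm s).
pose i5 s := i_sq (hNm s); pose i6 s := L2_dotm (hgf s) (hNm s).
have ir s : intble P (r s).
  by do 5![apply: intbleD; last exact: intbleZ]; exact: intbleZ.
have Er s : Ex P (r s) <= - h / 2 * Ex_grad s +
    (- h / 2 * (1 - L * h)) * Ex_mean_grad s +
    h * L ^+ 2 / (2 * n%:R) * Ex_consensus s +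
    L * h ^+ 2 / 2 * (sigma ^+ 2 / n%:R).
  rewrite /r.
  rewrite ExD; [|by do 4![apply: intbleD; last exact: intbleZ]; exact: intbleZ|exact: intbleZ].
  rewrite ExD; [|by do 3![apply: intbleD; last exact: intbleZ]; exact: intbleZ|exact: intbleZ].
  rewrite ExD; [|by do 2![apply: intbleD; last exact: intbleZ]; exact: intbleZ|exact: intbleZ].
  rewrite ExD; [|by do 1![apply: intbleD; last exact: intbleZ]; exact: intbleZ|exact: intbleZ].
  rewrite ExD; [|exact: intbleZ|exact: intbleZ].
  rewrite !ExZ// Ex_gm_N Ex_gf_N !mulr0 !addr0 lerD2l ler_wpM2l//.
  by rewrite divr_ge0// mulr_ge0 ?sqr_ge0// ltW.
have : finf f - favg f (rowmean xm1) <= \sum_(s < K) Ex P (r s).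
  rewrite -Ex_sum; last by move=> s _; exact: ir.
  rewrite -[leLHS](Ex_cst P); apply: le_Ex => //; first exact: intble_cst.
  exact: intble_sum.
have h1 : \sum_(s < K) Ex P (r s) <= \sum_(s < K) (
    - (h / 2 * Ex_grad s + h / 2 * (1 - L * h) * Ex_mean_grad s) +
    (h * L ^+ 2 / (2 * n%:R) * Ex_consensus s +
    L * h ^+ 2 / 2 * (sigma ^+ 2 / n%:R))).
  by apply: ler_sum => s _; have := Er s; lra.
move=> /le_trans /(_ h1).
set a := L * h ^+ 2 / 2 * _; set b := h * L ^+ 2 / _.
have -> : K%:R * a = \sum_(s < K) a by rewrite sumr_const card_ord mulr_natl.
rewrite big_split sumrN /=; move: (\sum_(s < K) (h / 2 * _ + _)) => SA.
rewrite big_split /= -mulr_sumr; lra.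
Qed.

Variable B : 'M[R]_n.
Hypotheses (Bsym : B^T = B) (MB : gossip W *m B = 1%:M - avg_mx)
  (JB : avg_mx *m B = 0).

Definition Ex_lyap k :=
  Ex P (fun w => lyap_path f W oracle alpha h xm1 H0 (z w) B k).

Let htr k : L2 P (fun w => tracking f W oracle alpha h xm1 H0 (z w) k).
Proof.
apply: L2D; first by have [] := query_dual_L2 L0 sm moracle mxi sg k.
by apply: L2Z; apply: L2_cen; exact: hmg.
Qed.

Let i_lyap k :
  intble P (fun w => lyap_path f W oracle alpha h xm1 H0 (z w) B k).
Proof.
apply: intbleB; last exact: i_sq.
apply: intbleD; first exact: i_sq (hcen k.+1).
by apply: L2_dotm => //; exact: L2_mull.
Qed.

Lemma Ex_consensus_le k : Ex_consensus k.+1 <= Ex_lyap k.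
Proof.
apply: le_Ex => //; first exact: i_sq.
move=> w; exact: (cen_le_lyap_path f n2 net).
Qed.

(** The drift and the mean gradient are functions of the past, so their inner
products with the noise have expectation 0. *)
Lemma Ex_lyap_step k : Ex_lyap k.+1 <= (1 - rho / 4) * Ex_lyap k
  + h ^+ 2 * (n%:R * sigma ^+ 2)
  + 5 * h ^+ 4 * L ^+ 2 / rho ^+ 2 *
    (n%:R * Ex_mean_grad k.+1 + sigma ^+ 2).
Proof.
set c := 5 * h ^+ 4 * L ^+ 2 / rho ^+ 2.
have c0 : 0 <= c.
  apply: divr_ge0; last exact: sqr_ge0.
  by apply: mulr_ge0; [apply: mulr_ge0 => //; exact: exprn_ge0|exact: sqr_ge0].
set c1 := - (2 * h * ((1 + rho / 4) * (1 - rho))).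
pose V k w := lyap_path f W oracle alpha h xm1 H0 (z w) B k.
pose r w := (1 - rho / 4) * V k w + c1 * dotm (dr k w) (N k.+1 w)
  + h ^+ 2 * sqnorm (N k.+1 w) + c * n%:R * sqnorm (gm k.+1 w)
  + c * n%:R * 2 * dotm (gm k.+1 w) (Nm k.+1 w)
  + c * n%:R * sqnorm (Nm k.+1 w).
pose i1 := i_lyap k; pose i2 := L2_dotm (hdr k) (hN k.+1).
pose i3 := i_sq (hN k.+1); pose i4 := i_sq (hgm k.+1).
pose i5 := L2_dotm (hgm k.+1) (hNm k.+1); pose i6 := i_sq (hNm k.+1).
have ir : intble P r.
  by do 5![apply: intbleD; last exact: intbleZ]; exact: intbleZ.
have le1 : Ex_lyap k.+1 <= Ex P r.
  apply: (le_Ex (i_lyap k.+1) ir) => w.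
  have := lyap_path_step n2 L0 sm net oracle alpha xm1 H0 (z w) Bsym MB JB k h0 hL.
  rewrite -/(N k.+1 w) -/(dr k w) -/(xq k.+1 w) -/c /r -/(V k w) -/(V k.+1 w).
  move: (V k w) (V k.+1 w) (dotm (dr k w) _) (sqnorm (N k.+1 w)) => v v' x1 x2.
  move: (dotm (rowmean _) _) (sqnorm (Nm _ _)) (sqnorm (gm k.+1 w)) => x3 x4 x5.
  by rewrite /c1; lra.
apply: (le_trans le1); rewrite /r.
rewrite ExD; [|by do 4![apply: intbleD; last exact: intbleZ]; exact: intbleZ|exact: intbleZ].
rewrite ExD; [|by do 3![apply: intbleD; last exact: intbleZ]; exact: intbleZ|exact: intbleZ].
rewrite ExD; [|by do 2![apply: intbleD; last exact: intbleZ]; exact: intbleZ|exact: intbleZ].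
rewrite ExD; [|by do 1![apply: intbleD; last exact: intbleZ]; exact: intbleZ|exact: intbleZ].
rewrite ExD; [|exact: intbleZ|exact: intbleZ].
rewrite !ExZ// Ex_dr_N Ex_gm_N !mulr0 !addr0.
have e1 := ler_wpM2l (sqr_ge0 h) (Ex_N k.+1).
have cn : 0 <= c * n%:R by rewrite mulr_ge0// ltW.
have e2 := ler_wpM2l cn (Ex_Nm k.+1).
have e3 : c * n%:R * (sigma ^+ 2 / n%:R) = c * sigma ^+ 2.
  by field; rewrite gt_eqF.
rewrite e3 in e2; rewrite -/(Ex_lyap k) -/(Ex_mean_grad k.+1).
move: (Ex P (fun w => sqnorm (N k.+1 w))) e1 => x1 e1.
move: (Ex P (fun w => sqnorm (Nm k.+1 w))) e2 => x2 e2.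
move: (Ex_lyap k) (Ex_mean_grad k.+1) => v x3; lra.
Qed.

(** The first iterate is the initial point moved by a stochastic gradient, and the
initial dual variable is 0, so the dual error is h times a gradient.  It is
compared with the gradient at the initial point by smoothness, and h L <= rho / 16
makes the factor 1 / rho harmless. *)
Lemma Ex_lyap0_le : Ex_lyap 0 <= 4 * sqnorm xm1
  + (4 * h ^+ 2 + 2 * h ^+ 2 / rho) * sqnorm (gradF f xm1)
  + 4 * h ^+ 2 * (n%:R * sigma ^+ 2).
Proof.
have r0 := gap_gt0 net; have r1 := gap_le n2 net.
set gx := gradF f xm1.
pose q w := sqnorm xm1 + h ^+ 2 * sqnorm gx + h ^+ 2 * sqnorm (N 0 w).
have hG w : xq 1 w = xm1 - h *: gx - h *: N 0 w.
  rewrite /xq /= -/(sgrad W oracle alpha h xm1 H0 (z w) 0) /N /noise.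
  rewrite -/gx; move: (sgrad _ _ _ _ _ _ _ _) => S.
  by apply/matrixP => i j; rewrite !mxE; ring.
have p1 w : sqnorm (xq 1 w) <= 3 * q w.
  have := sqnormD_le3 xm1 (- (h *: gx)) (- (h *: N 0 w)).
  by rewrite hG !sqnormN !sqnormZ /q.
have p2 w : sqnorm (mg 1 w) <= 2 * sqnorm gx + 6 * L ^+ 2 * q w.
  have h1 : sqnorm (mg 1 w - gx) <= 3 * L ^+ 2 * q w.
    apply: (le_trans (gradF_lipschitz L0 sm _ _)).
    have -> : 3 * L ^+ 2 * q w = L ^+ 2 * (3 * q w) by ring.
    apply: (ler_wpM2l (sqr_ge0 L)).
    rewrite -avg_mx_mul -/(xq 1 w) hG !mulmxBr -!scalemxAr.
    have lJ (X : 'M[R]_(n, p)) : sqnorm (avg_mx *m X) <= sqnorm X.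
      by rewrite avg_mx_mul sqnorm_spread// sqnorm_rowmean_le.
    have -> : avg_mx *m xm1 - h *: (avg_mx *m gx) - h *: (avg_mx *m N 0 w) - xm1 =
      - cen xm1 + - (h *: (avg_mx *m gx)) + - (h *: (avg_mx *m N 0 w)).
      rewrite /cen; move: (avg_mx *m xm1) (avg_mx *m gx) (avg_mx *m _) => u v y.
      by apply/matrixP => i j; rewrite !mxE; ring.
    apply: (le_trans (sqnormD_le3 _ _ _)); rewrite !sqnormN !sqnormZ.
    rewrite ler_pM2l// /q !lerD//.
    - exact: sqnorm_cen_le.
    - by rewrite ler_wpM2l ?sqr_ge0.
    - by rewrite ler_wpM2l ?sqr_ge0.
  by have := sqnormD_le2 (mg 1 w - gx) gx; rewrite subrK; lra.
have hL2 : h ^+ 2 * L ^+ 2 <= rho ^+ 2 / 256.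
  rewrite -exprMn (_ : rho ^+ 2 / 256 = (rho / 16) ^+ 2); last by field.
  rewrite ler_pXn2r ?nnegrE//; first exact: mulr_ge0 h0 (ltW L0).
  by rewrite divr_ge0// ltW.
have q0 w : 0 <= q w.
  by rewrite !addr_ge0 ?mulr_ge0 ?sqr_ge0 ?sqnorm_ge0.
pose r w := 4 * sqnorm xm1 + (4 * h ^+ 2 + 2 * h ^+ 2 / rho) * sqnorm gx +
  4 * h ^+ 2 * sqnorm (N 0 w).
have p3 w : lyap_path f W oracle alpha h xm1 H0 (z w) B 0 <= r w.
  apply: (le_trans (lyap_path0_le f n2 net oracle alpha h xm1 H0 (z w) MB JB)).
  rewrite -/(xq 1 w) -/(mg 1 w).
  have h1 : sqnorm (cen (xq 1 w)) <= 3 * q w.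
    exact: le_trans (sqnorm_cen_le n0 _) (p1 w).
  have h2 : rho^-1 * (h ^+ 2 * sqnorm (mg 1 w)) <=
      2 * h ^+ 2 / rho * sqnorm gx + q w.
    have : rho^-1 * (h ^+ 2 * sqnorm (mg 1 w)) <=
        rho^-1 * (h ^+ 2 * (2 * sqnorm gx + 6 * L ^+ 2 * q w)).
      by rewrite ler_wpM2l ?invr_ge0 ?(ltW r0)// ler_wpM2l ?sqr_ge0.
    move=> /le_trans; apply.
    rewrite (_ : rho^-1 * (h ^+ 2 * (2 * sqnorm gx + 6 * L ^+ 2 * q w)) =
      2 * h ^+ 2 / rho * sqnorm gx + 6 * (h ^+ 2 * L ^+ 2) / rho * q w); last first.
      by field; rewrite gt_eqF.
    rewrite lerD2l ler_piMl// ler_pdivrMr// mul1r.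
    have : rho ^+ 2 <= rho * (1 / 16) by rewrite expr2 ler_wpM2l// ltW.
    lra.
  rewrite /r; move: h1 h2; rewrite /q; lra.
have iN := i_sq (hN 0).
have ir : intble P r.
  by apply: intbleD; [exact: intble_cst|exact: intbleZ].
apply: (le_trans (le_Ex _ _ p3)) => //.
rewrite /r ExD; [|exact: intble_cst|exact: intbleZ].
rewrite Ex_cst ExZ// lerD2l ler_wpM2l ?Ex_N//.
by rewrite mulr_ge0 ?sqr_ge0.
Qed.

End OneRun.

(** * From the expected inequalities to the rate *)

Section Arithmetic.
Context {R : realType}.

(** Here A, B, C and V stand for sums over the run of the expected squared gradients
at the mean, squared mean gradients, consensus errors and Lyapunov values.
Insert the bound on V into the descent inequality: with t = (h L)^2 <=
rho^2 / 256, the resulting multiple 20 t^2 / rho^3 of B is at most 1 - L h, so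
the negative multiple of B absorbs it, and the other contributions of the
Lyapunov recursion are at most multiples of K t sigma^2 / rho and n / rho. *)
Lemma stationarity_bound (L sigma Delta rho n K h cx cg A B C V v0 c0 : R) :
  0 < L -> 0 < rho -> rho <= 1 / 16 -> 2 <= n -> 1 <= K -> 0 < h ->
  h * L <= rho / 16 -> 0 <= B -> 0 <= cx -> 0 <= cg ->
  h / 2 * A + h / 2 * (1 - L * h) * B <= Delta
    + h * L ^+ 2 / (2 * n) * (c0 + C)
    + (K + 1) * (L * h ^+ 2 / 2 * (sigma ^+ 2 / n)) ->
  C <= V ->
  rho / 4 * V <= v0 + K * (h ^+ 2 * (n * sigma ^+ 2))
    + 5 * h ^+ 4 * L ^+ 2 / rho ^+ 2 * (n * B + K * sigma ^+ 2) ->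
  c0 <= cx * n ^+ 2 ->
  v0 <= 4 * cx * n ^+ 2 + cg * n ^+ 2 / L ^+ 2 + 4 * h ^+ 2 * (n * sigma ^+ 2) ->
  A <= 2 * Delta / h + 2 * (K * (L * h * sigma ^+ 2 / n))
    + n / rho * (17 * L ^+ 2 * cx + 4 * cg)
    + 25 * (K * (h ^+ 2 * L ^+ 2 * sigma ^+ 2 / rho)).
Proof.
move=> L0 r0 r1 n2 K1 h0 hL B0 cx0 cg0 descent CV Vle c0le v0le.
have n0 : 0 < n by lra.
have nn : 0 <= n by lra. have K0 : 0 <= K by lra.
have rr : 0 <= rho by lra. have LL : 0 <= L by lra. have hh : 0 <= h by lra.
have sq0 : 0 <= sigma ^+ 2 by exact: sqr_ge0.
pose t := h ^+ 2 * L ^+ 2.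
have t0 : 0 <= t by rewrite mulr_ge0 ?sqr_ge0.
have tle : t <= rho ^+ 2 / 256.
  rewrite /t -exprMn (_ : rho ^+ 2 / 256 = (rho / 16) ^+ 2); last by field.
  by rewrite ler_pXn2r ?nnegrE//; [exact/ltW/mulr_gt0|rewrite divr_ge0// ltW].
(* the descent inequality divided by h / 2 *)
have h1 : A <= 2 * Delta / h - (1 - L * h) * B + L ^+ 2 / n * (c0 + C)
    + (K + 1) * (L * h * sigma ^+ 2 / n).
  rewrite -(ler_pM2l (divr_gt0 h0 (ltr0Sn R 1))).
  rewrite [leRHS](_ : _ = Delta
    + h * L ^+ 2 / (2 * n) * (c0 + C)
    + (K + 1) * (L * h ^+ 2 / 2 * (sigma ^+ 2 / n))
    - h / 2 * (1 - L * h) * B); first by lra.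
  by field; rewrite !gt_eqF.
(* the Lyapunov recursion multiplied by 4 L^2 / (rho n) *)
have h2 : L ^+ 2 / n * C <= 16 * (L ^+ 2 * cx * (n / rho)) + 4 * cg * (n / rho)
    + 16 * (t * sigma ^+ 2 / rho) + 4 * (K * (t * sigma ^+ 2 / rho))
    + 20 * t ^+ 2 / rho ^+ 3 * B + 20 * t ^+ 2 / rho ^+ 3 * (K * sigma ^+ 2 / n).
  have c4 : 0 <= 4 * L ^+ 2 / (rho * n).
    by rewrite divr_ge0// ?mulr_ge0 ?sqr_ge0// ltW.
  have := ler_wpM2l c4 Vle; have := ler_wpM2l c4 v0le.
  have : L ^+ 2 / n * C <= L ^+ 2 / n * V.
    by rewrite ler_wpM2l// divr_ge0 ?sqr_ge0// ltW.
  have -> : 4 * L ^+ 2 / (rho * n) * (rho / 4 * V) = L ^+ 2 / n * V.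
    by field; rewrite !gt_eqF.
  have -> : 4 * L ^+ 2 / (rho * n) * (v0 + K * (h ^+ 2 * (n * sigma ^+ 2))
    + 5 * h ^+ 4 * L ^+ 2 / rho ^+ 2 * (n * B + K * sigma ^+ 2)) =
    4 * L ^+ 2 / (rho * n) * v0 + 4 * (K * (t * sigma ^+ 2 / rho))
    + 20 * t ^+ 2 / rho ^+ 3 * B + 20 * t ^+ 2 / rho ^+ 3 * (K * sigma ^+ 2 / n).
    by rewrite /t; field; rewrite !gt_eqF.
  have -> : 4 * L ^+ 2 / (rho * n) * (4 * cx * n ^+ 2 + cg * n ^+ 2 / L ^+ 2
    + 4 * h ^+ 2 * (n * sigma ^+ 2)) =
    16 * (L ^+ 2 * cx * (n / rho)) + 4 * cg * (n / rho) + 16 * (t * sigma ^+ 2 / rho).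
    by rewrite /t; field; rewrite !gt_eqF.
  by move: (L ^+ 2 / n * C) (L ^+ 2 / n * V) (4 * L ^+ 2 / (rho * n) * v0)
    (20 * t ^+ 2 / rho ^+ 3 * B) (20 * t ^+ 2 / rho ^+ 3 * (K * sigma ^+ 2 / n))
     => *; lra.
have t2 : 20 * t ^+ 2 / rho ^+ 3 <= 20 / 256 * (t / rho).
  rewrite (_ : 20 * t ^+ 2 / rho ^+ 3 = 20 * (t / rho) * (t / rho ^+ 2)); last first.
    by field; rewrite gt_eqF.
  have tr : t / rho ^+ 2 <= 1 / 256.
    by rewrite ler_pdivrMr ?exprn_gt0//; lra.
  rewrite [leRHS](_ : _ = 20 * (t / rho) * (1 / 256)); last by field; rewrite gt_eqF.
  by rewrite ler_wpM2l// mulr_ge0// divr_ge0// ltW.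
have tr1 : t / rho <= 1 / 256.
  rewrite ler_pdivrMr//; have : rho ^+ 2 <= rho * (1 / 16).
    by rewrite expr2 ler_wpM2l// ltW.
  lra.
have h3 : 20 * t ^+ 2 / rho ^+ 3 * B <= (1 - L * h) * B.
  by rewrite ler_wpM2r//; lra.
have h4 : 20 * t ^+ 2 / rho ^+ 3 * (K * sigma ^+ 2 / n) <=
    K * (t * sigma ^+ 2 / rho).
  have k0 : 0 <= K * sigma ^+ 2 / n.
    exact: divr_ge0 (mulr_ge0 K0 sq0) nn.
  apply: (le_trans (ler_wpM2r k0 t2)).
  rewrite (_ : 20 / 256 * (t / rho) * (K * sigma ^+ 2 / n) =
    K * (t * sigma ^+ 2 / rho) * (20 / 256 / n)); last by field; rewrite !gt_eqF.
  apply: ler_piMr; last by rewrite ler_pdivrMr//; lra.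
  exact: mulr_ge0 K0 (divr_ge0 (mulr_ge0 t0 sq0) rr).
have h5 : L ^+ 2 / n * c0 <= L ^+ 2 * cx * (n / rho).
  apply: (@le_trans _ _ (L ^+ 2 / n * (cx * n ^+ 2))).
    by rewrite ler_wpM2l// divr_ge0 ?sqr_ge0// ltW.
  rewrite (_ : _ / n * _ = L ^+ 2 * cx * n); last by field; rewrite gt_eqF.
  rewrite ler_wpM2l ?mulr_ge0 ?sqr_ge0// ler_pdivlMr// ler_piMr//; lra.
have h6 : t * sigma ^+ 2 / rho <= K * (t * sigma ^+ 2 / rho).
  by rewrite ler_peMl//; exact: divr_ge0 (mulr_ge0 t0 sq0) rr.
have h7 : (K + 1) * (L * h * sigma ^+ 2 / n) <= 2 * (K * (L * h * sigma ^+ 2 / n)).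
  rewrite [leRHS]mulrA ler_wpM2r//; last by lra.
  exact: divr_ge0 (mulr_ge0 (mulr_ge0 LL hh) sq0) nn.
rewrite (_ : n / rho * (17 * L ^+ 2 * cx + 4 * cg) =
  17 * (L ^+ 2 * cx * (n / rho)) + 4 * cg * (n / rho)); last by ring.
have k0 : 0 <= K * (t * sigma ^+ 2 / rho).
  exact: mulr_ge0 K0 (divr_ge0 (mulr_ge0 t0 sq0) rr).
rewrite mulrDr in h1; rewrite -/t.
move: (K * (t * sigma ^+ 2 / rho)) (t * sigma ^+ 2 / rho) k0 h2 h4 h6 => x1 x2 k0 h2 h4 h6.
move: (20 * t ^+ 2 / rho ^+ 3 * B) (20 * t ^+ 2 / rho ^+ 3 * _) h2 h3 h4 => x3 x4 h2 h3 h4.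
move: ((1 - L * h) * B) (L ^+ 2 / n * c0) (L ^+ 2 / n * C) h1 h2 h3 h5 => x5 x6 x7 h1 h2 h3 h5.
move: (2 * Delta / h) ((K + 1) * _) (K * (L * h * _ / n)) h1 h7 => x8 x9 x10 h1 h7.
lra.
Qed.

(** The stepsize is 1 / (r + 16 L / rho), where r balances Delta / h against
K L h sigma^2 / n, so both are of order Delta r, up to L Delta / rho.  The
consensus noise K h^2 L^2 sigma^2 / rho is only of order n L Delta / rho, as
h r <= 1. *)
Lemma stepsize_bound (L sigma Delta rho n K h r c : R) :
  0 < L -> 0 < sigma -> 0 < Delta -> 0 < rho -> 2 <= n -> 1 <= K -> 0 < r ->
  r ^+ 2 = L * sigma ^+ 2 * K / (n * Delta) ->
  h = (r + 16 * L / rho)^-1 ->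
  2 * Delta / h + 2 * (K * (L * h * sigma ^+ 2 / n)) + n / rho * c
    + 25 * (K * (h ^+ 2 * L ^+ 2 * sigma ^+ 2 / rho)) <=
  4 * Delta * r + n / rho * (41 * L * Delta + c).
Proof.
move=> L0 s0 D0 rho0 n2 K1 r0 r2 hE.
have n0 : 0 < n by lra.
have Lr0 : 0 < 16 * L / rho by rewrite divr_gt0// mulr_gt0.
have h0 : 0 < h by rewrite hE invr_gt0 addr_gt0.
have hr : h * r <= 1.
  by rewrite hE mulrC ler_pdivrMr ?addr_gt0// mul1r lerDl ltW.
have h1 : 2 * Delta / h = 2 * Delta * r + 32 * (L * Delta / rho).
  by rewrite hE invrK; field; rewrite gt_eqF.
have KL : K * L * sigma ^+ 2 / n = Delta * r ^+ 2.
  by rewrite r2; field; rewrite !gt_eqF.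
have h2 : K * (L * h * sigma ^+ 2 / n) <= Delta * r.
  rewrite (_ : _ * _ = (K * L * sigma ^+ 2 / n) * h); last by field; rewrite gt_eqF.
  rewrite KL (_ : _ * h = Delta * r * (h * r)); last by ring.
  by rewrite ler_piMr// mulr_ge0// ltW.
have h3 : K * (h ^+ 2 * L ^+ 2 * sigma ^+ 2 / rho) <= n / rho * (L * Delta).
  rewrite (_ : K * _ = (K * L * sigma ^+ 2 / n) * (h ^+ 2 * L * (n / rho))); last first.
    by field; rewrite !gt_eqF.
  rewrite KL (_ : _ * _ = n / rho * (L * Delta) * (h * r) ^+ 2); last by ring.
  rewrite ler_piMr//; first by rewrite !mulr_ge0 ?invr_ge0// ltW.
  by rewrite exprn_ile1// mulr_ge0// ltW.
have h4 : 2 * (L * Delta / rho) <= n / rho * (L * Delta).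
  rewrite (_ : n / rho * _ = n * (L * Delta / rho)); last by field; rewrite gt_eqF.
  by rewrite ler_wpM2r// divr_ge0 ?mulr_ge0// ltW.
rewrite h1 [leRHS](_ : _ = 4 * (Delta * r) + 41 * (n / rho * (L * Delta)) + n / rho * c); last by ring.
move: (K * (L * h * sigma ^+ 2 / n)) (K * (h ^+ 2 * L ^+ 2 * sigma ^+ 2 / rho))
  h2 h3 => x1 x2 h2 h3.
rewrite -mulrA; lra.
Qed.

(** By the choice of r, Delta r sqrt (n K) = sqrt (L Delta) sigma K, so the first
term has the required order for every K; the second is at most 1 / sqrt (n K)
exactly from the threshold on. *)
Lemma transient_bound (L sigma Delta rho n K r C : R) :
  0 < L -> 0 < sigma -> 0 < Delta -> 0 < rho -> 2 <= n -> 1 <= K -> 0 < r ->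
  r ^+ 2 = L * sigma ^+ 2 * K / (n * Delta) -> 0 <= C ->
  C ^+ 2 * n ^+ 3 / rho ^+ 2 <= K ->
  K^-1 * (4 * Delta * r + n / rho * C) <=
  (4 * Num.sqrt (L * Delta) * sigma + 1) / Num.sqrt (n * K).
Proof.
move=> L0 s0 D0 rho0 n2 K1 r0 r2 C0 KC.
have n0 : 0 < n by lra. have K0 : 0 < K by lra.
set q := Num.sqrt (n * K).
have q0 : 0 < q by rewrite sqrtr_gt0 mulr_gt0.
have q2 : q ^+ 2 = n * K by rewrite sqr_sqrtr// mulr_ge0// ltW.
set u := Num.sqrt (L * Delta).
have u0 : 0 < u by rewrite sqrtr_gt0 mulr_gt0.
have u2 : u ^+ 2 = L * Delta by rewrite sqr_sqrtr// mulr_ge0// ltW.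
have e1 : Delta * r * q = u * sigma * K.
  apply/eqP; rewrite -(@eqrXn2 _ 2)// ?mulr_ge0 ?ltW//; apply/eqP.
  rewrite !exprMn r2 q2 u2; field; rewrite !gt_eqF//.
have e2 : n / rho * C * q <= K.
  rewrite -(@ler_pXn2r _ 2)// ?nnegrE; last 2 first.
  - by rewrite !mulr_ge0// ?invr_ge0 ltW.
  - exact: ltW.
  rewrite !exprMn q2 [leLHS](_ : _ = C ^+ 2 * n ^+ 3 / rho ^+ 2 * K).
    by rewrite [leRHS]expr2; apply: ler_wpM2r => //; exact: ltW.
  by field; rewrite gt_eqF.
rewrite ler_pdivlMr// -[leLHS]mulrA ler_pdivrMl//.
have -> : (4 * Delta * r + n / rho * C) * q = 4 * (Delta * r * q) + n / rho * C * q.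
  by ring.
rewrite e1; lra.
Qed.

(** Summation of the recursion for v over the run.  The sums on the left of the
descent inequality include the initial query, which is not an iterate; its terms
are nonnegative and are dropped. *)
Lemma stationarity_sum (L sigma Delta rho n h cx cg : R) (K : nat)
  (a b c v : nat -> R) :
  0 < L -> 0 < rho -> rho <= 1 / 16 -> 2 <= n -> (0 < K)%N -> 0 < h ->
  h * L <= rho / 16 -> 0 <= cx -> 0 <= cg ->
  (forall s, 0 <= a s) -> (forall s, 0 <= b s) -> (forall k, 0 <= v k) ->
  \sum_(s < K.+1) (h / 2 * a s + h / 2 * (1 - L * h) * b s) <= Delta
    + h * L ^+ 2 / (2 * n) * \sum_(s < K.+1) c s
    + K.+1%:R * (L * h ^+ 2 / 2 * (sigma ^+ 2 / n)) ->
  (forall k, c k.+1 <= v k) ->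
  (forall k, v k.+1 <= (1 - rho / 4) * v k + h ^+ 2 * (n * sigma ^+ 2)
    + 5 * h ^+ 4 * L ^+ 2 / rho ^+ 2 * (n * b k.+1 + sigma ^+ 2)) ->
  c 0%N <= cx * n ^+ 2 ->
  v 0%N <= 4 * cx * n ^+ 2 + cg * n ^+ 2 / L ^+ 2
    + 4 * h ^+ 2 * (n * sigma ^+ 2) ->
  \sum_(t < K) a t.+1 <=
    2 * Delta / h + 2 * (K%:R * (L * h * sigma ^+ 2 / n))
    + n / rho * (17 * L ^+ 2 * cx + 4 * cg)
    + 25 * (K%:R * (h ^+ 2 * L ^+ 2 * sigma ^+ 2 / rho)).
Proof.
move=> L0 r0 r1 n2 K0 h0 hL cx0 cg0 a_ge0 b_ge0 v_ge0 desc cv step c0le v0le.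
set kap := 5 * h ^+ 4 * L ^+ 2 / rho ^+ 2 in step.
have tel : rho / 4 * \sum_(k < K) v k <= v 0%N
    + K%:R * (h ^+ 2 * (n * sigma ^+ 2))
    + kap * (n * \sum_(k < K) b k.+1 + K%:R * sigma ^+ 2).
  suff : rho / 4 * \sum_(k < K) v k + v K <= v 0%N
    + K%:R * (h ^+ 2 * (n * sigma ^+ 2))
    + kap * (n * \sum_(k < K) b k.+1 + K%:R * sigma ^+ 2).
    by have := v_ge0 K; lra.
  clear -step; move: kap (h ^+ 2 * _) step => kap x step.
  elim: K => [|k IH]; first by rewrite !big_ord0; lra.
  by rewrite !big_ord_recr /= -[k.+1%:R]natr1; have := step k; lra.
have K1 : 1 <= K%:R :> R by rewrite ler1n.
apply: (@stationarity_bound L sigma Delta rho n K%:R h cx cg _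
  (\sum_(k < K) b k.+1) (\sum_(k < K) c k.+1) (\sum_(k < K) v k) (v 0%N)
  (c 0%N)) => //.
- by apply: sumr_ge0 => k _; exact: b_ge0.
- move: desc; rewrite [X in X <= _]big_ord_recl [in leRHS]big_ord_recl /=.
  rewrite big_split /= -!mulr_sumr -[K.+1%:R]natr1.
  have t1 : 0 <= h / 2 * a 0%N by rewrite mulr_ge0// divr_ge0// ltW.
  have t2 : 0 <= h / 2 * (1 - L * h) * b 0%N.
    rewrite mulr_ge0// mulr_ge0 ?divr_ge0//; first exact: ltW.
    by rewrite mulrC; lra.
  have -> : \sum_(i < K) a (bump 0 i) = \sum_(i < K) a i.+1 by [].
  have -> : \sum_(i < K) b (bump 0 i) = \sum_(i < K) b i.+1 by [].
  have -> : \sum_(i < K) c (bump 0 i) = \sum_(i < K) c i.+1 by [].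
  move: (h / 2 * a 0%N) (h / 2 * (1 - L * h) * b 0%N) t1 t2 => x1 x2 t1 t2.
  move: (\sum_(i < K) a i.+1) (\sum_(i < K) b i.+1) (\sum_(i < K) c i.+1) (c 0%N).
  by move=> x3 x4 x5 x6; lra.
- by apply: ler_sum => k _; exact: cv.
Qed.

End Arithmetic.

Section Horizon.
Context {R : realType} {n p : nat} {d dX : measure_display}
  {T : measurableType d}.
Variables (P : probability T R) (f : 'I_n -> 'rV[R]_p -> R) (L sigma : R).
Variables (e : rel 'I_n) (W : 'M[R]_n) (lam : n.-tuple R).
Variables (Xi : 'I_n -> measurableType dX).
Variables (oracle : forall i, 'rV[R]_p -> Xi i -> 'rV[R]_p) (alpha h : R).
Variables (xm1 H0 : 'M[R]_(n, p)) (xi : forall i, nat -> T -> Xi i).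
Hypotheses (n2 : (2 <= n)%N) (L0 : 0 < L) (sm : smooth f L).
Hypothesis df : forall i x, differentiable (f i) x.
Hypothesis net : network e W lam.
Hypothesis moracle : measurable_oracle oracle.
Hypothesis mxi : forall i s, measurable_fun setT (xi i s).
Let xq s w := cedas_query idfun W alpha (1 / 8) (fun=> h) oracle xm1 H0
  (fun s i => xi i s w) s.
Hypothesis sg : stochastic_gradient P f oracle sigma xq xi.
Hypotheses (h0 : 0 < h) (hL : h * L <= gap lam / 16).
Hypothesis lb : has_lbound (range (favg f)).
Notation rho := (gap lam).

Let a s := Ex_grad P f W oracle alpha h xm1 H0 xi s.

Lemma stationarity_run (K : nat) (cx cg : R) : (0 < K)%N ->
  sqnorm xm1 <= cx * n%:R ^+ 2 -> sqnorm (gradF f xm1) <= cg * n%:R ^+ 2 ->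
  0 <= cx -> 0 <= cg ->
  \sum_(t < K) a t.+1 <=
    2 * (favg f (rowmean xm1) - finf f) / h
    + 2 * (K%:R * (L * h * sigma ^+ 2 / n%:R))
    + n%:R / rho * (17 * L ^+ 2 * cx + 4 * cg)
    + 25 * (K%:R * (h ^+ 2 * L ^+ 2 * sigma ^+ 2 / rho)).
Proof.
move=> K0 xle gle cx0 cg0.
have r0 := gap_gt0 net; have r1 := gap_le n2 net.
have n0 : (0 < n)%N by exact: ltnW.
have [B [Bsym MB JB]] := ex_pseudo_inverse (gossip_sym net) (@avg_mx_tr _ _)
  (avg_mx_idem n0) (gossip_avg net) r0 (gossip_ge n2 net).
pose b s := Ex_mean_grad P f W oracle alpha h xm1 H0 xi s.
pose c s := Ex_consensus P W oracle alpha h xm1 H0 xi s.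
pose v k := Ex_lyap P f W oracle alpha h xm1 H0 xi B k.
have h0' := ltW h0.
have desc := descent_Ex n2 L0 sm df net moracle mxi sg h0' K.+1 lb.
have step k : v k.+1 <= (1 - rho / 4) * v k + h ^+ 2 * (n%:R * sigma ^+ 2)
    + 5 * h ^+ 4 * L ^+ 2 / rho ^+ 2 * (n%:R * b k.+1 + sigma ^+ 2).
  have hh := Ex_lyap_step n2 L0 sm net moracle mxi sg h0' hL Bsym MB JB k.
  exact: hh.
have v0le := Ex_lyap0_le n2 L0 sm net moracle mxi sg h0' hL MB JB.
have cv k : c k.+1 <= v k.
  have hh := Ex_consensus_le n2 L0 sm net moracle mxi sg Bsym MB JB k.
  exact: hh.
have v_ge0 k : 0 <= v k.
  by apply: le_trans (cv k); apply: Ex_ge0 => w; exact: sqnorm_ge0.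
have b_ge0 s : 0 <= b s by apply: Ex_ge0 => w; exact: sqnorm_ge0.
have a_ge0 s : 0 <= a s by apply: Ex_ge0 => w; exact: sqnorm_ge0.
apply: (@stationarity_sum _ L sigma _ rho n%:R h cx cg K a b c v) => //.
- by rewrite ler_nat.
- apply: le_trans xle; rewrite /c /Ex_consensus -[leRHS](Ex_cst P).
  apply: le_Ex; [|exact: intble_cst|].
    by have [_] := L2_cst P (cen xm1).
  by move=> w; exact: sqnorm_cen_le.
- apply: (le_trans v0le).
  have g2 : (4 * h ^+ 2 + 2 * h ^+ 2 / rho) * sqnorm (gradF f xm1) <=
      cg * n%:R ^+ 2 / L ^+ 2.
    have L2 : 0 < L ^+ 2 by rewrite exprn_gt0.
    have t2 : (h ^+ 2) * L ^+ 2 <= rho ^+ 2 / 256.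
      rewrite -exprMn (_ : rho ^+ 2 / 256 = (rho / 16) ^+ 2); last by field.
      by rewrite ler_pXn2r ?nnegrE//; [exact/ltW/mulr_gt0|rewrite divr_ge0// ltW].
    have t3 : (4 * h ^+ 2 + 2 * h ^+ 2 / rho) * L ^+ 2 <= 1.
      rewrite (_ : _ * L ^+ 2 = h ^+ 2 * L ^+ 2 * ((4 * rho + 2) / rho)); last first.
        by field; rewrite gt_eqF.
      apply: (@le_trans _ _ (rho ^+ 2 / 256 * ((4 * rho + 2) / rho))).
        by rewrite ler_wpM2r// divr_ge0// ?ltW//; lra.
      rewrite (_ : _ * _ = (4 * rho ^+ 2 + 2 * rho) / 256); last by field; rewrite gt_eqF.
      have : rho ^+ 2 <= rho * (1 / 16) by rewrite expr2 ler_wpM2l// ltW.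
      lra.
    rewrite ler_pdivlMr// mulrAC; apply: le_trans gle.
    by rewrite ler_piMl// sqnorm_ge0.
  have : 4 * sqnorm xm1 <= 4 * cx * n%:R ^+ 2 by rewrite -mulrA ler_pM2l.
  lra.
Qed.

End Horizon.

(** * The transient time *)

Theorem corollary4 (R : realType) (L sigma Delta0 : R)
  (L_gt0 : 0 < L) (sigma_gt0 : 0 < sigma) (Delta0_gt0 : 0 < Delta0) :
  exists A : R, 0 < A /\
  forall q cx cH cg cl : R, 0 < q ->
  exists B : R, 0 < B /\
  forall (n p : nat) (f : 'I_n -> 'rV[R]_p -> R)
    (e : rel 'I_n) (W : 'M[R]_n) (lam : n.-tuple R)
    (xm1 H0 : 'M[R]_(n, p))
    (dX : measure_display) (Xi : 'I_n -> measurableType dX)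
    (oracle : forall i, 'rV[R]_p -> Xi i -> 'rV[R]_p)
    (d : nat -> measure_display) (T : forall K, measurableType (d K))
    (P : forall K, probability (T K) R)
    (xi : forall K (i : 'I_n), nat -> {RV (P K) >-> Xi i}),
  let lam2 := lam`_1 in
  let alpha : R := 1 / 4 in
  let gamma : R := 1 / 8 in
  let eta K (_ : nat) := cedas_stepsize n L sigma Delta0 gamma lam2 K in
  let sample K w s i := xi K i s w in
  let run K w := cedas idfun W alpha gamma (eta K) oracle xm1 H0 (sample K w) in
  let query K s w :=
    cedas_query idfun W alpha gamma (eta K) oracle xm1 H0 (sample K w) s in
  (2 <= n)%N ->
  (forall i x, differentiable (f i) x) ->
  has_lbound (range (favg f)) ->
  favg f (rowmean xm1) - finf f = Delta0 ->
  smooth f L ->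
  network e W lam ->
  measurable_oracle oracle ->
  (forall K, (0 < K)%N ->
     stochastic_gradient (P K) f oracle sigma (query K) (fun i s => xi K i s)) ->
  sqnorm xm1 <= cx * n%:R ^+ 2 ->
  sqnorm H0 <= cH * n%:R ^+ 2 ->
  sqnorm (gradF f xm1) <= cg * n%:R ^+ 2 ->
  1 / (1 - lam2) <= cl * n%:R `^ q ->
  (transient_time A n
     (fun K => avg_stationarity (P K) f (fun t w => cedas_x (run K w t)) K)
   <= (B * (n%:R ^+ 3 / (1 - lam2) ^+ 2))%:E)%E.
Proof.
exists (4 * Num.sqrt (L * Delta0) * sigma + 1); split.
  by rewrite ltr_wpDl// !mulr_ge0 ?sqrtr_ge0// ltW.
move=> q cx cH cg cl _.
pose C := 41 * L * Delta0 + (17 * L ^+ 2 * `|cx| + 4 * `|cg|).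
have LD0 : 0 < L * Delta0 by rewrite mulr_gt0.
have C0 : 0 <= C by rewrite !addr_ge0 ?mulr_ge0 ?sqr_ge0// ltW.
have B0 : 0 < 256 * C ^+ 2 + 1 by rewrite ltr_wpDl// mulr_ge0 ?sqr_ge0.
exists (256 * C ^+ 2 + 1); split => //.
move=> n p f e W lam xm1 H0 dX Xi oracle d T P xi lam2 alpha gamma eta sample
  run query n2 df lb Delta0E sm net moracle sg xle _ gle _.
have L0 := L_gt0.
have n0 : (0 < n)%N by exact: ltnW.
have nR : 2 <= n%:R :> R by rewrite ler_nat.
have lam_lt1 : lam2 < 1 := network_lam2 net.
have lam_ge0 : 0 <= lam2 := lam2_ge0 n2 net.
have rho0 := gap_gt0 net; have rho1 := gap_le n2 net.
set X := n%:R ^+ 3 / (1 - lam2) ^+ 2.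
have X1 : 1 <= X.
  rewrite ler_pdivlMr ?exprn_gt0 ?subr_gt0// mul1r.
  apply: (@le_trans _ _ 1); first by rewrite exprn_ile1 ?subr_ge0 ?gerBl// ltW.
  by rewrite exprn_ege1//; lra.
(* the first integer above the threshold; the excess 1 is at most X *)
pose K0 := (Num.truncn (256 * C ^+ 2 * X)).+1.
have CX0 : 0 <= 256 * C ^+ 2 * X by apply: mulr_ge0; [exact: mulr_ge0 (sqr_ge0 _)|exact: le_trans X1].
apply: (@le_trans _ _ K0%:R%:E); last first.
  rewrite lee_fin mulrDl mul1r /K0 -natr1 lerD//.
  by rewrite truncn_le.
apply: ereal_inf_lbound; exists K0 => //; split => // k K0k.
have k0 : (0 < k)%N by exact: leq_trans K0k.
have k1 : 1 <= k%:R :> R by rewrite ler1n.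
pose r := Num.sqrt (L * sigma ^+ 2 * k%:R / (n%:R * Delta0)).
have arg0 : 0 < L * sigma ^+ 2 * k%:R / (n%:R * Delta0).
  by rewrite divr_gt0 ?mulr_gt0 ?exprn_gt0 ?ltr0n.
have r0 : 0 < r by rewrite sqrtr_gt0.
have r2 : r ^+ 2 = L * sigma ^+ 2 * k%:R / (n%:R * Delta0).
  by rewrite sqr_sqrtr// ltW.
pose h := eta k 0%N.
(* 32 L / (gamma (1 - lambda_2)) = 256 L / (1 - lambda_2) = 16 L / rho *)
have hE : h = (r + 16 * L / gap lam)^-1.
  rewrite /h /eta /cedas_stepsize -/r /gap /gamma; congr (_ + _)^-1.
  by rewrite -/lam2; field; rewrite subr_eq0 gt_eqF//.
have Lr : 0 < 16 * L / gap lam by rewrite divr_gt0// mulr_gt0.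
have h0 : 0 < h by rewrite hE invr_gt0 addr_gt0.
have hL : h * L <= gap lam / 16.
  rewrite hE mulrC ler_pdivrMr ?addr_gt0// mulrDr.
  rewrite (_ : gap lam / 16 * (16 * L / gap lam) = L); last by field; rewrite gt_eqF.
  apply: ler_wpDl => //; apply: mulr_ge0; last exact: ltW.
  by apply: divr_ge0 => //; exact: ltW.
have mxi i s : measurable_fun setT (xi k i s) by exact: measurable_funPT.
have sgk : stochastic_gradient (P k) f oracle sigma (query k)
  (fun i s => xi k i s) by exact: sg.
have sqle (a b : R) : a <= b * n%:R ^+ 2 -> a <= `|b| * n%:R ^+ 2.
  move=> /le_trans; apply; apply: ler_wpM2r; [exact: sqr_ge0|exact: ler_norm].
have := stationarity_run n2 L_gt0 sm df net moracle mxi sgk h0 hL lb k0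
  (sqle _ _ xle) (sqle _ _ gle) (normr_ge0 _) (normr_ge0 _).
rewrite Delta0E => bound.
have := stepsize_bound (17 * L ^+ 2 * `|cx| + 4 * `|cg|) L_gt0 sigma_gt0
  Delta0_gt0 rho0 nR k1 r0 r2 hE.
move=> /(le_trans bound); rewrite -/C => {}bound.
have CK : C ^+ 2 * n%:R ^+ 3 / gap lam ^+ 2 <= k%:R.
  rewrite (_ : _ / _ = 256 * C ^+ 2 * X); last first.
    by rewrite /X /gap -/lam2; field; rewrite subr_eq0 gt_eqF.
  apply: (@le_trans _ _ K0%:R); last by rewrite ler_nat.
  by rewrite ltW// truncnS_gt.
have := transient_bound L_gt0 sigma_gt0 Delta0_gt0 rho0 nR k1 r0 r2 C0 CK.
have kV0 : 0 <= k%:R^-1 :> R by rewrite invr_ge0.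
move=> /(le_trans (ler_wpM2l kV0 bound)); rewrite natrM -lee_fin.
apply: le_trans; rewrite /avg_stationarity EFinM; apply: lee_wpmul2l => //.
rewrite -sumEFin; apply: lee_sum => t _.
rewrite -(expectation_grad L_gt0 sm df moracle mxi sgk t.+1).
exact: lexx.
Qed.
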